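(* Let $E_n$ be the expected total number of branches in a binary tree chosen uniformly at random among binary trees with $n$ inner nodes. Then, as $n\to\infty$, \[ E_n=\frac{4n}{3}+\frac16\log_4 n-\frac{2\zeta'(-1)}{\log 2}-\frac{\gamma}{12\log2}-\frac{1}{6\log2}+\frac{43}{36}+\delta(\log_4 n)+O\Big(\frac{\log n}{n}\Big), \] where \[ \delta(x)=\frac{1}{\log2}\sum_{k\ne0}\Gamma\Big(\frac{\chi_k}{2}\Big)\zeta(\chi_k-1)(\chi_k-1)e^{2\pi ikx} \] is a $1$-periodic function of mean zero.
   Context: A binary tree is either a leaf $\square$ or an inner node with an ordered pair of subtrees (left, right) which are binary trees; its size is its number of inner nodes. The register function is defined by $\mathrm{Reg}(\square)=0$, and for a tree with subtrees $t_1,t_2$: $\mathrm{Reg}(t)=\max\{\mathrm{Reg}(t_1),\mathrm{Reg}(t_2)\}$ if these differ, and $\mathrm{Reg}(t_1)+1$ otherwise. Label every node (inner node or leaf) by the register function of the subtree rooted at it. An $r$-branch is a maximal chain of nodes labeled $r$, i.e. a connected component (with respect to parent–child edges) of the set of nodes labeled $r$; a branch is an $r$-branch for some $r\ge0$. Here $\gamma$ is the Euler–Mascheroni constant, $\zeta$ the Riemann zeta function, $\Gamma$ the Gamma function, and $\chi_k=\frac{2\pi i k}{\log 2}$ for $k\in\mathbb{Z}$. *)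

(* Defs.v *)
From HB Require Import structures.
From mathcomp Require Import ssreflect ssrfun ssrbool eqtype ssrnat seq choice fintype fingraph binomial.
From Stdlib Require Import Reals.
From Coquelicot Require Import Coquelicot.

Set Implicit Arguments. Unset Strict Implicit. Unset Printing Implicit Defensive.
Local Open Scope nat_scope.

Inductive bintree := Leaf | Node of bintree & bintree.

Fixpoint bintree_eqb (t u : bintree) : bool :=
  match t, u with
  | Leaf, Leaf => true
  | Node l r, Node l' r' => bintree_eqb l l' && bintree_eqb r r'
  | _, _ => false
  end.

Lemma bintree_eqP : Equality.axiom bintree_eqb.
Proof.
elim=> [|l IHl r IHr] [|l' r'] /=; try by constructor.
by apply: (iffP andP) => [[/IHl -> /IHr ->]|[<- <-]]; split; [apply/IHl|apply/IHr].
Qed.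

HB.instance Definition _ := hasDecEq.Build bintree bintree_eqP.

Fixpoint tsize (t : bintree) : nat :=
  match t with Leaf => 0 | Node l r => (tsize l + tsize r).+1 end.

Fixpoint depth (t : bintree) : nat :=
  match t with Leaf => 0 | Node l r => (maxn (depth l) (depth r)).+1 end.

Fixpoint Reg (t : bintree) : nat :=
  match t with
  | Leaf => 0
  | Node l r => let a := Reg l in let b := Reg r in
                if a == b then a.+1 else maxn a b
  end.

(* Nodes (inner nodes and leaves) are addressed by paths from the root:
   a path is a seq bool, false = go left, true = go right; the children of
   the node at path p are at paths rcons p false and rcons p true. *)
Fixpoint subtree_at (t : bintree) (p : seq bool) : option bintree :=
  match p, t with
  | [::], _ => Some t
  | false :: p', Node l _ => subtree_at l p'
  | true :: p', Node _ r => subtree_at r p'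
  | _ :: _, Leaf => None
  end.

Fixpoint nodes (t : bintree) : seq (seq bool) :=
  match t with
  | Leaf => [:: [::]]
  | Node l r => [::] :: map (cons false) (nodes l) ++ map (cons true) (nodes r)
  end.

Definition label (t : bintree) (p : seq bool) : nat :=
  if subtree_at t p is Some s then Reg s else 0.

Definition same_label_edge (t : bintree) : rel (seq_sub (nodes t)) :=
  fun x y =>
    let p := ssval x in let q := ssval y in
    [|| q == rcons p false, q == rcons p true, p == rcons q false
      | p == rcons q true] && (label t p == label t q).

(* Branches: the connected components (w.r.t. parent-child edges) of the sets
   of nodes labelled r, over all r; i.e. the connected components of the graph
   on all nodes whose edges are parent-child pairs with equal labels. *)
Definition branches (t : bintree) : nat :=
  n_comp (@same_label_edge t) (@predT (seq_sub (nodes t))).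

Fixpoint trees_depth (d : nat) : seq bintree :=
  match d with
  | 0 => [:: Leaf]
  | d'.+1 => Leaf :: [seq Node l r | l <- trees_depth d', r <- trees_depth d']
  end.

(* all binary trees with n inner nodes (such a tree has depth <= n) *)
Definition trees (n : nat) : seq bintree :=
  [seq t <- trees_depth n | tsize t == n].

Lemma depth_le_size t : depth t <= tsize t.
Proof.
elim: t => //= l IHl r IHr; rewrite ltnS geq_max.
by rewrite (leq_trans IHl (leq_addr _ _)) (leq_trans IHr (leq_addl _ _)).
Qed.

Lemma mem_trees_depth d t : (t \in trees_depth d) = (depth t <= d).
Proof.
elim: d t => [|d IH] [|l r] //=; rewrite ?inE //.
rewrite ltnS geq_max -!IH.
apply/allpairsP/andP => [[[l' r'] /= [Hl Hr [-> ->]]]|[Hl Hr]]; first by [].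
by exists (l, r).
Qed.

Lemma uniq_trees_depth d : uniq (trees_depth d).
Proof.
elim: d => //= d IH; apply/andP; split.
  by apply/allpairsP => [[[l r] /= [_ _]]].
apply: allpairs_uniq => // [[l r] [l' r']] _ _ /= [-> ->] //.
Qed.

Lemma mem_trees n t : (t \in trees n) = (tsize t == n).
Proof.
rewrite mem_filter mem_trees_depth; case: eqP => //= <-.
exact: depth_le_size.
Qed.

Lemma uniq_trees n : uniq (trees n).
Proof. exact/filter_uniq/uniq_trees_depth. Qed.

Definition E_n (n : nat) : R :=
  (INR (sumn [seq branches t | t <- trees n]) / INR (size (trees n)))%R.

Open Scope R_scope.

Definition Cexp (z : C) : C := (exp (Re z) * cos (Im z), exp (Re z) * sin (Im z)).
Definition Cpow (a : R) (z : C) : C := Cexp (z * RtoC (ln a))%C.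

Definition Clim (u : nat -> C) : C :=
  (real (Lim_seq (fun n => Re (u n))), real (Lim_seq (fun n => Im (u n)))).

Fixpoint Csum (f : nat -> C) (n : nat) : C :=
  match n with 0 => f 0%nat | S m => (Csum f m + f n)%C end.
Fixpoint Cprod (f : nat -> C) (n : nat) : C :=
  match n with 0 => f 0%nat | S m => (Cprod f m * f n)%C end.

Local Open Scope C_scope.
(* Riemann zeta function on C \ {1}, via Hasse's globally convergent series
   zeta(s) = 1/(1-2^(1-s)) sum_{n>=0} 2^{-(n+1)} sum_{k=0}^n (-1)^k C(n,k) (k+1)^{-s} *)
Definition zeta (s : C) : C :=
  / (1 - Cpow 2 (1 - s)) *
  Clim (Csum (fun n => RtoC (/ 2 ^ (S n))%R *
     Csum (fun k => RtoC ((-1) ^ k * INR ('C(n, k)))%R * Cpow (INR (S k)) (- s)) n)).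

(* Euler's Gamma function, via the Gauss limit formula
   Gamma(z) = lim n^z n! / (z (z+1) ... (z+n)) *)
Definition Gamma (z : C) : C :=
  Clim (fun n => Cpow (INR n) z * RtoC (INR (n`!)) / Cprod (fun j => z + RtoC (INR j)) n).

Local Close Scope C_scope.
(* derivative of zeta at -1 (zeta is real on the real axis) *)
Definition zeta'_m1 : R := Derive (fun s => Re (zeta (RtoC s))) (-1).

Definition euler_gamma : R :=
  real (Lim_seq (fun n => sum_n (fun k => / INR (S k)) n - ln (INR (S n)))).

Local Open Scope C_scope.
Definition chi (k : Z) : C := (0, 2 * PI * IZR k / ln 2)%R.

Definition delta_term (x : R) (k : Z) : C :=
  Gamma (chi k / 2) * zeta (chi k - 1) * (chi k - 1) * Cexp (0, 2 * PI * IZR k * x)%R.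

(* delta(x) = 1/log 2 * sum_{k <> 0} ..., summed as lim_N sum_{1<=|k|<=N} *)
Definition delta (x : R) : C :=
  RtoC (/ ln 2)%R *
  Clim (Csum (fun m => delta_term x (Z.of_nat (S m)) + delta_term x (- Z.of_nat (S m))%Z)).

Local Close Scope C_scope.
Definition log4 (x : R) : R := ln x / ln 4.

Definition main_term (n : nat) : R :=
  4 * INR n / 3 + / 6 * log4 (INR n) - 2 * zeta'_m1 / ln 2
  - euler_gamma / (12 * ln 2) - 1 / (6 * ln 2) + 43 / 36.

(* Main.v *)
(* A branch is determined by its lowest node, which is a leaf or an inner node whose two children
   have equal labels. Marking such a node in a tree and substituting z = u/(1+u)^2 gives
     E_n = 4(n+1)/3 - (1/3) sum_l R_l,   R_l = ((n+1) / C(2n,n)) sum_{m>=1} (-1)^(m-1) m D(2^l m),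
   where D is the second difference of k |-> C(2n, n-k). A Gaussian approximation yields
   R_l = a(l ln 4 - ln n) + O(1/n), where a(w) is the alternating sum over m of m h(m e^(w/2)) and h is
   the second derivative of exp(-x^2); the number of relevant l is O(log n). The alternation makes
   every leading term exact: a tends to -1/2 and to 0, exponentially fast, at minus and plus infinity,
   so the sum over l is 1/2 of a logarithm plus a 1-periodic C^1 function of log_4 n, which is the sum of
   its Fourier series. Its Fourier coefficients are values of the two-sided Laplace transform of a';
   by Euler's transformation of the alternating sum this transform is the product of a Gamma integral
   with exactly Hasse's series for the zeta function, and its derivative at 0 gives the mean value. *)

Require Import Defs.
From Stdlib Require Import Reals Lra Lia Psatz ZArith FunctionalExtensionality Factorial PSeries_reg Ranalysis5.
From Coquelicot Require Import Coquelicot.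
From mathcomp Require ssreflect ssrfun ssrbool eqtype ssrnat seq choice fintype fingraph path bigop binomial.
Open Scope R_scope.

(** * Formal power series *)

(** [zeta], [Gamma], [euler_gamma] and [delta] are all defined through [Lim_seq], which assigns a
    value to every sequence, so each evaluation has to come with a proof of convergence. This shapes
    the analytic half. Gauss' product is compared with an integral by a concentration argument.
    Hasse's series converges because the Euler sums of the fluctuation converge under a common
    exponential majorant. The Fourier series converges pointwise in the symmetric order that [delta]
    prescribes. The factor 1/3 and the alternating signs come from v/(1-v)^2 = v/(1+v)^2 + 4
    v^2/(1-v^2)^2 with v = u^(2^r). Applied to all dyadic levels, it trades the counts of marked
    nodes with a given label, which grow linearly in n, for alternating sums that stay bounded.
    Transforms are taken in the strip |Re z| <= 1/4: the imaginary axis carries the Fourier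
    coefficients, and a real neighbourhood of 0 is needed to differentiate zeta at -1. *)

Definition ps := nat -> R.
Definition ps0 : ps := fun _ => 0.
Definition ps1 : ps := fun n => match n with O => 1 | _ => 0 end.
Definition psX : ps := fun n => match n with 1%nat => 1 | _ => 0 end.
Definition psadd (a b : ps) : ps := fun n => a n + b n.
Definition psopp (a : ps) : ps := fun n => - a n.
Definition pssub (a b : ps) : ps := fun n => a n - b n.
Definition pstl (a : ps) : ps := fun n => a (S n).

(** The product peels the first factor, a b = a_0 b + X (tail a) b. The tail rule [pstl_mul] then
    holds by computation, and commutativity and associativity are inductions on n for general
    factors. *)
Fixpoint cauchy (n : nat) (a b : ps) : R :=
  match n with
  | O => a 0%nat * b 0%nat
  | S m => a 0%nat * b n + cauchy m (pstl a) b
  end.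
Definition psmul (a b : ps) : ps := fun n => cauchy n a b.

Lemma ps_ext (a b : ps) : (forall n, a n = b n) -> a = b.
Proof. intros; now apply functional_extensionality. Qed.

Lemma cauchy_add_l n a a' b : cauchy n (psadd a a') b = cauchy n a b + cauchy n a' b.
Proof.
  revert a a'; induction n as [|n IH]; intros a a'; simpl.
  - unfold psadd; ring.
  - replace (pstl (psadd a a')) with (psadd (pstl a) (pstl a')) by reflexivity.
    rewrite IH; unfold psadd; ring.
Qed.

Lemma cauchy_scal_l n c a b : cauchy n (fun k => c * a k) b = c * cauchy n a b.
Proof.
  revert a; induction n as [|n IH]; intros a; simpl.
  - ring.
  - replace (pstl (fun k => c * a k)) with (fun k => c * pstl a k) by reflexivity.
    rewrite IH; ring.
Qed.

Lemma cauchy_S_r n a b : cauchy (S n) a b = b 0%nat * a (S n) + cauchy n a (pstl b).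
Proof.
  revert a; induction n as [|n IH]; intros a.
  - simpl; unfold pstl; ring.
  - change (cauchy (S (S n)) a b) with (a 0%nat * b (S (S n)) + cauchy (S n) (pstl a) b).
    rewrite IH; simpl; unfold pstl; ring.
Qed.

Lemma cauchy_comm n a b : cauchy n a b = cauchy n b a.
Proof.
  revert a b; induction n as [|n IH]; intros a b.
  - simpl; ring.
  - rewrite cauchy_S_r; simpl; now rewrite IH.
Qed.

Lemma pstl_mul a b : pstl (psmul a b) = psadd (fun k => a 0%nat * pstl b k) (psmul (pstl a) b).
Proof. reflexivity. Qed.

Lemma cauchy_assoc n a b c : cauchy n a (psmul b c) = cauchy n (psmul a b) c.
Proof.
  revert a b c; induction n as [|n IH]; intros a b c.
  - simpl; unfold psmul; simpl; ring.
  - simpl (cauchy (S n) a _). simpl (cauchy (S n) (psmul a b) c).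
    rewrite pstl_mul, cauchy_add_l, cauchy_scal_l, <- IH.
    unfold psmul; simpl; ring.
Qed.

Lemma cauchy_1_l n b : cauchy n ps1 b = b n.
Proof.
  destruct n as [|n]; simpl; [ring|].
  replace (cauchy n (pstl ps1) b) with 0; [ring|].
  replace (pstl ps1) with (fun k => 0 * ps1 k).
  - rewrite cauchy_scal_l; ring.
  - apply ps_ext; intros k; unfold pstl; simpl; ring.
Qed.

(** Functional extensionality turns coefficientwise equality into Leibniz equality, so that [ring]
    and [rewrite] apply to series and identities of generating functions reduce to the defining
    equation of u. *)
Lemma ps_ring : ring_theory ps0 ps1 psadd psmul pssub psopp (@eq ps).
Proof.
  constructor; intros; apply ps_ext; intros k;
    unfold psadd, pssub, psopp, ps0; try ring; unfold psmul.
  - apply cauchy_1_l.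
  - apply cauchy_comm.
  - apply cauchy_assoc.
  - apply cauchy_add_l.
Qed.
Add Ring ps_ring_inst : ps_ring.

Lemma psmul_X_0 a : psmul psX a 0%nat = 0.
Proof. unfold psmul; simpl; ring. Qed.

Lemma psmul_X_S a n : psmul psX a (S n) = a n.
Proof.
  unfold psmul; simpl.
  replace (pstl psX) with ps1; [rewrite cauchy_1_l; ring|].
  apply ps_ext; intros [|k]; reflexivity.
Qed.

Fixpoint pspow (a : ps) (k : nat) : ps :=
  match k with O => ps1 | S k => psmul a (pspow a k) end.

Lemma pspow_add a j k : pspow a (j + k) = psmul (pspow a j) (pspow a k).
Proof. induction j; simpl; [ring|rewrite IHj; ring]. Qed.

Lemma psmul_order a b j k : (forall n, (n < j)%nat -> a n = 0) -> (forall n, (n < k)%nat -> b n = 0) ->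
  forall n, (n < j + k)%nat -> psmul a b n = 0.
Proof.
  intros Ha Hb n; revert j a Ha; induction n as [|n IH]; intros j a Ha Hn; unfold psmul; simpl.
  - destruct j as [|j]; [rewrite Hb by lia; ring|rewrite Ha by lia; ring].
  - destruct j as [|j].
    + rewrite Hb by lia. fold (psmul (pstl a) b n). rewrite (IH 0%nat); [ring|intros; lia|lia].
    + rewrite Ha by lia. fold (psmul (pstl a) b n). rewrite (IH j); [ring| |lia].
      intros m Hm; unfold pstl; apply Ha; lia.
Qed.

Lemma pspow_order a k : a 0%nat = 0 -> forall n, (n < k)%nat -> pspow a k n = 0.
Proof.
  intros Ha; induction k as [|k IH]; intros n Hn; [lia|].
  apply (psmul_order a (pspow a k) 1 k); auto.
  intros m Hm; replace m with 0%nat by lia; assumption.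
Qed.

(** Identities between quotients are proved in cross-multiplied form and the denominators cancelled
    here: once the coefficients of b - c below n vanish, the coefficient of a (b - c) at n is a_0 (b
    - c)_n. *)
Lemma ps_cancel a b c : a 0%nat <> 0 -> psmul a b = psmul a c -> b = c.
Proof.
  intros Ha E; apply ps_ext.
  assert (H : forall n, psmul a b n = psmul a c n) by (intros; now rewrite E).
  clear E; intros n; induction n as [n IH] using (well_founded_induction Wf_nat.lt_wf).
  assert (G : psmul a (pssub b c) n = 0).
  { replace (psmul a (pssub b c)) with (pssub (psmul a b) (psmul a c)) by ring.
    unfold pssub; rewrite H; ring. }
  assert (D : forall m, (m < n)%nat -> pssub b c m = 0)
    by (intros m Hm; unfold pssub; rewrite IH by assumption; ring).
  assert (K : a 0%nat * pssub b c n = 0).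
  { rewrite <- G; unfold psmul; destruct n as [|n]; simpl; [ring|].
    fold (psmul (pstl a) (pssub b c) n).
    rewrite (psmul_order (pstl a) (pssub b c) 0 (S n)); [ring|intros; lia|assumption|lia]. }
  apply Rmult_integral in K; destruct K as [K|K]; [contradiction|].
  unfold pssub in K; lra.
Qed.

Lemma ps_cancel_X b c : psmul psX b = psmul psX c -> b = c.
Proof. intros E; apply ps_ext; intros n; rewrite <- (psmul_X_S b), E; apply psmul_X_S. Qed.

Fixpoint geom (a : ps) (N : nat) : ps :=
  match N with O => ps1 | S N => psadd (geom a N) (pspow a (S N)) end.

Lemma geom_mul a N : psmul (pssub ps1 a) (geom a N) = pssub ps1 (pspow a (S N)).
Proof.
  induction N as [|N IH]; [simpl; ring|].
  change (geom a (S N)) with (psadd (geom a N) (pspow a (S N))).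
    transitivity (psadd (psmul (pssub ps1 a) (geom a N)) (psmul (pssub ps1 a) (pspow a (S N)))); [ring|].
  rewrite IH; simpl; ring.
Qed.

(** The inverse of 1 - a when a_0 = 0: powers a^k with k > n do not reach coefficient n, so the
    diagonal of the geometric sums is already the full series. *)
Definition psinv1 (a : ps) : ps := fun n => geom a n n.

Lemma psmul_ext_upto a b c n : (forall m, (m <= n)%nat -> b m = c m) -> psmul a b n = psmul a c n.
Proof.
  intros H.
  enough (E : psmul a (pssub b c) n = 0).
  { assert (F : psmul a (pssub b c) = pssub (psmul a b) (psmul a c)) by ring.
    rewrite F in E; unfold pssub in E; lra. }
  apply (psmul_order a (pssub b c) 0 (S n)); [intros; lia| |lia].
  intros m Hm; unfold pssub; rewrite H by lia; ring.
Qed.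

Lemma psinv1_spec a : a 0%nat = 0 -> psmul (pssub ps1 a) (psinv1 a) = ps1.
Proof.
  intros Ha; apply ps_ext; intros n.
  assert (G : forall m N, (m <= N)%nat -> geom a N m = geom a m m).
  { intros m N Hm; induction N as [|N IH]; [now replace m with 0%nat by lia|].
    destruct (Nat.eq_dec m (S N)) as [->|ne]; [reflexivity|].
    change (geom a (S N) m) with (geom a N m + pspow a (S N) m).
    rewrite IH by lia.
    rewrite (pspow_order a (S N)) by (assumption || lia); ring. }
  rewrite (psmul_ext_upto _ _ (geom a n)) by (intros m Hm; unfold psinv1; symmetry; now apply G).
  rewrite geom_mul; unfold pssub; rewrite (pspow_order a (S n)) by (assumption || lia); ring.
Qed.

(** * Branches and trees *)

Module Import TreeCount.
Import mathcomp.boot.ssreflect mathcomp.boot.ssrfun mathcomp.boot.ssrbool mathcomp.boot.eqtype.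
Import mathcomp.boot.ssrnat mathcomp.boot.seq mathcomp.boot.choice mathcomp.boot.fintype.
Import mathcomp.boot.fingraph mathcomp.boot.path mathcomp.boot.bigop.
Set Implicit Arguments. Unset Strict Implicit. Unset Printing Implicit Defensive.
Local Open Scope nat_scope.

Fixpoint eq_nodes (t : bintree) : nat :=
  if t is Node l r then eq_nodes l + eq_nodes r + (Reg l == Reg r) else 0.

(* The path from the root of [t] to the lowest node of the branch containing the root. *)
Fixpoint bottom (t : bintree) : seq bool :=
  if t is Node l r then
    if Reg l == Reg r then [::]
    else if Reg l < Reg r then true :: bottom r else false :: bottom l
  else [::].

Lemma subtree_at_nil t : subtree_at t [::] = Some t. Proof. by case: t. Qed.

Lemma subtree_at_cat t p q :
  subtree_at t (p ++ q) = obind (fun s => subtree_at s q) (subtree_at t p).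
Proof.
elim: p t => [|d p IH] t /=; first by rewrite subtree_at_nil.
by case: d; case: t => [|l r] //=; rewrite IH.
Qed.

Lemma mem_nodes t p : (p \in nodes t) = (subtree_at t p != None).
Proof.
elim: t p => [|l IHl r IHr] [|d p] //=; first by case: d.
have injc b : injective (cons b) by move=> x y [].
have nm b b' (s : seq (seq bool)) : b != b' -> (b :: p \in map (cons b') s) = false.
  by move=> bb'; apply/mapP => -[x _ [E _]]; rewrite E eqxx in bb'.
case: d; rewrite inE /= mem_cat.
- by rewrite nm //= mem_map ?IHr //; apply: injc.
- by rewrite (nm false true) //= orbF mem_map ?IHl //; apply: injc.
Qed.

Lemma uniq_nodes t : uniq (nodes t).
Proof.
have injc b : injective (cons b : seq bool -> _) by move=> x y [].
elim: t => //= l IHl r IHr; rewrite cat_uniq !map_inj_uniq ?IHl ?IHr //; try exact: injc.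
rewrite mem_cat !andbT /=; apply/andP; split.
  by apply/negP => /orP[] /mapP[].
by apply/hasPn => x /mapP[y _ ->]; apply/negP => /mapP[].
Qed.

(** Two equally labelled children give their parent a strictly larger label, so at most one child
    continues the branch of its parent: a branch is a downward path, and [bottom] follows it. *)
Lemma bottom_child l r (d : bool) :
  Reg (Node l r) = Reg (if d then r else l) ->
  bottom (Node l r) = d :: bottom (if d then r else l).
Proof.
rewrite /=; case: eqP => [E|/eqP N].
  by case: d; rewrite ?E => H; have := n_Sn (Reg r); rewrite -{1}H.
case: ltnP => [lt|ge]; case: d => // E.
  by rewrite E ltnn in lt.
by rewrite E eqxx in N.
Qed.

Lemma bottom_subtree s : exists2 s', subtree_at s (bottom s) = Some s' & bottom s' = [::].
Proof.
elim: s => [|l IHl r IHr] /=; first by exists Leaf.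
case: (boolP (Reg l == Reg r)) => [E|N]; first by exists (Node l r) => //=; rewrite E.
by case: ifP.
Qed.

Definition to_bottom t p := p ++ (if subtree_at t p is Some s then bottom s else [::]).

Lemma subtree_at_rcons t p d :
  subtree_at t (rcons p d) = obind (fun s => subtree_at s [:: d]) (subtree_at t p).
Proof. by rewrite -cats1 subtree_at_cat. Qed.

Lemma to_bottom_child t p d : rcons p d \in nodes t ->
  label t p = label t (rcons p d) -> to_bottom t p = to_bottom t (rcons p d).
Proof.
rewrite mem_nodes /label /to_bottom subtree_at_rcons.
case: (subtree_at t p) => [[|l r]|] /=; [by case: d| |by []].
move=> H E; rewrite cat_rcons; congr (_ ++ _).
have -> : (if d then subtree_at r [::] else subtree_at l [::]) = Some (if d then r else l).
  by case: d {H E}; rewrite subtree_at_nil.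
by apply: (@bottom_child l r d); rewrite [LHS]E; case: d {H E}; rewrite subtree_at_nil.
Qed.

Section Branches.
Variable t : bintree.
Notation T := (seq_sub (nodes t)).
Notation e := (@same_label_edge t).

Lemma to_bottom_edge (x y : T) : e x y -> to_bottom t (ssval x) = to_bottom t (ssval y).
Proof.
case: x y => [p Hp] [q Hq] /andP[/= E /eqP L].
case/or4P: E => /eqP E; subst.
- exact: to_bottom_child.
- exact: to_bottom_child.
- by rewrite [RHS](@to_bottom_child t q false).
- by rewrite [RHS](@to_bottom_child t q true).
Qed.

Lemma same_label_sym : connect_sym e.
Proof.
apply: sym_connect_sym => x y; rewrite /same_label_edge /= [label t (ssval x) == _]eq_sym; congr (_ && _).
by do 4!case: (_ == _).
Qed.

Lemma to_bottom_connect (x y : T) : connect e x y -> to_bottom t (ssval x) = to_bottom t (ssval y).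
Proof.
case/connectP => p; elim: p x => [|z p IH] x /=; first by move=> _ ->.
by case/andP => /to_bottom_edge -> /IH; apply.
Qed.

Lemma connect_to_bottom s (x y : T) : subtree_at t (ssval x) = Some s ->
  ssval y = ssval x ++ bottom s -> connect e x y.
Proof.
elim: s x => [|l IHl r IHr] x Hx /=.
  by rewrite cats0 => E; have -> : y = x by apply: val_inj.
case: (boolP (Reg l == Reg r)) => [E|N].
  by rewrite cats0 => E'; have -> : y = x by apply: val_inj.
case: ifP => L H.
- have Hn : rcons (ssval x) true \in nodes t.
    by rewrite mem_nodes subtree_at_rcons Hx /= subtree_at_nil.
  apply: (@connect_trans _ _ (SeqSub Hn)).
    apply: connect1; rewrite /same_label_edge /= eqxx orbT /= /label subtree_at_rcons Hx /= subtree_at_nil.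
    by rewrite (negbTE N) (maxn_idPr _) // ltnW.
  by apply: IHr; rewrite /= ?subtree_at_rcons ?Hx /= ?subtree_at_nil // cat_rcons.
- have Hn : rcons (ssval x) false \in nodes t.
    by rewrite mem_nodes subtree_at_rcons Hx /= subtree_at_nil.
  apply: (@connect_trans _ _ (SeqSub Hn)).
    apply: connect1; rewrite /same_label_edge /= eqxx /= /label subtree_at_rcons Hx /= subtree_at_nil.
    by rewrite (negbTE N) (maxn_idPl _) // leqNgt L.
  by apply: IHl; rewrite /= ?subtree_at_rcons ?Hx /= ?subtree_at_nil // cat_rcons.
Qed.

Lemma to_bottom_node p : p \in nodes t -> to_bottom t p \in nodes t.
Proof.
rewrite !mem_nodes /to_bottom subtree_at_cat; case: (subtree_at t p) => [s|] //= _.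
by have [s' -> ] := bottom_subtree s.
Qed.

Lemma to_bottom_idem p : p \in nodes t -> to_bottom t (to_bottom t p) = to_bottom t p.
Proof.
rewrite mem_nodes {2}/to_bottom /to_bottom subtree_at_cat; case: (subtree_at t p) => [s|] //= _.
by have [s' -> ->] := bottom_subtree s; rewrite cats0.
Qed.

(** [to_bottom] is constant along edges with equal labels and never leaves the component of its
    argument, so every component contains exactly one fixed point, its lowest node. *)
Lemma branches_count : branches t = count (fun p => to_bottom t p == p) (nodes t).
Proof.
pose F (x : T) : T := SeqSub (to_bottom_node (valP x)).
have cF x : connect e x (F x).
  case: x => p Hp; have := Hp; rewrite mem_nodes; case Es: (subtree_at t p) => [s|] // _.
  by apply: (@connect_to_bottom s) => //=; rewrite /to_bottom Es.
rewrite /branches /n_comp_mem.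
(* Restricted to the representatives chosen by [root], [F] is injective, and its image is the set of
   fixed points of [to_bottom]. *)
have -> : #|[predI roots e & predT]| = #|[pred x : T | to_bottom t (ssval x) == ssval x]|.
  rewrite -(@card_in_image _ _ F) => [|x y].
    apply: eq_card => x; rewrite !inE; apply/imageP/eqP => [[y _ ->]|E] /=.
      by rewrite to_bottom_idem // (valP y).
    exists (root e x); first by rewrite !inE (roots_root same_label_sym).
    apply: val_inj => /=; rewrite -E; apply: to_bottom_connect.
    exact: connect_root.
  rewrite !inE !andbT => /eqP Hx /eqP Hy E.
  rewrite -Hx -Hy; apply/eqP; rewrite (root_connect same_label_sym).
  apply: connect_trans (cF x) _; rewrite E same_label_sym; exact: cF.
rewrite cardE -(size_map (@ssval _ _)) -size_filter; apply: perm_size; apply: uniq_perm.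
- by rewrite map_inj_uniq ?enum_uniq //; exact: val_inj.
- by rewrite filter_uniq // uniq_nodes.
move=> p; rewrite mem_filter; apply/mapP/andP => [[x]|[E Hp]].
  by rewrite mem_enum !inE => /eqP E ->; rewrite E eqxx (valP x).
by exists (SeqSub Hp) => //; rewrite mem_enum !inE.
Qed.
End Branches.

(** The summand [(tsize t).+1] is the number of leaves; each of them ends a branch, besides the
    inner nodes counted by [eq_nodes]. *)
Lemma branchesE t : branches t = (tsize t).+1 + eq_nodes t.
Proof.
rewrite branches_count.
transitivity (count (fun p => if subtree_at t p is Some s then bottom s == [::] else true) (nodes t)).
  apply: eq_count => p; rewrite /to_bottom; case: (subtree_at t p) => [s|]; last by rewrite cats0 eqxx.
  by rewrite -{2}[p]cats0 eqseq_cat // eqxx.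
elim: t => [|l IHl r IHr] //=; rewrite count_cat !count_map /preim /= IHl IHr.
by case: (Reg l =P Reg r) => /= _; [|case: (Reg l < Reg r) => /=]; change addn with Nat.add; Lia.lia.
Qed.

(** * Sums over trees of given size and their generating functions *)

Definition tree_sum (F : bintree -> nat) (n : nat) := \sum_(t <- trees n) F t.

Definition node_prod (G H : bintree -> nat) (t : bintree) :=
  if t is Node l r then G l * H r else 0.

(** Lets the subtrees of a tree with n+1 inner nodes, all listed in [trees_depth n], be regrouped by
    their sizes i and n-i, which is the convolution of the next lemmas. *)
Lemma trees_from_depth n i : i <= n -> perm_eq [seq t <- trees_depth n | tsize t == i] (trees i).
Proof.
move=> le; apply: uniq_perm; rewrite ?uniq_trees ?filter_uniq ?uniq_trees_depth //.
move=> t; rewrite mem_trees mem_filter mem_trees_depth; case: eqP => //= E.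
by rewrite (leq_trans (depth_le_size t)) // E.
Qed.

Lemma tree_sum_node_prod G H n :
  tree_sum (node_prod G H) n.+1 = \sum_(i < n.+1) tree_sum G i * tree_sum H (n - i).
Proof.
rewrite {1}/tree_sum /trees big_filter big_mkcond /= big_cons /= add0n big_allpairs_dep /=.
have E l : \sum_(r <- trees_depth n) (if (tsize l + tsize r).+1 == n.+1 then G l * H r else 0)
  = \sum_(i < n.+1) if tsize l == i then G l * tree_sum H (n - i) else 0.
  case: (ltnP (tsize l) n.+1) => L; last first.
    rewrite !big1 // => [i _|r _].
      by case: eqP => // e; move: L; rewrite e leqNgt ltn_ord.
    rewrite eqSS; case: eqP => // e.
    by move: L; rewrite ltnNge -e leq_addr.
  rewrite [RHS](bigD1 (Ordinal L)) //= eqxx [X in _ + X]big1 ?addn0; last first.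
    by move=> i /eqP ne; case: eqP => // e; exfalso; apply: ne; apply: val_inj.
  rewrite /tree_sum big_distrr /= -(perm_big _ (@trees_from_depth n (n - tsize l) (leq_subr _ _))) /=.
  rewrite big_filter [RHS]big_mkcond; apply: eq_bigr => r _.
  by rewrite eqSS -(eqn_add2l (tsize l) (tsize r)) subnKC.
rewrite (eq_bigr _ (fun l _ => E l)) exchange_big /=; apply: eq_bigr => i _.
have lei : i <= n by rewrite -ltnS ltn_ord.
rewrite [tree_sum G i]/tree_sum big_distrl -(perm_big _ (trees_from_depth lei)).
by rewrite big_filter [RHS]big_mkcond.
Qed.

Lemma tree_sum_node_prod0 G H : tree_sum (node_prod G H) 0 = 0.
Proof. by rewrite /tree_sum /trees big_cons big_nil. Qed.

Fixpoint eq_nodes_at (r : nat) (t : bintree) : nat :=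
  if t is Node t1 t2 then
    eq_nodes_at r t1 + eq_nodes_at r t2 + (Reg t1 == r) * (Reg t2 == r)
  else 0.

Lemma Reg_size t : 2 ^ Reg t <= (tsize t).+1.
Proof.
elim: t => //= l IHl r IHr.
have le_l : 2 ^ Reg l <= (tsize l + tsize r).+2.
  by apply: leq_trans IHl _; rewrite !ltnS (leq_trans (leq_addr (tsize r) _)).
have le_r : 2 ^ Reg r <= (tsize l + tsize r).+2.
  by apply: leq_trans IHr _; rewrite !ltnS (leq_trans (leq_addl (tsize l) _)).
case: eqP => [E|_]; last by case: (leqP (Reg l) (Reg r)).
rewrite expnS mul2n -addnn {2}E; apply: leq_trans (leq_add IHl IHr) _.
by rewrite addSn addnS.
Qed.

(** A label r requires at least 2^r leaves ([Reg_size]). A node whose children are both labelled r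
    has label r+1, so r < L as soon as the tree has fewer than 2^(L+1) leaves. *)
Lemma eq_nodes_sum L t : tsize t + 1 < 2 ^ L.+1 -> eq_nodes t = \sum_(r < L) eq_nodes_at r t.
Proof.
elim: t => [|l IHl r IHr] lt /=; first by rewrite big1.
rewrite !big_split /= -IHl -?IHr; first last.
- by apply: leq_ltn_trans lt; rewrite leq_add2r /= leqW // leq_addr.
- by apply: leq_ltn_trans lt; rewrite leq_add2r /= leqW // leq_addl.
congr (_ + _); case: eqP => [E|N]; last first.
  by rewrite big1 // => i _; case: eqP => // e1; case: eqP => // e2; rewrite e1 e2 in N.
have laplace : Reg l < L.
  have := leq_ltn_trans (Reg_size (Node l r)) (_ : (tsize (Node l r)).+1 < 2 ^ L.+1).
  by rewrite -addn1 => /(_ lt); rewrite /= E eqxx ltn_exp2l.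
rewrite (bigD1 (Ordinal laplace)) //= -E eqxx big1 // => i /eqP ne.
by case: eqP => // e; exfalso; apply: ne; apply: val_inj.
Qed.

Definition gf (F : bintree -> nat) : ps := fun n => INR (tree_sum F n).

Lemma INR_addn m n : INR (m + n) = (INR m + INR n)%R. Proof. exact: plus_INR. Qed.
Lemma INR_muln m n : INR (m * n) = (INR m * INR n)%R. Proof. exact: mult_INR. Qed.

Lemma INR_cauchy (a b : nat -> nat) n :
  INR (\sum_(i < n.+1) a i * b (n - i)) = cauchy n (fun k => INR (a k)) (fun k => INR (b k)).
Proof.
elim: n a => [|n IH] a; first by rewrite big_ord_recl big_ord0 addn0 INR_muln.
by rewrite big_ord_recl INR_addn INR_muln subn0 /= -(IH (fun k => a k.+1)).
Qed.

Lemma gf_ext F G : F =1 G -> gf F = gf G.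
Proof. by move=> E; apply: ps_ext => n; rewrite /gf /tree_sum (eq_bigr _ (fun t _ => E t)). Qed.

Lemma gf_add F G : gf (fun t => F t + G t) = psadd (gf F) (gf G).
Proof. by apply: ps_ext => n; rewrite /gf /tree_sum /psadd big_split INR_addn. Qed.

Lemma gf_node_prod G H : gf (node_prod G H) = psmul psX (psmul (gf G) (gf H)).
Proof.
apply: ps_ext => -[|n]; first by rewrite psmul_X_0 /gf tree_sum_node_prod0.
by rewrite psmul_X_S /gf tree_sum_node_prod INR_cauchy.
Qed.

Definition is_leaf (t : bintree) : nat := if t is Leaf then 1 else 0.

Lemma gf_leaf : gf is_leaf = ps1.
Proof.
apply: ps_ext => -[|n]; first by rewrite /gf /tree_sum /trees big_cons big_nil.
rewrite /gf /tree_sum big_seq big1 // => t; rewrite mem_trees; by case: t.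
Qed.

Definition gf_cat := gf (fun _ => 1).
Definition gf_reg r := gf (fun t => Reg t == r).
Definition gf_reg_lt r := gf (fun t => Reg t < r).

Lemma gf_cat_eq : gf_cat = psadd ps1 (psmul psX (psmul gf_cat gf_cat)).
Proof. by rewrite -gf_node_prod -gf_leaf -gf_add; apply: gf_ext => -[]. Qed.

Lemma gf_reg0 : gf_reg 0 = ps1.
Proof.
rewrite -gf_leaf; apply: gf_ext => -[|l r] //=.
by case: (Reg l) (Reg r) => [|a] [|b] //; rewrite /maxn; do 2?case: ifP.
Qed.

Lemma gf_reg_lt0 : gf_reg_lt 0 = ps0.
Proof. by apply: ps_ext => n; rewrite /gf_reg_lt /gf /tree_sum big1. Qed.

Lemma gf_reg_ltS r : gf_reg_lt r.+1 = psadd (gf_reg_lt r) (gf_reg r).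
Proof.
by rewrite -gf_add; apply: gf_ext => t; rewrite ltnS leq_eqVlt; case: ltngtP.
Qed.

Lemma gf_regS r : gf_reg r.+1 =
  psmul psX (psadd (psmul (gf_reg r) (gf_reg r))
    (psadd (psmul (gf_reg r.+1) (gf_reg_lt r.+1)) (psmul (gf_reg_lt r.+1) (gf_reg r.+1)))).
Proof.
transitivity (psadd (psmul psX (psmul (gf_reg r) (gf_reg r)))
  (psadd (psmul psX (psmul (gf_reg r.+1) (gf_reg_lt r.+1))) (psmul psX (psmul (gf_reg_lt r.+1) (gf_reg r.+1)))));
  last by ring.
rewrite -!gf_node_prod -!gf_add; apply: gf_ext => -[|a b] //=.
move: (Reg a) (Reg b) => x y; rewrite /maxn.
case: (x =P y) => [->|ne]; last case: (@ltP x y) => lt.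
- by do ?[case: eqP => ? //=]; do ?[case: ltP => ? //=]; exfalso; Lia.lia.
- by do ?[case: eqP => ? //=]; do ?[case: ltP => ? //=]; exfalso; Lia.lia.
- by do ?[case: eqP => ? //=]; do ?[case: ltP => ? //=]; exfalso; Lia.lia.
Qed.

Definition gf_eq_at r := gf (eq_nodes_at r).

Lemma gf_eq_at_eq r : gf_eq_at r = psmul psX (psadd (psmul gf_cat (gf_eq_at r))
  (psadd (psmul (gf_eq_at r) gf_cat) (psmul (gf_reg r) (gf_reg r)))).
Proof.
transitivity (psadd (psmul psX (psmul gf_cat (gf_eq_at r)))
  (psadd (psmul psX (psmul (gf_eq_at r) gf_cat)) (psmul psX (psmul (gf_reg r) (gf_reg r)))));
  last by ring.
rewrite -!gf_node_prod -!gf_add; apply: gf_ext => -[|a b] //=.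
by rewrite mul1n muln1 addnA; congr (_ + _); apply: addnC.
Qed.

Lemma size_trees n : INR (size (trees n)) = gf_cat n.
Proof. by rewrite /gf_cat /gf /tree_sum big_const_seq count_predT iter_addn_0 mul1n. Qed.

Lemma INR_sum (F : nat -> nat) L :
  INR (\sum_(r < L.+1) F r) = sum_f_R0 (fun r => INR (F r)) L.
Proof.
elim: L => [|L IH]; first by rewrite big_ord_recr big_ord0.
by rewrite big_ord_recr INR_addn IH.
Qed.

(** The case distinction on L stands for a sum over r < L: [sum_f_R0] always has at least one term
    and cannot express the empty sum. *)
Lemma sumn_branches n L : Peano.lt (n + 1) (Nat.pow 2 (S L)) ->
  INR (sumn [seq branches t | t <- trees n]) =
  ((INR n + 1) * gf_cat n +
   (if L is L'.+1 then sum_f_R0 (fun r => gf_eq_at r n) L' else 0))%R.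
Proof.
have -> : Nat.pow 2 L.+1 = 2 ^ L.+1.
  by elim: (L.+1) => //= k IH; rewrite expnS IH.
move/ltP => lt.
rewrite sumnE big_map (eq_bigr _ (fun t _ => branchesE t)) big_split INR_addn; congr (_ + _)%R.
  rewrite -S_INR -size_trees -INR_muln; congr INR.
  rewrite (eq_big_seq (fun _ => n.+1)) => [|t].
    by rewrite big_const_seq count_predT iter_addn_0.
  by rewrite mem_trees => /eqP ->.
have -> : (if L is L'.+1 then sum_f_R0 (fun r => gf_eq_at r n) L' else 0)%R
    = INR (\sum_(r < L) tree_sum (eq_nodes_at r) n).
  by case: L {lt} => [|L]; [rewrite big_ord0|rewrite (INR_sum (fun r => tree_sum (eq_nodes_at r) n))].
congr INR; rewrite [RHS]exchange_big; apply: eq_big_seq => t; rewrite mem_trees => /eqP E.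
by apply: eq_nodes_sum; rewrite E.
Qed.
End TreeCount.

(** * An exact formula for the expected number of branches *)

Lemma binom_pascal n k : binomial.binomial (S n) (S k) = (binomial.binomial n (S k) + binomial.binomial n k)%nat.
Proof. exact (binomial.binS n k). Qed.

Lemma binom_0_r n : binomial.binomial n 0 = 1%nat.
Proof. exact (binomial.bin0 n). Qed.

Lemma binom_small n : forall k, (n < k)%nat -> binomial.binomial n k = 0%nat.
Proof.
  induction n as [|n IH]; intros [|k] H; try lia; [reflexivity|].
  rewrite binom_pascal, !IH by lia; reflexivity.
Qed.

Lemma binom_shift n k :
  (INR n - INR k) * INR (binomial.binomial n k) = INR (S k) * INR (binomial.binomial n (S k)).
Proof.
  revert k; induction n as [|n IH]; intros k.
  - destruct k as [|k]; [rewrite binom_0_r|rewrite binom_small by lia]; rewrite binom_small by lia; simpl; ring.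
  - destruct k as [|k].
    + rewrite binom_0_r, binom_pascal, binom_0_r, plus_INR.
      specialize (IH 0%nat); rewrite binom_0_r in IH.
      rewrite S_INR. simpl INR in *. lra.
    + rewrite !binom_pascal, !plus_INR.
      pose proof (IH k) as H1; pose proof (IH (S k)) as H2.
      rewrite !S_INR in *. nra.
Qed.

(* [C(2n, n+k)], so that no truncated subtraction occurs. *)
Definition cbin (n k : nat) : R := INR (binomial.binomial (2 * n) (n + k)).

Lemma cbin_shift n k : (INR n - INR k) * cbin n k = (INR n + INR k + 1) * cbin n (S k).
Proof.
  unfold cbin; pose proof (binom_shift (2 * n) (n + k)) as H.
  replace (n + S k)%nat with (S (n + k)) by lia.
  rewrite S_INR, !plus_INR, mult_INR in H. simpl (INR 2) in H.
  rewrite <- H; ring.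
Qed.

Lemma cbin_0 k : cbin 0 k = match k with O => 1 | _ => 0 end.
Proof.
  unfold cbin; destruct k as [|k]; [reflexivity|].
  now rewrite binom_small by (simpl; lia).
Qed.

Lemma cbin_S n k : cbin (S n) (S k) = cbin n k + 2 * cbin n (S k) + cbin n (S (S k)).
Proof.
  unfold cbin.
  replace (2 * S n)%nat with (S (S (2 * n))) by lia.
  replace (S n + S k)%nat with (S (S (n + k))) by lia.
  rewrite !binom_pascal, !plus_INR.
  replace (n + S k)%nat with (S (n + k)) by lia.
  replace (n + S (S k))%nat with (S (S (n + k))) by lia. ring.
Qed.

(** The analogue of [cbin_S] one index lower, folded by the symmetry C(2n, n-1) = C(2n, n+1). Since
    [cbin] has no negative index, it is derived from the ratio relation [cbin_shift]. *)
Lemma cbin_S0 n : cbin (S n) 0 = 2 * cbin n 0 + 2 * cbin n 1.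
Proof.
  pose proof (cbin_shift n 0) as H0.
  pose proof (cbin_shift (S n) 0) as H1. rewrite cbin_S, S_INR in H1. simpl INR in *.
  pose proof (cbin_shift n 1) as H2. simpl INR in H2.
  pose proof (pos_INR n) as Hn.
  apply (Rmult_eq_reg_l (INR n + 1)); [|lra].
  replace ((INR n + 1) * cbin (S n) 0) with ((INR n + 1 - 0) * cbin (S n) 0) by ring.
  rewrite H1. nra.
Qed.

Lemma cbin_pos n : 0 < cbin n 0.
Proof.
  enough (H : forall k, 0 <= cbin n k /\ 0 < cbin n 0) by apply (H 0%nat).
  induction n as [|n IH]; intros k.
  - rewrite !cbin_0; destruct k; lra.
  - split; [unfold cbin; apply pos_INR|].
    rewrite cbin_S0. pose proof (IH 0%nat); pose proof (IH 1%nat); lra.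
Qed.

(* [z = cat_u / (1 + cat_u)^2], where [C = 1 + cat_u] is the Catalan series. *)
Definition cat_u : ps := pssub gf_cat ps1.

Lemma u_eq : psmul psX (psmul (psadd ps1 cat_u) (psadd ps1 cat_u)) = cat_u.
Proof.
  unfold cat_u. replace (psadd ps1 (pssub gf_cat ps1)) with gf_cat by ring.
  rewrite gf_cat_eq at 3. ring.
Qed.

Lemma u_0 : cat_u 0%nat = 0.
Proof. rewrite <- u_eq; apply psmul_X_0. Qed.

Lemma one_plus_0 a : a 0%nat = 0 -> psadd ps1 a 0%nat <> 0.
Proof. intros H; unfold psadd; rewrite H; simpl; lra. Qed.
Lemma one_minus_0 a : a 0%nat = 0 -> pssub ps1 a 0%nat <> 0.
Proof. intros H; unfold pssub; rewrite H; simpl; lra. Qed.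

(** The constant term of u is 0, so [ps_cancel] does not apply directly; u is split as z (1+u)^2 and
    the three factors are cancelled one by one. *)
Lemma u_cancel a b : psmul cat_u a = psmul cat_u b -> a = b.
Proof.
  intros E. rewrite <- u_eq in E.
  apply (ps_cancel (psadd ps1 cat_u)); [apply one_plus_0, u_0|].
  apply (ps_cancel (psadd ps1 cat_u)); [apply one_plus_0, u_0|].
  apply ps_cancel_X.
  transitivity (psmul (psmul psX (psmul (psadd ps1 cat_u) (psadd ps1 cat_u))) a); [ring|].
  rewrite E; ring.
Qed.

(** * Closed forms of the register generating functions in powers of u *)

Definition u_dyadic (r : nat) : ps := pspow cat_u (2 ^ r).

Lemma u_dyadic_S r : u_dyadic (S r) = psmul (u_dyadic r) (u_dyadic r).
Proof. unfold u_dyadic; rewrite <- pspow_add; f_equal; simpl; lia. Qed.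

Lemma u_dyadic_0 r : u_dyadic r 0%nat = 0.
Proof. unfold u_dyadic; apply pspow_order; [apply u_0|]. pose proof (Nat.pow_nonzero 2 r); lia. Qed.

(** Cross-multiplied closed forms. With x = u^(2^r), labels below r give (1+u)/u * (u-x)/(1-x), and
    label r gives (1-u^2)/u * x/(1-x^2). They are proved together because the equation for label r+1
    has the series of smaller labels as coefficient. *)
Lemma gf_reg_solve r :
  psmul (pssub ps1 (u_dyadic r)) (psmul cat_u (gf_reg_lt r)) = psmul (psadd ps1 cat_u) (pssub cat_u (u_dyadic r)) /\
  psmul (pssub ps1 (u_dyadic (S r))) (psmul cat_u (gf_reg r)) = psmul (pssub ps1 (psmul cat_u cat_u)) (u_dyadic r).
Proof.
  induction r as [|r [IHs IHb]].
  - rewrite u_dyadic_S, gf_reg_lt0, gf_reg0. unfold u_dyadic; simpl pspow. split; ring.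
  - rewrite (u_dyadic_S (S r)) in *. rewrite (u_dyadic_S r) in *.
    set (x := u_dyadic r) in *. set (s := gf_reg_lt r) in *. set (b := gf_reg r) in *.
    pose (X := psmul x x). fold X in IHb |- *.
    assert (Hs : psmul (pssub ps1 X) (psmul cat_u (gf_reg_lt (S r))) = psmul (psadd ps1 cat_u) (pssub cat_u X)).
    { rewrite gf_reg_ltS. fold s b.
      transitivity (psadd (psmul (psadd ps1 x) (psmul (pssub ps1 x) (psmul cat_u s)))
                          (psmul (pssub ps1 X) (psmul cat_u b))); [unfold X; ring|].
      rewrite IHs, IHb; unfold X; ring. }
    split; [exact Hs|].
    set (s' := gf_reg_lt (S r)) in *.
    (* By [gf_regS] the series b' of label r+1 solves (1 - 2 z s') b' = z b^2. This is the
       evaluation 1 - 2 z s' = (1-u)(1+X) / ((1+u)(1-X)), in which everything factors. *)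
    assert (K : psmul (psadd ps1 cat_u) (psmul (pssub ps1 X) (pssub ps1 (psmul psX (psadd s' s'))))
              = psmul (pssub ps1 cat_u) (psadd ps1 X)).
    { apply u_cancel.
      transitivity (pssub (psmul cat_u (psmul (psadd ps1 cat_u) (pssub ps1 X)))
        (psmul (psmul psX (psadd ps1 cat_u)) (psadd (psmul (pssub ps1 X) (psmul cat_u s')) (psmul (pssub ps1 X) (psmul cat_u s'))))); [ring|].
      rewrite Hs.
      transitivity (pssub (psmul cat_u (psmul (psadd ps1 cat_u) (pssub ps1 X)))
        (psmul (psmul psX (psmul (psadd ps1 cat_u) (psadd ps1 cat_u))) (psadd (pssub cat_u X) (pssub cat_u X)))); [ring|].
      rewrite u_eq; ring. }
    pose proof (gf_regS r) as Hb. fold s' b in Hb.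
    set (b' := gf_reg (S r)) in *.
    assert (Hb' : psmul (pssub ps1 (psmul psX (psadd s' s'))) b' = psmul psX (psmul b b)).
    { transitivity (pssub b' (psmul psX (psadd (psmul b' s') (psmul s' b')))); [ring|].
      rewrite Hb at 1; ring. }
    apply (ps_cancel (pssub ps1 cat_u)); [apply one_minus_0, u_0|].
    apply u_cancel.
    transitivity (psmul (psmul cat_u cat_u) (psmul (pssub ps1 X) (psmul (psmul (pssub ps1 cat_u) (psadd ps1 X)) b'))); [ring|].
    rewrite <- K.
    transitivity (psmul (psmul cat_u cat_u) (psmul (psmul (pssub ps1 X) (pssub ps1 X)) (psmul (psadd ps1 cat_u)
       (psmul (pssub ps1 (psmul psX (psadd s' s'))) b')))); [ring|].
    rewrite Hb'.
    transitivity (psmul (psmul psX (psadd ps1 cat_u)) (psmul (psmul (pssub ps1 X) (psmul cat_u b)) (psmul (pssub ps1 X) (psmul cat_u b)))); [ring|].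
    rewrite IHb.
    transitivity (psmul (psmul psX (psmul (psadd ps1 cat_u) (psadd ps1 cat_u)))
       (psmul (psmul (pssub ps1 cat_u) (pssub ps1 (psmul cat_u cat_u))) X)); [unfold X; ring|].
    rewrite u_eq; ring.
Qed.

Definition one_sub_usq : ps := pssub ps1 (psmul cat_u cat_u).
(* [(1 - cat_u^2) / cat_u * cat_u^N / (1 - cat_u^N)^2]; [pred N] absorbs the division by [cat_u].
   For [N = 2^(r+1)] it counts the nodes both of whose children are labelled [r]. *)
Definition polar_ps (N : nat) : ps :=
  psmul one_sub_usq (psmul (pspow cat_u (pred N)) (psmul (psinv1 (pspow cat_u N)) (psinv1 (pspow cat_u N)))).
(* The same with a plus sign in the denominator: it expands with alternating coefficients. *)
Definition alt_polar_ps (N : nat) : ps :=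
  psmul one_sub_usq (psmul (pspow cat_u (pred N)) (psmul (psinv1 (psopp (pspow cat_u N))) (psinv1 (psopp (pspow cat_u N))))).

Lemma polar_ps_spec N : (0 < N)%nat -> let Y := pspow cat_u N in
  psmul (psmul (pssub ps1 Y) (pssub ps1 Y)) (polar_ps N) = psmul one_sub_usq (pspow cat_u (pred N)).
Proof.
  intros HN Y. assert (I : psmul (pssub ps1 Y) (psinv1 Y) = ps1).
  { apply psinv1_spec, pspow_order; [apply u_0|lia]. }
  unfold polar_ps; fold Y.
  transitivity (psmul (psmul one_sub_usq (pspow cat_u (pred N)))
     (psmul (psmul (pssub ps1 Y) (psinv1 Y)) (psmul (pssub ps1 Y) (psinv1 Y)))); [ring|].
  rewrite I; ring.
Qed.

Lemma alt_polar_ps_spec N : (0 < N)%nat -> let Y := pspow cat_u N in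
  psmul (psmul (psadd ps1 Y) (psadd ps1 Y)) (alt_polar_ps N) = psmul one_sub_usq (pspow cat_u (pred N)).
Proof.
  intros HN Y. assert (I : psmul (pssub ps1 (psopp Y)) (psinv1 (psopp Y)) = ps1).
  { apply psinv1_spec. unfold psopp, Y. rewrite pspow_order; [ring|apply u_0|lia]. }
  unfold alt_polar_ps; fold Y.
  transitivity (psmul (psmul one_sub_usq (pspow cat_u (pred N)))
     (psmul (psmul (pssub ps1 (psopp Y)) (psinv1 (psopp Y))) (psmul (pssub ps1 (psopp Y)) (psinv1 (psopp Y))))); [ring|].
  rewrite I; ring.
Qed.

Lemma u_pow_pred N : (0 < N)%nat -> pspow cat_u N = psmul cat_u (pspow cat_u (pred N)).
Proof. destruct N; [lia|reflexivity]. Qed.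

(** The identity v/(1-v)^2 = v/(1+v)^2 + 4 v^2/(1-v^2)^2 at v = u^N, multiplied by (1-u^2)/u. The
    double pole at v = 1 is pushed to the exponent 2N, and what remains expands with alternating
    signs. *)
Lemma polar_ps_alt_polar_ps N : (0 < N)%nat ->
  polar_ps N = psadd (alt_polar_ps N) (psmul (psadd (psadd ps1 ps1) (psadd ps1 ps1)) (polar_ps (2 * N))).
Proof.
  intros HN. set (Y := pspow cat_u N).
  assert (HY : Y 0%nat = 0) by (apply pspow_order; [apply u_0|lia]).
  pose proof (polar_ps_spec N HN) as H1; pose proof (alt_polar_ps_spec N HN) as H2;
  pose proof (polar_ps_spec (2 * N) ltac:(lia)) as H3.
  cbv zeta in *. fold Y in H1, H2.
  replace (pspow cat_u (2 * N)) with (psmul Y Y) in H3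
    by (unfold Y; rewrite <- pspow_add; f_equal; lia).
  replace (pred (2 * N)) with (pred N + N)%nat in H3 by lia.
  rewrite pspow_add in H3. fold Y in H3.
  do 2 (apply (ps_cancel (pssub ps1 Y)); [now apply one_minus_0|]).
  do 2 (apply (ps_cancel (psadd ps1 Y)); [now apply one_plus_0|]).
  transitivity (psmul (psmul (psadd ps1 Y) (psadd ps1 Y)) (psmul (psmul (pssub ps1 Y) (pssub ps1 Y)) (polar_ps N))); [ring|].
  rewrite H1.
  transitivity (psadd (psmul (psmul (pssub ps1 Y) (pssub ps1 Y)) (psmul (psmul (psadd ps1 Y) (psadd ps1 Y)) (alt_polar_ps N)))
   (psmul (psadd (psadd ps1 ps1) (psadd ps1 ps1)) (psmul (psmul (pssub ps1 (psmul Y Y)) (pssub ps1 (psmul Y Y))) (polar_ps (2 * N))))); [|ring].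
  rewrite H2, H3; ring.
Qed.

(** The path from the root to a marked node contributes the factor 1/(1 - 2 z C); in terms of u it
    equals (1+u)/(1-u). *)
Lemma one_minus_2XC : psmul (psadd ps1 cat_u) (pssub ps1 (psmul psX (psadd gf_cat gf_cat))) = pssub ps1 cat_u.
Proof.
  replace gf_cat with (psadd ps1 cat_u) by (unfold cat_u; ring).
  transitivity (pssub (psadd ps1 cat_u) (psadd (psmul psX (psmul (psadd ps1 cat_u) (psadd ps1 cat_u)))
    (psmul psX (psmul (psadd ps1 cat_u) (psadd ps1 cat_u))))); [ring|].
  rewrite u_eq; ring.
Qed.

(** By [gf_eq_at_eq] the series is z b^2 / (1 - 2 z C) with b the series of label r; inserting the
    closed form of b and z = u/(1+u)^2 leaves (1-u^2)/u * Y/(1-Y)^2 with Y = u^(2^(r+1)). *)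
Lemma gf_eq_at_solve r : gf_eq_at r = polar_ps (2 ^ S r).
Proof.
  assert (Hpos : (0 < 2 ^ S r)%nat) by (pose proof (Nat.pow_nonzero 2 (S r)); lia).
  pose proof (polar_ps_spec (2 ^ S r) Hpos) as H; cbv zeta in H.
  pose proof (u_pow_pred (2 ^ S r) Hpos) as HW.
  set (W := pspow cat_u (pred (2 ^ S r))) in *.
  change (pspow cat_u (2 ^ S r)) with (u_dyadic (S r)) in *.
  destruct (gf_reg_solve r) as [_ Hb].
  pose proof (u_dyadic_S r) as HX. set (x := u_dyadic r) in *. set (Y := u_dyadic (S r)) in *.
  set (b := gf_reg r) in *.
  pose proof (gf_eq_at_eq r) as Hd. fold b in Hd. set (d := gf_eq_at r) in *.
  assert (Hd' : psmul (pssub ps1 (psmul psX (psadd gf_cat gf_cat))) d = psmul psX (psmul b b)).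
  { transitivity (pssub d (psmul psX (psadd (psmul gf_cat d) (psmul d gf_cat)))); [ring|].
    rewrite Hd at 1; ring. }
  assert (HY : Y 0%nat = 0) by apply u_dyadic_0.
  apply (ps_cancel (pssub ps1 cat_u)); [apply one_minus_0, u_0|].
  do 2 (apply (ps_cancel (pssub ps1 Y)); [now apply one_minus_0|]).
  do 2 apply u_cancel.
  transitivity (psmul (psmul (psmul cat_u cat_u) (psmul (pssub ps1 Y) (pssub ps1 Y))) (psmul (pssub ps1 cat_u) d)); [ring|].
  transitivity (psmul (psmul (psmul cat_u cat_u) (psmul (pssub ps1 Y) (pssub ps1 Y))) (psmul (psadd ps1 cat_u)
     (psmul (pssub ps1 (psmul psX (psadd gf_cat gf_cat))) d))); [rewrite <- one_minus_2XC; ring|].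
  rewrite Hd'.
  transitivity (psmul (psmul psX (psadd ps1 cat_u)) (psmul (psmul (pssub ps1 Y) (psmul cat_u b)) (psmul (pssub ps1 Y) (psmul cat_u b)))); [ring|].
  rewrite Hb.
  transitivity (psmul (psmul psX (psmul (psadd ps1 cat_u) (psadd ps1 cat_u)))
     (psmul (psmul (pssub ps1 cat_u) (pssub ps1 (psmul cat_u cat_u))) Y)); [rewrite HX; ring|].
  rewrite u_eq.
  transitivity (psmul (psmul cat_u (psmul cat_u (pssub ps1 cat_u))) (psmul (psmul (pssub ps1 Y) (pssub ps1 Y)) (polar_ps (2 ^ S r)))); [|ring].
  rewrite H, HW; unfold one_sub_usq; ring.
Qed.

(** The dyadic identity summed over N = 2^0, ..., 2^L. Each polar term with 1 <= r <= L occurs once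
    on the left and four times on the right, which leaves the factor 3 and, at the two ends, N = 1
    and N = 2^(L+1). *)
Lemma gf_eq_at_sum L n :
  3 * (match L with O => 0 | S L => sum_f_R0 (fun r => gf_eq_at r n) L end)
  + sum_f_R0 (fun l => alt_polar_ps (2 ^ l) n) L + 4 * polar_ps (2 ^ S L) n = polar_ps 1 n.
Proof.
  assert (E : forall r, polar_ps (2 ^ r) n = alt_polar_ps (2 ^ r) n + 4 * polar_ps (2 ^ S r) n).
  { intros r.
    pose proof (polar_ps_alt_polar_ps (2 ^ r) ltac:(pose proof (Nat.pow_nonzero 2 r); lia)) as Q.
    change (2 * 2 ^ r)%nat with (2 ^ S r)%nat in Q. set (a := polar_ps (2 ^ S r)) in *.
    rewrite Q.
    replace (psmul (psadd (psadd ps1 ps1) (psadd ps1 ps1)) a) with (psadd (psadd a a) (psadd a a)) by ring.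
    unfold psadd; ring. }
  assert (I : forall L, 3 * (match L with O => 0 | S L => sum_f_R0 (fun r => gf_eq_at r n) L end)
     = 3 * (match L with O => 0 | S L => sum_f_R0 (fun r => polar_ps (2 ^ S r) n) L end)).
  { intros [|K]; [reflexivity|]. f_equal. apply sum_eq; intros; now rewrite gf_eq_at_solve. }
  rewrite I; clear I. induction L as [|L IH].
  - cbn [sum_f_R0]. pose proof (E 0%nat) as H. change (2 ^ 0)%nat with 1%nat in *. lra.
  - rewrite (tech5 (fun l => alt_polar_ps (2 ^ l) n)). pose proof (E (S L)) as H.
    destruct L as [|L]; [cbn [sum_f_R0] in *; lra|].
    rewrite tech5. lra.
Qed.

Lemma polar_ps_small N n : (S n < N)%nat -> polar_ps N n = 0.
Proof.
  intros H. unfold polar_ps.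
  apply (psmul_order _ _ 0 (pred N)); [intros; lia| |lia].
  intros m Hm; apply (psmul_order _ _ (pred N) 0); [|intros; lia|lia].
  intros j Hj; apply pspow_order; [apply u_0|assumption].
Qed.

(** * Coefficients of powers of u *)

Lemma polar_ps1_mul : psmul (pssub ps1 cat_u) (polar_ps 1) = psadd ps1 cat_u.
Proof.
  pose proof (polar_ps_spec 1 ltac:(lia)) as H; cbv zeta in H.
  change (pred 1) with 0%nat in H. simpl pspow in H.
  apply (ps_cancel (pssub ps1 cat_u)); [apply one_minus_0, u_0|].
  transitivity (psmul one_sub_usq ps1); [rewrite <- H; ring|unfold one_sub_usq; ring].
Qed.

(** Instead of Lagrange inversion: since u = z (1 + 2u + u^2), the series u^k (1+u)/(1-u) obey in n
    and k the twice iterated Pascal rule [cbin_S], and for k = 0 the boundary rule [cbin_S0]. *)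
Lemma pow_polar_ps1 k n : psmul (pspow cat_u k) (polar_ps 1) n = cbin n k.
Proof.
  assert (R0 : polar_ps 1 = psadd ps1 (psmul psX (psadd (psadd (polar_ps 1) (polar_ps 1)) (psadd (psmul cat_u (polar_ps 1)) (psmul cat_u (polar_ps 1)))))).
  { apply (ps_cancel (pssub ps1 cat_u)); [apply one_minus_0, u_0|].
    apply (ps_cancel (psadd ps1 cat_u)); [apply one_plus_0, u_0|].
    transitivity (psmul (psadd ps1 cat_u) (psmul (pssub ps1 cat_u) (polar_ps 1))); [ring|]. rewrite polar_ps1_mul.
    transitivity (psadd (psmul (pssub ps1 cat_u) (psadd ps1 cat_u)) (psmul (psmul psX (psadd ps1 cat_u))
       (psmul (psadd (psadd ps1 ps1) (psadd cat_u cat_u)) (psmul (pssub ps1 cat_u) (polar_ps 1))))); [|ring].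
    rewrite polar_ps1_mul.
    transitivity (psadd (psmul (pssub ps1 cat_u) (psadd ps1 cat_u)) (psmul (psmul psX (psmul (psadd ps1 cat_u) (psadd ps1 cat_u)))
       (psadd (psadd ps1 ps1) (psadd cat_u cat_u)))); [|ring].
    rewrite u_eq; ring. }
  assert (RS : forall k, psmul (pspow cat_u (S k)) (polar_ps 1) = psmul psX (psadd (psmul (pspow cat_u k) (polar_ps 1))
     (psadd (psadd (psmul (pspow cat_u (S k)) (polar_ps 1)) (psmul (pspow cat_u (S k)) (polar_ps 1))) (psmul (pspow cat_u (S (S k))) (polar_ps 1))))).
  { intros j; simpl pspow. rewrite <- u_eq at 1. ring. }
  revert k; induction n as [|n IH]; intros k.
  - rewrite cbin_0. destruct k as [|k].
    + simpl pspow. replace (psmul ps1 (polar_ps 1)) with (polar_ps 1) by ring.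
      rewrite R0; unfold psadd at 1; rewrite psmul_X_0; simpl; ring.
    + rewrite RS; apply psmul_X_0.
  - destruct k as [|k].
    + simpl pspow. replace (psmul ps1 (polar_ps 1)) with (polar_ps 1) by ring.
      rewrite R0; unfold psadd at 1; rewrite psmul_X_S; unfold psadd; rewrite cbin_S0.
      pose proof (IH 0%nat) as H0; pose proof (IH 1%nat) as H1. simpl pspow in H0, H1.
      replace (psmul ps1 (polar_ps 1)) with (polar_ps 1) in H0 by ring.
      replace (psmul cat_u ps1) with cat_u in H1 by ring.
      rewrite H0, H1; simpl; ring.
    + rewrite RS, psmul_X_S. unfold psadd. rewrite !IH, cbin_S; ring.
Qed.

Definition beta (n k : nat) : R := cbin n (pred k) - 2 * cbin n k + cbin n (S k).

Lemma one_sub_usq_pow k n : (0 < k)%nat -> psmul one_sub_usq (pspow cat_u (pred k)) n = beta n k.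
Proof.
  intros Hk; unfold beta; rewrite <- !pow_polar_ps1.
  destruct k as [|k]; [lia|]; simpl pred.
  replace (psmul one_sub_usq (pspow cat_u k)) with (psadd (pssub (psmul (pspow cat_u k) (polar_ps 1))
     (psadd (psmul (pspow cat_u (S k)) (polar_ps 1)) (psmul (pspow cat_u (S k)) (polar_ps 1)))) (psmul (pspow cat_u (S (S k))) (polar_ps 1))).
  { unfold psadd, pssub; ring. }
  transitivity (psmul (psmul (pssub ps1 cat_u) (pspow cat_u k)) (psmul (pssub ps1 cat_u) (polar_ps 1))); [simpl pspow; ring|].
  rewrite polar_ps1_mul; unfold one_sub_usq; ring.
Qed.

Lemma gf_cat_n n : (INR n + 1) * gf_cat n = cbin n 0.
Proof.
  assert (E : gf_cat = pssub (psmul (pspow cat_u 0) (polar_ps 1)) (psmul (pspow cat_u 1) (polar_ps 1))).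
  { transitivity (psadd ps1 cat_u); [unfold cat_u; ring|]. rewrite <- polar_ps1_mul; simpl pspow; ring. }
  rewrite E; unfold pssub; rewrite !pow_polar_ps1.
  pose proof (cbin_shift n 0) as H; simpl INR in H. lra.
Qed.

(** [P M] is the partial sum of 1/(1+Y)^2 = sum (-1)^m (m+1) Y^m, and [HP] gives its exact remainder
    (-1)^M ((M+2) Y^(M+1) + (M+1) Y^(M+2)), whose order exceeds n. [cst] embeds the real
    coefficients into the ring of series. *)
Lemma alt_polar_ps_n N n M : (0 < N)%nat -> (n <= M)%nat ->
  alt_polar_ps N n = sum_f_R0 (fun m => (-1) ^ m * INR (S m) * beta n (N * S m)) M.
Proof.
  intros HN HM.
  set (Y := pspow cat_u N). set (W := psmul one_sub_usq (pspow cat_u (pred N))).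
  assert (HY : Y 0%nat = 0) by (apply pspow_order; [apply u_0|lia]).
  pose (cst := fun c : R => (fun k => match k with O => c | _ => 0 end) : ps).
  assert (Hc : forall c a k, psmul (cst c) a k = c * a k).
  { intros c a k. unfold psmul. replace (cst c) with (fun k => c * ps1 k).
    - rewrite cauchy_scal_l, cauchy_1_l; reflexivity.
    - apply ps_ext; intros [|j]; unfold cst, ps1; ring. }
  assert (Hadd : forall c d, cst (c + d) = psadd (cst c) (cst d)).
  { intros c d; apply ps_ext; intros [|k]; unfold psadd, cst; ring. }
  assert (Hopp : forall c, cst (- c) = psopp (cst c)).
  { intros c; apply ps_ext; intros [|k]; unfold psopp, cst; ring. }
  assert (H1 : cst 1 = ps1) by (apply ps_ext; intros [|k]; reflexivity).
  pose (P := fix P M := match M with O => ps1 | S m => psadd (P m) (psmul (cst ((-1) ^ S m * INR (S (S m)))) (pspow Y (S m))) end).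
  assert (HP : forall M, psmul (psmul (psadd ps1 Y) (psadd ps1 Y)) (P M) =
     psadd ps1 (psmul (cst ((-1) ^ M)) (psadd (psmul (cst (INR M + 2)) (pspow Y (S M))) (psmul (cst (INR M + 1)) (pspow Y (S (S M))))))).
  { intros K; induction K as [|K IH].
    - simpl. rewrite !Rplus_0_l. replace 2 with (1 + 1) by ring. rewrite (Hadd 1 1), H1. ring.
    - change (P (S K)) with (psadd (P K) (psmul (cst ((-1) ^ S K * INR (S (S K)))) (pspow Y (S K)))).
      transitivity (psadd (psmul (psmul (psadd ps1 Y) (psadd ps1 Y)) (P K))
        (psmul (psmul (psadd ps1 Y) (psadd ps1 Y)) (psmul (cst ((-1) ^ S K * INR (S (S K)))) (pspow Y (S K))))); [ring|].
      rewrite IH. rewrite !S_INR. simpl pow.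
      replace (-1 * (-1) ^ K * (INR K + 1 + 1)) with (- ((-1) ^ K * INR K + (-1) ^ K + (-1)^ K)) by ring.
      replace (-1 * (-1) ^ K) with (- (-1) ^ K) by ring.
      replace (INR K + 2) with (INR K + 1 + 1) by ring.
      replace (INR K + 1 + 2) with (INR K + 1 + 1 + 1) by ring.
      rewrite !Hopp, !Hadd, H1.
      assert (Hm : cst ((-1) ^ K * INR K) = psmul (cst ((-1) ^ K)) (cst (INR K)))
        by (apply ps_ext; intros [|k]; rewrite Hc; unfold cst; ring).
      rewrite Hm. simpl pspow. ring. }
  assert (HWY : forall m, psmul W (pspow Y m) n = beta n (N * S m)).
  { intros m. rewrite <- one_sub_usq_pow by lia. unfold W, Y.
    replace (pspow (pspow cat_u N) m) with (pspow cat_u (N * m)).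
    - transitivity (psmul one_sub_usq (psmul (pspow cat_u (pred N)) (pspow cat_u (N * m))) n); [apply (f_equal (fun f : ps => f n)); ring|].
      rewrite <- pspow_add. do 3 f_equal. lia.
    - clear; induction m as [|m IH]; [now rewrite Nat.mul_0_r|].
      replace (N * S m)%nat with (N + N * m)%nat by lia. rewrite pspow_add, IH; reflexivity. }
  transitivity (psmul W (P M) n).
  - set (Iv := psinv1 (psopp Y)).
    assert (I : psmul (psadd ps1 Y) Iv = ps1).
    { transitivity (psmul (pssub ps1 (psopp Y)) Iv); [ring|]. apply psinv1_spec; unfold psopp; rewrite HY; ring. }
    assert (E : psmul W (P M) = psadd (alt_polar_ps N) (psmul (psmul W (pspow Y (S M))) (psmul (psmul Iv Iv)
       (psmul (cst ((-1) ^ M)) (psadd (cst (INR M + 2)) (psmul (cst (INR M + 1)) Y)))))).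
    { transitivity (psmul (psmul W (psmul Iv Iv)) (psmul (psmul (psadd ps1 Y) (psadd ps1 Y)) (P M))).
      - transitivity (psmul W (psmul (psmul (psmul (psadd ps1 Y) Iv) (psmul (psadd ps1 Y) Iv)) (P M))); [rewrite I; ring|ring].
      - rewrite HP. unfold alt_polar_ps. fold Y Iv. unfold W. simpl pspow. ring. }
    rewrite E. unfold psadd at 1.
    rewrite (psmul_order (psmul W (pspow Y (S M))) _ (S n) 0); [ring| |intros; lia|lia].
    intros k Hk. apply (psmul_order _ _ 0 (S n)); [intros; lia| |lia].
    intros j Hj. apply pspow_order; [assumption|lia].
  - clear HM. induction M as [|M IH].
    + simpl sum_f_R0. rewrite <- HWY. simpl. replace (psmul W ps1) with W by ring. ring.
    + rewrite tech5, <- IH, <- HWY.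
      change (P (S M)) with (psadd (P M) (psmul (cst ((-1) ^ S M * INR (S (S M)))) (pspow Y (S M)))).
      rewrite <- (Hc ((-1) ^ S M * INR (S (S M))) (psmul W (pspow Y (S M))) n).
      transitivity (psadd (psmul W (P M)) (psmul (cst ((-1) ^ S M * INR (S (S M)))) (psmul W (pspow Y (S M)))) n); [|reflexivity].
      apply (f_equal (fun f : ps => f n)); ring.
Qed.

(** The condition on L kills the last term of [gf_eq_at_sum]. The number of trees is C(2n,n)/(n+1),
    whence the weight (n+1)/C(2n,n), and the marked nodes are a third of what the leaves' term
    C(2n,n) exceeds the alternating sums by. *)
Theorem E_n_formula n L : (n + 1 < 2 ^ S L)%nat ->
  E_n n = 4 / 3 * (INR n + 1) - / 3 * sum_f_R0 (fun l =>
     sum_f_R0 (fun m => (-1) ^ m * INR (S m) * ((INR n + 1) * beta n (2 ^ l * S m) / cbin n 0)) n) L.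
Proof.
  intros HL. unfold E_n.
  rewrite (sumn_branches HL), size_trees.
  pose proof (gf_cat_n n) as Hc. pose proof (cbin_pos n) as Hp. pose proof (pos_INR n) as Hn.
  pose proof (gf_eq_at_sum L n) as HT.
  rewrite (polar_ps_small (2 ^ S L) n) in HT by lia.
  assert (H1 : polar_ps 1 n = cbin n 0).
  { rewrite <- pow_polar_ps1. apply (f_equal (fun f : ps => f n)); simpl pspow; ring. }
  rewrite H1 in HT. clear H1.
  match type of HT with 3 * ?t + ?q + _ = _ => set (T := t) in *; set (Q := q) in * end.
  assert (HQ : sum_f_R0 (fun l => sum_f_R0 (fun m => (-1) ^ m * INR (S m) *
     ((INR n + 1) * beta n (2 ^ l * S m) / cbin n 0)) n) L = (INR n + 1) / cbin n 0 * Q).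
  { unfold Q. rewrite scal_sum. apply sum_eq; intros l _.
    rewrite (alt_polar_ps_n (2 ^ l) n n) by (pose proof (Nat.pow_nonzero 2 l); lia).
    rewrite Rmult_comm, scal_sum. apply sum_eq; intros m _. field; lra. }
  rewrite HQ.
  assert (HC : gf_cat n = cbin n 0 / (INR n + 1)) by (rewrite <- Hc; field; lra).
  rewrite HC. replace T with ((cbin n 0 - Q) / 3) by lra. field; lra.
Qed.

(** * Integrals over the real line *)

(** A total function; it is the integral over the line for the functions satisfying [dom], for which
    all exhaustions of the line give the same limit. *)
Definition RIntR (f : R -> R) : R := real (Lim_seq (fun N => RInt f (- INR N) (INR N))).

(** The rate 1/4 is what is left of the rate 1 in [dom1] after multiplication by factors of growth
    up to e^(3|x|/4): a kernel e^(zx) with |Re z| <= 1/4, possibly together with x or x^2. *)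
Definition dom (K : R) (f : R -> R) : Prop :=
  (forall x, continuous f x) /\ forall x, Rabs (f x) <= K * exp (- Rabs x / 4).

Lemma dom_pos K f : dom K f -> 0 <= K.
Proof.
  intros [_ H]. specialize (H 0). rewrite Rabs_R0 in H.
  replace (- 0 / 4) with 0 in H by field. rewrite exp_0 in H.
  pose proof (Rabs_pos (f 0)); lra.
Qed.

Lemma cont_ex_RInt (f : R -> R) a b : (forall x, continuous f x) -> ex_RInt f a b.
Proof. intros H; apply (@ex_RInt_continuous R_CompleteNormedModule); intros; apply H. Qed.

Lemma RInt_exp_lin (K c a b : R) : c <> 0 ->
  is_RInt (fun t => K * exp (c * t)) a b (K / c * (exp (c * b) - exp (c * a))).
Proof.
  intros Hc.
  replace (K / c * (exp (c * b) - exp (c * a)))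
    with (minus (K / c * exp (c * b)) (K / c * exp (c * a)) : R) by (unfold minus, plus, opp; simpl; ring).
  apply (is_RInt_derive (fun t => K / c * exp (c * t))).
  - intros x _. auto_derive; [trivial|field; assumption].
  - intros x _. apply (ex_derive_continuous (fun t => K * exp (c * t))). auto_derive; trivial.
Qed.

Lemma dom_tail_r K f A B : dom K f -> 0 <= A <= B -> Rabs (RInt f A B) <= 4 * K * exp (- A / 4).
Proof.
  intros Hd HAB. pose proof (dom_pos _ _ Hd) as HK. destruct Hd as [Hc Hb].
  assert (E := RInt_exp_lin K (- / 4) A B ltac:(lra)).
  apply Rle_trans with (RInt (fun t => K * exp (- / 4 * t)) A B).
  - apply Rle_trans with (RInt (fun t => Rabs (f t)) A B).
    + apply abs_RInt_le; [lra|now apply cont_ex_RInt].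
    + apply RInt_le; [lra| |eexists; apply E|].
      * apply cont_ex_RInt; intros x; apply (continuous_comp f Rabs); [apply Hc|apply continuous_Rabs].
      * intros x Hx. eapply Rle_trans; [apply Hb|]. rewrite Rabs_right by lra.
        right; do 2 f_equal; field.
  - rewrite (is_RInt_unique _ _ _ _ E).
    pose proof (exp_pos (- / 4 * B)).
    replace (- A / 4) with (- / 4 * A) by field.
    assert (0 <= K * exp (- / 4 * B)) by nra.
    replace (K / - / 4) with (- 4 * K) by field. nra.
Qed.

Lemma dom_opp K f : dom K f -> dom K (fun x => f (- x)).
Proof.
  intros [Hc Hb]; split.
  - intros x. apply (continuous_comp (fun x => - x) f); [|apply Hc].
    apply (ex_derive_continuous (fun x : R => - x)). auto_derive; trivial.
  - intros x. rewrite <- (Rabs_Ropp x). apply Hb.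
Qed.

Lemma RInt_reflect (f : R -> R) a b : (forall x, continuous f x) -> RInt (fun x => f (- x)) a b = RInt f (- b) (- a).
Proof.
  intros Hc.
  assert (H : is_RInt (fun y => scal (-1) (f (-1 * y + 0))) a b (RInt f (- a) (- b))).
  { apply (is_RInt_comp_lin f (-1) 0).
    replace (-1 * a + 0) with (- a) by ring. replace (-1 * b + 0) with (- b) by ring.
    apply (@RInt_correct R_CompleteNormedModule), cont_ex_RInt, Hc. }
  apply (is_RInt_scal _ a b (-1)) in H.
  rewrite (is_RInt_unique (fun x => f (- x)) a b (scal (-1) (RInt f (- a) (- b)))).
  - rewrite <- (opp_RInt_swap f (- b) (- a)); [|apply cont_ex_RInt, Hc].
    unfold scal, opp; simpl; unfold mult; simpl; ring.
  - eapply is_RInt_ext; [|apply H]. intros x _; unfold scal; simpl; unfold mult; simpl.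
    replace (-1 * x + 0) with (- x) by ring. ring.
Qed.

Lemma dom_tail_l K f A B : dom K f -> 0 <= A <= B -> Rabs (RInt f (- B) (- A)) <= 4 * K * exp (- A / 4).
Proof.
  intros Hd H. rewrite <- RInt_reflect by apply Hd.
  apply dom_tail_r; [now apply dom_opp|assumption].
Qed.

Lemma exp_le_mono x y : x <= y -> exp x <= exp y.
Proof. intros [H| ->]; [left; now apply exp_increasing|right; reflexivity]. Qed.

Lemma dom_cauchy K f A B A' B' : dom K f -> 0 <= A <= A' -> 0 <= B <= B' ->
  Rabs (RInt f (- A) B - RInt f (- A') B') <= 4 * K * (exp (- A / 4) + exp (- B / 4)).
Proof.
  intros Hd HA HB. destruct Hd as [Hc Hb].
  assert (E : forall a b, ex_RInt f a b) by (intros; now apply cont_ex_RInt).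
  rewrite <- (RInt_Chasles f (- A') (- A) B'), <- (RInt_Chasles f (- A) B B') by apply E.
  unfold plus; simpl.
  replace (RInt f (- A) B - _) with (- (RInt f (- A') (- A)) - RInt f B B') by ring.
  pose proof (dom_tail_l K f A A' (conj Hc Hb) HA). pose proof (dom_tail_r K f B B' (conj Hc Hb) HB).
  eapply Rle_trans; [apply Rabs_triang|]. rewrite !Rabs_Ropp. lra.
Qed.

Lemma exp_tail_small eps : 0 < eps -> exists T, 0 <= T /\ forall x, T <= x -> exp (- x / 4) <= eps.
Proof.
  intros He. exists (Rmax 0 (- 4 * ln eps)). split; [apply Rmax_l|].
  intros x Hx. rewrite <- (exp_ln eps) by assumption. apply exp_le_mono.
  pose proof (Rmax_r 0 (- 4 * ln eps)). lra.
Qed.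

Lemma INR_eventually_ge T : exists N, forall n, (N <= n)%nat -> T <= INR n.
Proof.
  destruct (INR_archimed 1 T Rlt_0_1) as [N HN]. exists N. intros n Hn.
  apply le_INR in Hn. lra.
Qed.

Lemma RIntR_lim K f : dom K f -> is_lim_seq (fun N => RInt f (- INR N) (INR N)) (RIntR f).
Proof.
  intros Hd. pose proof (dom_pos _ _ Hd) as HK. unfold RIntR. apply Lim_seq_correct'.
  apply ex_lim_seq_cauchy_corr. intros eps.
  destruct (exp_tail_small (eps / (8 * K + 8))) as [T [HT H]].
  { apply Rdiv_lt_0_compat; [apply eps|lra]. }
  destruct (INR_eventually_ge T) as [N HN]. exists N.
  assert (G : forall n m, (N <= n)%nat -> (n <= m)%nat ->
    Rabs (RInt f (- INR n) (INR n) - RInt f (- INR m) (INR m)) < eps).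
  { intros n m Hn Hm. eapply Rle_lt_trans.
    - apply (dom_cauchy K); [assumption| |]; (split; [apply pos_INR|now apply le_INR]).
    - pose proof (H (INR n) (HN n Hn)) as Hx. pose proof (cond_pos eps) as He.
      apply Rle_lt_trans with (8 * K * (eps / (8 * K + 8))).
      + nra.
      + apply (Rmult_lt_reg_r (8 * K + 8)); [lra|]. field_simplify; [nra|lra]. }
  intros n m Hn Hm. destruct (Nat.le_ge_cases n m) as [L|L]; [now apply G|].
  rewrite Rabs_minus_sym. now apply G.
Qed.

Lemma lim_abs_le (v : nat -> R) (l c B : R) : is_lim_seq v l -> (exists N, forall n, (N <= n)%nat -> Rabs (c - v n) <= B) ->
  Rabs (c - l) <= B.
Proof.
  intros Hv HB.
  assert (H : is_lim_seq (fun n => Rabs (c - v n)) (Rabs (c - l))).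
  { apply (is_lim_seq_abs _ (Finite (c - l))). apply is_lim_seq_minus'; [apply is_lim_seq_const|assumption]. }
  assert (H2 : Rbar_le (Rabs (c - l)) B); [|exact H2].
  apply (is_lim_seq_le_loc (fun n => Rabs (c - v n)) (fun _ => B)); [assumption|assumption|apply is_lim_seq_const].
Qed.

Lemma RIntR_rate K f A B : dom K f -> 0 <= A -> 0 <= B ->
  Rabs (RInt f (- A) B - RIntR f) <= 4 * K * (exp (- A / 4) + exp (- B / 4)).
Proof.
  intros Hd HA HB. eapply lim_abs_le; [eapply RIntR_lim, Hd|].
  destruct (INR_eventually_ge (Rmax A B)) as [N HN]. exists N. intros n Hn.
  specialize (HN n Hn). pose proof (Rmax_l A B); pose proof (Rmax_r A B).
  apply dom_cauchy; [assumption|lra|lra].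
Qed.

Lemma is_lim_seq_eps (v : nat -> R) (l : R) :
  (forall eps, 0 < eps -> exists N, forall n, (N <= n)%nat -> Rabs (v n - l) <= eps) -> is_lim_seq v l.
Proof.
  intros H. apply is_lim_seq_spec. intros eps. destruct (H (eps / 2)) as [N HN].
  - pose proof (cond_pos eps); lra.
  - exists N. intros n Hn. specialize (HN n Hn). pose proof (cond_pos eps). lra.
Qed.

(** Translations and the unfolding of periodic sums produce intervals that are not symmetric with
    integer endpoints; the exponential bound makes the limit independent of the exhaustion. *)
Lemma RIntR_lim_gen K f (A B : nat -> R) : dom K f ->
  (forall T, exists N, forall n, (N <= n)%nat -> T <= A n) ->
  (forall T, exists N, forall n, (N <= n)%nat -> T <= B n) ->
  is_lim_seq (fun n => RInt f (- A n) (B n)) (RIntR f).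
Proof.
  intros Hd HA HB. pose proof (dom_pos _ _ Hd) as HK. apply is_lim_seq_eps. intros eps He.
  destruct (exp_tail_small (eps / (8 * K + 8))) as [T [HT H]].
  { apply Rdiv_lt_0_compat; lra. }
  destruct (HA T) as [N1 H1]; destruct (HB T) as [N2 H2].
  exists (N1 + N2)%nat. intros n Hn.
  specialize (H1 n ltac:(lia)); specialize (H2 n ltac:(lia)).
  eapply Rle_trans; [apply (RIntR_rate K); [assumption|lra|lra]|].
  pose proof (H _ H1); pose proof (H _ H2).
  apply Rle_trans with (8 * K * (eps / (8 * K + 8))); [nra|].
  apply (Rmult_le_reg_r (8 * K + 8)); [lra|]. field_simplify; [nra|lra].
Qed.

Lemma RIntR_unique K f (l : R) : dom K f -> is_lim_seq (fun N => RInt f (- INR N) (INR N)) l -> RIntR f = l.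
Proof.
  intros Hd H. apply is_lim_seq_unique in H. unfold RIntR. now rewrite H.
Qed.

Lemma RIntR_ext f g : (forall x, f x = g x) -> RIntR f = RIntR g.
Proof. intros H. f_equal. now apply functional_extensionality. Qed.

Lemma dom_plus K1 K2 f g : dom K1 f -> dom K2 g -> dom (K1 + K2) (fun x => f x + g x).
Proof.
  intros [Hf Bf] [Hg Bg]; split.
  - intros x; apply (continuous_plus f g); [apply Hf|apply Hg].
  - intros x. eapply Rle_trans; [apply Rabs_triang|]. specialize (Bf x); specialize (Bg x). lra.
Qed.

Lemma dom_scal c K f : dom K f -> dom (Rabs c * K) (fun x => c * f x).
Proof.
  intros [Hf Bf]; split.
  - intros x; apply (continuous_scal_r c f); apply Hf.
  - intros x. rewrite Rabs_mult, Rmult_assoc. apply Rmult_le_compat_l; [apply Rabs_pos|apply Bf].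
Qed.

Lemma RIntR_plus K1 K2 f g : dom K1 f -> dom K2 g -> RIntR (fun x => f x + g x) = RIntR f + RIntR g.
Proof.
  intros Hf Hg. apply (RIntR_unique (K1 + K2)); [now apply dom_plus|].
  eapply is_lim_seq_ext; [|apply is_lim_seq_plus'; [apply (RIntR_lim _ _ Hf)|apply (RIntR_lim _ _ Hg)]].
  intros n; simpl. symmetry. apply (RInt_plus f g); apply cont_ex_RInt; [apply Hf|apply Hg].
Qed.

Lemma RIntR_scal c K f : dom K f -> RIntR (fun x => c * f x) = c * RIntR f.
Proof.
  intros Hf. apply (RIntR_unique (Rabs c * K)); [now apply dom_scal|].
  eapply is_lim_seq_ext; [|apply (is_lim_seq_scal_l (fun N => RInt f (- INR N) (INR N)) c (RIntR f)), (RIntR_lim _ _ Hf)].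
  intros n; simpl. symmetry. apply (RInt_scal f); apply cont_ex_RInt; apply Hf.
Qed.

Lemma dom_minus K1 K2 f g : dom K1 f -> dom K2 g -> dom (K1 + K2) (fun x => f x - g x).
Proof.
  intros Hf Hg. pose proof (dom_plus _ _ _ _ Hf (dom_scal (-1) _ _ Hg)) as H.
  replace (Rabs (-1)) with 1 in H by (rewrite Rabs_left by lra; ring). rewrite Rmult_1_l in H.
  destruct H as [Hc Hb]; split; intros x.
  - eapply continuous_ext; [|apply Hc]. intros; simpl; ring.
  - specialize (Hb x). replace (f x - g x) with (f x + -1 * g x) by ring. assumption.
Qed.

Lemma RIntR_minus K1 K2 f g : dom K1 f -> dom K2 g -> RIntR (fun x => f x - g x) = RIntR f - RIntR g.
Proof.
  intros Hf Hg. rewrite (RIntR_ext _ (fun x => f x + -1 * g x)) by (intros; ring).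
  rewrite (RIntR_plus K1 (Rabs (-1) * K2)); [|assumption|now apply dom_scal].
  rewrite (RIntR_scal _ K2) by assumption. ring.
Qed.

Lemma RIntR_bound K f : dom K f -> Rabs (RIntR f) <= 8 * K.
Proof.
  intros Hd. pose proof (RIntR_rate K f 0 0 Hd (Rle_refl 0) (Rle_refl 0)) as H.
  rewrite Ropp_0, RInt_point in H. unfold zero in H; simpl in H.
  replace (0 / 4) with 0 in H by field.
  rewrite exp_0 in H. rewrite Rminus_0_l, Rabs_Ropp in H. lra.
Qed.

Lemma RIntR_le K1 K2 f g : dom K1 f -> dom K2 g -> (forall x, f x <= g x) -> RIntR f <= RIntR g.
Proof.
  intros Hf Hg H.
  assert (G : Rbar_le (RIntR f) (RIntR g)); [|exact G].
  eapply is_lim_seq_le; [|apply (RIntR_lim _ _ Hf)|apply (RIntR_lim _ _ Hg)].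
  intros n. apply RInt_le; [pose proof (pos_INR n); lra|apply cont_ex_RInt, Hf|apply cont_ex_RInt, Hg|].
  intros; apply H.
Qed.

Lemma RIntR_derive K F f (l0 l1 : R) : dom K f -> (forall x, is_derive F x (f x)) ->
  is_lim F m_infty l0 -> is_lim F p_infty l1 -> RIntR f = l1 - l0.
Proof.
  intros Hd HF H0 H1. apply (RIntR_unique K); [assumption|].
  assert (Hp : is_lim_seq (fun n => F (INR n)) l1).
  { apply (is_lim_comp_seq F INR p_infty l1); [assumption|exists 0%nat; intros; discriminate|apply is_lim_seq_INR]. }
  assert (Hm : is_lim_seq (fun n => F (- INR n)) l0).
  { apply (is_lim_comp_seq F (fun n => - INR n) m_infty l0); [assumption|exists 0%nat; intros; discriminate|].
    apply (is_lim_seq_opp INR p_infty), is_lim_seq_INR. }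
  eapply is_lim_seq_ext; [|apply is_lim_seq_minus'; [apply Hp|apply Hm]].
  intros n; simpl. symmetry. apply is_RInt_unique.
  apply (is_RInt_derive F f); [intros; apply HF|intros; apply Hd].
Qed.

Lemma dom_shift K f c : dom K f -> dom (K * exp (Rabs c / 4)) (fun x => f (x + c)).
Proof.
  intros Hd; pose proof (dom_pos _ _ Hd) as HK; destruct Hd as [Hc Hb]; split; intros x.
  - apply (continuous_comp (fun x => x + c) f); [|apply Hc].
    apply (continuous_plus (fun x => x) (fun _ => c)); [apply continuous_id|apply continuous_const].
  - eapply Rle_trans; [apply Hb|]. rewrite Rmult_assoc, <- exp_plus.
    apply Rmult_le_compat_l; [assumption|]. apply exp_le_mono.
    pose proof (Rabs_triang (x + c) (- c)) as H. rewrite Rabs_Ropp in H.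
    replace (x + c + - c) with x in H by ring. lra.
Qed.

Lemma RIntR_shift K f c : dom K f -> RIntR (fun x => f (x + c)) = RIntR f.
Proof.
  intros Hd. apply (RIntR_unique (K * exp (Rabs c / 4))); [now apply dom_shift|].
  eapply is_lim_seq_ext; [|apply (RIntR_lim_gen K f (fun n => INR n - c) (fun n => INR n + c)); [assumption| |]].
  - intros n; simpl.
    assert (H : is_RInt (fun y => scal 1 (f (1 * y + c))) (- INR n) (INR n) (RInt f (- (INR n - c)) (INR n + c))).
    { apply (is_RInt_comp_lin f 1 c).
      replace (1 * - INR n + c) with (- (INR n - c)) by ring.
      replace (1 * INR n + c) with (INR n + c) by ring. apply (@RInt_correct R_CompleteNormedModule), cont_ex_RInt, Hd. }
    symmetry. apply is_RInt_unique. eapply is_RInt_ext; [|apply H].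
    intros x _. unfold scal; simpl; unfold mult; simpl. rewrite Rmult_1_l. f_equal; ring.
  - intros T. destruct (INR_eventually_ge (T + c)) as [N HN]. exists N; intros n Hn; specialize (HN n Hn); lra.
  - intros T. destruct (INR_eventually_ge (T - c)) as [N HN]. exists N; intros n Hn; specialize (HN n Hn); lra.
Qed.

Lemma RInt_const_le (f : R -> R) a b eps : a <= b -> (forall x, continuous f x) ->
  (forall x, a <= x <= b -> Rabs (f x) <= eps) -> Rabs (RInt f a b) <= (b - a) * eps.
Proof. intros H Hc Hb. apply abs_RInt_le_const; [assumption|now apply cont_ex_RInt|assumption]. Qed.

(** Dominated convergence reduced to an estimate: the common bound controls the tails outside
    [-T, T] with T independent of n, and uniform convergence controls the inside. *)
Lemma RIntR_dominated K (f : nat -> R -> R) g : (forall n, dom K (f n)) -> dom K g ->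
  (forall T eps, 0 < eps -> exists N, forall n, (N <= n)%nat -> forall x, Rabs x <= T -> Rabs (f n x - g x) <= eps) ->
  is_lim_seq (fun n => RIntR (f n)) (RIntR g).
Proof.
  intros Hf Hg Hu. pose proof (dom_pos _ _ Hg) as HK. apply is_lim_seq_eps. intros eps He.
  destruct (exp_tail_small (eps / (32 * K + 32))) as [T [HT H]].
  { apply Rdiv_lt_0_compat; lra. }
  destruct (Hu T (eps / (4 * T + 4))) as [N HN].
  { apply Rdiv_lt_0_compat; lra. }
  exists N. intros n Hn. specialize (HN n Hn).
  rewrite <- (RIntR_minus K K) by auto.
  pose proof (dom_minus K K _ _ (Hf n) Hg) as Hd.
  pose proof (RIntR_rate _ _ T T Hd HT HT) as HR.
  assert (HI : Rabs (RInt (fun x => f n x - g x) (- T) T) <= (T - - T) * (eps / (4 * T + 4))).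
  { apply RInt_const_le; [lra|apply Hd|]. intros x Hx; apply HN. apply Rabs_le; lra. }
  specialize (H T (Rle_refl T)).
  assert (H1 : (T - - T) * (eps / (4 * T + 4)) <= eps / 2).
  { apply (Rmult_le_reg_r (4 * T + 4)); [lra|]. field_simplify; [nra|lra]. }
  assert (H2 : 4 * (K + K) * (exp (- T / 4) + exp (- T / 4)) <= eps / 2).
  { apply Rle_trans with (16 * K * (eps / (32 * K + 32))); [nra|].
    apply (Rmult_le_reg_r (32 * K + 32)); [lra|]. field_simplify; [nra|lra]. }
  set (J := RInt _ _ _) in *. set (L := RIntR _) in *.
  replace L with (J - (J - L)) by ring.
  eapply Rle_trans; [apply Rabs_triang|]. rewrite Rabs_Ropp. lra.
Qed.

(** * The two-sided Laplace transform and the Gamma function *)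

Definition dom1 (K : R) (g : R -> R) : Prop :=
  (forall x, continuous g x) /\ forall x, Rabs (g x) <= K * exp (- Rabs x).

Definition wcos (s t w : R) : R := exp (s * w) * cos (t * w).
Definition wsin (s t w : R) : R := exp (s * w) * sin (t * w).
(** The integral of g(w) e^(zw), split into real and imaginary part. With this sign a translation of
    g by c multiplies the transform by e^(-zc), which turns c = 2 ln m into m^(-2z). *)
Definition laplace (g : R -> R) (z : C) : C :=
  (RIntR (fun w => g w * wcos (Re z) (Im z) w), RIntR (fun w => g w * wsin (Re z) (Im z) w)).

Lemma mvt (f df : R -> R) a b : (forall x, is_derive f x (df x)) ->
  exists c, Rmin a b <= c <= Rmax a b /\ f b - f a = df c * (b - a).
Proof.
  intros H. destruct (MVT_gen f a b df) as [c Hc].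
  - intros; apply H.
  - intros x _. apply continuity_pt_filterlim, (ex_derive_continuous f). eexists; apply H.
  - now exists c.
Qed.

Lemma cont_of_derive (f df : R -> R) : (forall x, is_derive f x (df x)) -> forall x, continuous f x.
Proof. intros H x. apply (ex_derive_continuous f). eexists; apply H. Qed.

Lemma cont_mult (f g : R -> R) x : continuous f x -> continuous g x -> continuous (fun y => f y * g y) x.
Proof. intros Hf Hg. apply (continuous_mult f g); assumption. Qed.

Lemma wcos_derive s t w : is_derive (wcos s t) w (s * wcos s t w - t * wsin s t w).
Proof. unfold wcos, wsin. auto_derive; [trivial|ring]. Qed.
Lemma wsin_derive s t w : is_derive (wsin s t) w (s * wsin s t w + t * wcos s t w).
Proof. unfold wcos, wsin. auto_derive; [trivial|ring]. Qed.

Lemma dom1_pos K g : dom1 K g -> 0 <= K.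
Proof.
  intros [_ H]. specialize (H 0). rewrite Rabs_R0, Ropp_0, exp_0 in H.
  pose proof (Rabs_pos (g 0)); lra.
Qed.

Lemma dom_of_dom1 K g k c : dom1 K g -> (forall x, continuous k x) ->
  (forall x, Rabs (k x) <= c * exp (3 / 4 * Rabs x)) -> dom (K * c) (fun x => g x * k x).
Proof.
  intros Hg Hk Hb. pose proof (dom1_pos _ _ Hg) as HK. destruct Hg as [Hc Hg]. split.
  - intros x. apply cont_mult; [apply Hc|apply Hk].
  - intros x. rewrite Rabs_mult. eapply Rle_trans.
    + apply Rmult_le_compat; [apply Rabs_pos|apply Rabs_pos|apply Hg|apply Hb].
    + right. replace (- Rabs x / 4) with (- Rabs x + 3 / 4 * Rabs x) by field.
      rewrite exp_plus. ring.
Qed.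

Lemma Rabs_cos_le x : Rabs (cos x) <= 1.
Proof. apply Rabs_le, COS_bound. Qed.
Lemma Rabs_sin_le x : Rabs (sin x) <= 1.
Proof. apply Rabs_le, SIN_bound. Qed.

Lemma exp_sw_le s w : Rabs s <= / 4 -> exp (s * w) <= exp (/ 4 * Rabs w).
Proof.
  intros H. apply exp_le_mono. eapply Rle_trans; [apply Rle_abs|]. rewrite Rabs_mult.
  apply Rmult_le_compat_r; [apply Rabs_pos|assumption].
Qed.

Lemma wcos_bound s t w : Rabs s <= / 4 -> Rabs (wcos s t w) <= exp (/ 4 * Rabs w).
Proof.
  intros H. unfold wcos. rewrite Rabs_mult, (Rabs_pos_eq (exp _)) by (left; apply exp_pos).
  pose proof (exp_sw_le s w H). pose proof (Rabs_cos_le (t * w)). pose proof (Rabs_pos (cos (t * w))).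
  pose proof (exp_pos (s * w)). nra.
Qed.
Lemma wsin_bound s t w : Rabs s <= / 4 -> Rabs (wsin s t w) <= exp (/ 4 * Rabs w).
Proof.
  intros H. unfold wsin. rewrite Rabs_mult, (Rabs_pos_eq (exp _)) by (left; apply exp_pos).
  pose proof (exp_sw_le s w H). pose proof (Rabs_sin_le (t * w)). pose proof (Rabs_pos (sin (t * w))).
  pose proof (exp_pos (s * w)). nra.
Qed.

Lemma exp_quarter_le x : exp (/ 4 * Rabs x) <= 1 * exp (3 / 4 * Rabs x).
Proof. rewrite Rmult_1_l. apply exp_le_mono. pose proof (Rabs_pos x); lra. Qed.

Lemma dom_wcos K g s t : Rabs s <= / 4 -> dom1 K g -> dom K (fun x => g x * wcos s t x).
Proof.
  intros Hs Hg. rewrite <- (Rmult_1_r K). apply dom_of_dom1; [assumption| |].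
  - apply (cont_of_derive _ _ (wcos_derive s t)).
  - intros x. eapply Rle_trans; [now apply wcos_bound|apply exp_quarter_le].
Qed.
Lemma dom_wsin K g s t : Rabs s <= / 4 -> dom1 K g -> dom K (fun x => g x * wsin s t x).
Proof.
  intros Hs Hg. rewrite <- (Rmult_1_r K). apply dom_of_dom1; [assumption| |].
  - apply (cont_of_derive _ _ (wsin_derive s t)).
  - intros x. eapply Rle_trans; [now apply wsin_bound|apply exp_quarter_le].
Qed.

Lemma dom1_dom K g : dom1 K g -> dom K g.
Proof.
  intros Hg. pose proof (dom1_pos _ _ Hg). destruct Hg as [Hc Hb]; split; [assumption|].
  intros x; eapply Rle_trans; [apply Hb|]. apply Rmult_le_compat_l; [assumption|].
  apply exp_le_mono. pose proof (Rabs_pos x); lra.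
Qed.

Lemma dom1_plus K1 K2 f g : dom1 K1 f -> dom1 K2 g -> dom1 (K1 + K2) (fun x => f x + g x).
Proof.
  intros [Hf Bf] [Hg Bg]; split.
  - intros x; apply (continuous_plus f g); [apply Hf|apply Hg].
  - intros x. eapply Rle_trans; [apply Rabs_triang|]. specialize (Bf x); specialize (Bg x). lra.
Qed.

Lemma dom1_scal c K f : dom1 K f -> dom1 (Rabs c * K) (fun x => c * f x).
Proof.
  intros [Hf Bf]; split.
  - intros x; apply (continuous_scal_r c f); apply Hf.
  - intros x. rewrite Rabs_mult, Rmult_assoc. apply Rmult_le_compat_l; [apply Rabs_pos|apply Bf].
Qed.

Lemma dom1_shift K f c : dom1 K f -> dom1 (K * exp (Rabs c)) (fun x => f (x + c)).
Proof.
  intros Hd; pose proof (dom1_pos _ _ Hd) as HK; destruct Hd as [Hc Hb]; split; intros x.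
  - apply (continuous_comp (fun x => x + c) f); [|apply Hc].
    apply (continuous_plus (fun x => x) (fun _ => c)); [apply continuous_id|apply continuous_const].
  - eapply Rle_trans; [apply Hb|]. rewrite Rmult_assoc, <- exp_plus.
    apply Rmult_le_compat_l; [assumption|]. apply exp_le_mono.
    pose proof (Rabs_triang (x + c) (- c)) as H. rewrite Rabs_Ropp in H.
    replace (x + c + - c) with x in H by ring. lra.
Qed.

Lemma laplace_plus K1 K2 f g z : Rabs (Re z) <= / 4 -> dom1 K1 f -> dom1 K2 g ->
  laplace (fun w => f w + g w) z = Cplus (laplace f z) (laplace g z).
Proof.
  intros Hz Hf Hg. unfold laplace, Cplus; simpl. f_equal.
  - rewrite <- (RIntR_plus K1 K2) by (now apply dom_wcos). apply RIntR_ext; intros; ring.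
  - rewrite <- (RIntR_plus K1 K2) by (now apply dom_wsin). apply RIntR_ext; intros; ring.
Qed.

Lemma laplace_scal c K f z : Rabs (Re z) <= / 4 -> dom1 K f ->
  laplace (fun w => c * f w) z = Cmult (RtoC c) (laplace f z).
Proof.
  intros Hz Hf. unfold laplace, Cmult, RtoC; simpl. f_equal.
  - rewrite Rmult_0_l, Rminus_0_r, <- (RIntR_scal c K) by (now apply dom_wcos). apply RIntR_ext; intros; ring.
  - rewrite Rmult_0_l, Rplus_0_r, <- (RIntR_scal c K) by (now apply dom_wsin). apply RIntR_ext; intros; ring.
Qed.

Lemma laplace_shift c K f z : Rabs (Re z) <= / 4 -> dom1 K f ->
  laplace (fun w => f (w + c)) z = Cmult (Cexp (Copp z * RtoC c)) (laplace f z).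
Proof.
  intros Hz Hf. destruct z as [s t]; simpl in Hz. unfold laplace, Cexp, Cmult, Copp, RtoC; simpl.
  replace (- s * c - - t * 0) with (- s * c) by ring.
  replace (- s * 0 + - t * c) with (- t * c) by ring.
  pose proof (dom_wcos _ _ s t Hz Hf) as Dc. pose proof (dom_wsin _ _ s t Hz Hf) as Ds.
  pose (A := exp (- s * c)). fold A.
  f_equal.
  - rewrite <- !(RIntR_scal _ K) by assumption.
    rewrite <- (RIntR_minus (Rabs (A * cos (- t * c)) * K) (Rabs (A * sin (- t * c)) * K)) by (now apply dom_scal).
    eapply eq_trans; [|apply (RIntR_shift (Rabs (A * cos (- t * c)) * K + Rabs (A * sin (- t * c)) * K) _ c);
      apply dom_minus; now apply dom_scal].
    apply RIntR_ext; intros x. unfold A, wcos, wsin.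
    replace (exp (s * x)) with (exp (- s * c) * exp (s * (x + c))) by (rewrite <- exp_plus; f_equal; ring).
    replace (t * x) with (- t * c + t * (x + c)) by ring. rewrite cos_plus; ring.
  - rewrite <- !(RIntR_scal _ K) by assumption.
    rewrite <- (RIntR_plus (Rabs (A * cos (- t * c)) * K) (Rabs (A * sin (- t * c)) * K)) by (now apply dom_scal).
    eapply eq_trans; [|apply (RIntR_shift (Rabs (A * cos (- t * c)) * K + Rabs (A * sin (- t * c)) * K) _ c);
      apply dom_plus; now apply dom_scal].
    apply RIntR_ext; intros x. unfold A, wcos, wsin.
    replace (exp (s * x)) with (exp (- s * c) * exp (s * (x + c))) by (rewrite <- exp_plus; f_equal; ring).
    replace (t * x) with (- t * c + t * (x + c)) by ring. rewrite sin_plus; ring.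
Qed.

Lemma exp_neg_lim_p k : 0 < k -> is_lim (fun x => exp (- k * Rabs x)) p_infty 0.
Proof.
  intros Hk. apply is_lim_spec. intros eps.
  exists (Rmax 0 (- ln eps / k)). intros x Hx.
  pose proof (Rmax_l 0 (- ln eps / k)); pose proof (Rmax_r 0 (- ln eps / k)).
  rewrite Rminus_0_r, Rabs_pos_eq by (left; apply exp_pos). rewrite Rabs_pos_eq by lra.
  rewrite <- (exp_ln eps) by apply eps. apply exp_increasing.
  assert (- ln eps / k < x) by lra. apply (Rmult_lt_compat_r k) in H1; [|lra].
  field_simplify in H1; lra.
Qed.
Lemma exp_neg_lim_m k : 0 < k -> is_lim (fun x => exp (- k * Rabs x)) m_infty 0.
Proof.
  intros Hk.
  apply is_lim_ext with (fun x => (fun y => exp (- k * Rabs y)) (- x)); [intros; now rewrite Rabs_Ropp|].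
  apply (is_lim_comp (fun y => exp (- k * Rabs y)) Ropp m_infty 0 p_infty).
  - now apply exp_neg_lim_p.
  - apply (is_lim_opp (fun x => x) m_infty m_infty), is_lim_id.
  - exists 0; intros; discriminate.
Qed.

Lemma is_lim_le_0 (F G : R -> R) x : (forall y, Rabs (F y) <= G y) -> is_lim G x 0 -> is_lim F x 0.
Proof.
  intros H HG. apply (is_lim_le_le_loc (fun y => - G y) G).
  - apply filter_forall. intros y. specialize (H y). split; [pose proof (Rle_abs (- F y)); rewrite Rabs_Ropp in *; lra|pose proof (Rle_abs (F y)); lra].
  - replace (Finite 0) with (Rbar_opp 0) by (simpl; f_equal; ring). now apply is_lim_opp.
  - assumption.
Qed.

Lemma RIntR_derive_0 K1 K2 F f : dom K1 f -> dom K2 F -> (forall x, is_derive F x (f x)) -> RIntR f = 0.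
Proof.
  intros Hf HF HD. rewrite <- (Rminus_0_r 0). apply (RIntR_derive K1 F); [assumption|assumption| |].
  - apply (is_lim_le_0 _ (fun x => K2 * exp (- / 4 * Rabs x))).
    + intros y. replace (- / 4 * Rabs y) with (- Rabs y / 4) by field. apply HF.
    + replace (Finite 0) with (Rbar_mult K2 0) by (simpl; f_equal; ring).
      apply is_lim_scal_l, exp_neg_lim_m; lra.
  - apply (is_lim_le_0 _ (fun x => K2 * exp (- / 4 * Rabs x))).
    + intros y. replace (- / 4 * Rabs y) with (- Rabs y / 4) by field. apply HF.
    + replace (Finite 0) with (Rbar_mult K2 0) by (simpl; f_equal; ring).
      apply is_lim_scal_l, exp_neg_lim_p; lra.
Qed.

Lemma laplace_derive K1 K2 g dg z : Rabs (Re z) <= / 4 -> dom1 K1 g -> dom1 K2 dg ->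
  (forall x, is_derive g x (dg x)) -> laplace dg z = Copp (Cmult z (laplace g z)).
Proof.
  intros Hz Hg Hdg HD. destruct z as [s t]; simpl in Hz. unfold laplace, Cmult, Copp; simpl.
  pose proof (dom_wcos _ _ s t Hz Hg) as Dc. pose proof (dom_wsin _ _ s t Hz Hg) as Ds.
  pose proof (dom_wcos _ _ s t Hz Hdg) as Dc'. pose proof (dom_wsin _ _ s t Hz Hdg) as Ds'.
  f_equal.
  - assert (E : RIntR (fun x => dg x * wcos s t x + (s * (g x * wcos s t x) - t * (g x * wsin s t x))) = 0).
    { eapply RIntR_derive_0; [|apply Dc|].
      - apply dom_plus; [apply Dc'|]. apply dom_minus; (apply dom_scal; eassumption).
      - intros x. replace (dg x * wcos s t x + (s * (g x * wcos s t x) - t * (g x * wsin s t x)))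
          with (dg x * wcos s t x + g x * (s * wcos s t x - t * wsin s t x)) by ring.
        apply (is_derive_mult g (wcos s t)); [apply HD|apply wcos_derive|intros; apply Rmult_comm]. }
    erewrite RIntR_plus, RIntR_minus, !RIntR_scal in E; [|eassumption|eassumption|apply dom_scal; eassumption|apply dom_scal; eassumption|eassumption|].
    2: { apply dom_minus; (apply dom_scal; eassumption). }
    lra.
  - assert (E : RIntR (fun x => dg x * wsin s t x + (s * (g x * wsin s t x) + t * (g x * wcos s t x))) = 0).
    { eapply RIntR_derive_0; [|apply Ds|].
      - apply dom_plus; [apply Ds'|]. apply dom_plus; (apply dom_scal; eassumption).
      - intros x. replace (dg x * wsin s t x + (s * (g x * wsin s t x) + t * (g x * wcos s t x)))
          with (dg x * wsin s t x + g x * (s * wsin s t x + t * wcos s t x)) by ring.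
        apply (is_derive_mult g (wsin s t)); [apply HD|apply wsin_derive|intros; apply Rmult_comm]. }
    erewrite RIntR_plus, RIntR_plus, !RIntR_scal in E; [|eassumption|eassumption|apply dom_scal; eassumption|apply dom_scal; eassumption|eassumption|].
    2: { apply dom_plus; (apply dom_scal; eassumption). }
    lra.
Qed.

(* Under [t = e^v] the integral of [t^(n+z-1) e^(-t)] over [t > 0], i.e. [Gamma (n + z)], becomes [laplace (gammaden n) z]. *)
Definition gammaden (n : nat) (v : R) : R := exp (INR n * v - exp v).

Lemma exp_pow n x : exp x ^ n = exp (INR n * x).
Proof.
  induction n as [|n IH]; [simpl; now rewrite Rmult_0_l, exp_0|].
  rewrite S_INR, Rmult_plus_distr_r, exp_plus, <- IH. simpl. rewrite Rmult_1_l. ring.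
Qed.

(** The m-th power of x/m <= e^(x/m). It serves throughout to trade polynomial factors for
    exponential ones with an explicit constant. *)
Lemma pow_le_exp m x : 0 <= x -> x ^ m <= INR m ^ m * exp x.
Proof.
  intros Hx. destruct m as [|m].
  - simpl. rewrite Rmult_1_l. rewrite <- exp_0. now apply exp_le_mono.
  - assert (Hm : 0 < INR (S m)) by (apply lt_0_INR; lia).
    replace (exp x) with (exp (x / INR (S m)) ^ S m).
    + rewrite <- Rpow_mult_distr. apply pow_incr. split; [assumption|].
      pose proof (exp_ineq1_le (x / INR (S m))).
      replace x with (INR (S m) * (x / INR (S m))) at 1 by (field; lra).
      apply Rmult_le_compat_l; lra.
    + rewrite exp_pow. f_equal. field. lra.
Qed.

Lemma gammaden_S n v : gammaden (S n) v = exp v * gammaden n v.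
Proof. unfold gammaden. rewrite <- exp_plus, S_INR. f_equal; ring. Qed.

Lemma gammaden_derive n v : is_derive (gammaden n) v (INR n * gammaden n v - gammaden (S n) v).
Proof.
  rewrite gammaden_S. unfold gammaden, Rminus. auto_derive; [trivial|]. unfold Rminus; ring.
Qed.

(** At minus infinity the factor e^(nv) provides the rate 1 exactly when n >= 1; at plus infinity
    [pow_le_exp] with exponent n+1, applied to e^v, leaves e^(-v). *)
Lemma gammaden_dom1 n : (1 <= n)%nat -> exists K, dom1 K (gammaden n).
Proof.
  intros Hn. exists (1 + INR (S n) ^ S n). split.
  - apply (cont_of_derive _ (fun v => INR n * gammaden n v - gammaden (S n) v)), gammaden_derive.
  - intros v. unfold gammaden. rewrite Rabs_pos_eq by (left; apply exp_pos).
    assert (H1 : 1 <= INR n) by (apply (le_INR 1); assumption).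
    assert (H0 : 0 <= INR (S n) ^ S n) by apply pow_le, pos_INR.
    pose proof (exp_pos v) as Hv. pose proof (exp_pos (- Rabs v)) as Hav.
    destruct (Rle_dec 0 v) as [P|P].
    + rewrite Rabs_pos_eq in * by assumption.
      pose proof (pow_le_exp (S n) (exp v) (Rlt_le _ _ Hv)) as H.
      rewrite exp_pow in H.
      replace (INR n * v - exp v) with (INR (S n) * v + (- exp v + - v)) by (rewrite S_INR; ring).
      rewrite !exp_plus, (exp_Ropp (exp v)).
      pose proof (exp_pos (exp v)) as He.
      apply Rle_trans with ((INR (S n) ^ S n * exp (exp v)) * (/ exp (exp v) * exp (- v))).
      * apply Rmult_le_compat_r; [|exact H].
        apply Rmult_le_pos; [left; now apply Rinv_0_lt_compat|lra].
      * replace (INR (S n) ^ S n * exp (exp v) * (/ exp (exp v) * exp (- v))) with (INR (S n) ^ S n * exp (- v)) by (field; lra).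
        nra.
    + rewrite (Rabs_left v) in * by lra. rewrite Ropp_involutive in *.
      apply Rle_trans with (1 * exp v); [|apply Rmult_le_compat_r; lra].
      rewrite Rmult_1_l. apply exp_le_mono. nra.
Qed.

(** * Limits of complex sequences *)

Lemma Re_le_Cmod z : Rabs (Re z) <= Cmod z.
Proof. pose proof (Rmax_Cmod z). pose proof (Rmax_l (Rabs (fst z)) (Rabs (snd z))). unfold Re; lra. Qed.
Lemma Im_le_Cmod z : Rabs (Im z) <= Cmod z.
Proof. pose proof (Rmax_Cmod z). pose proof (Rmax_r (Rabs (fst z)) (Rabs (snd z))). unfold Im; lra. Qed.

Lemma Cmod_le_sum z : Cmod z <= Rabs (Re z) + Rabs (Im z).
Proof.
  destruct z as [a b]. replace (a, b) with (Cplus (RtoC a) (Cmult Ci (RtoC b))).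
  - eapply Rle_trans; [apply Cmod_triangle|]. rewrite Cmod_mult, !Cmod_R.
    replace (Cmod Ci) with 1; [simpl; unfold Re, Im; simpl|].
    + rewrite !Rmult_0_l, !Rmult_0_r, Rmult_1_l. rewrite !Rplus_0_l, !Rminus_0_r, !Rplus_0_r, Rmult_1_l. lra.
    + unfold Cmod, Ci; simpl. replace (0 * (0 * 1) + 1 * (1 * 1)) with 1 by ring. now rewrite sqrt_1.
  - unfold Cplus, Cmult, Ci, RtoC; simpl. f_equal; ring.
Qed.

Definition Cconv (v : nat -> C) (l : C) : Prop :=
  forall eps, 0 < eps -> exists N, forall n, (N <= n)%nat -> Cmod (v n - l) <= eps.

Lemma Cconv_re v l : Cconv v l -> is_lim_seq (fun n => Re (v n)) (Re l).
Proof.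
  intros H. apply is_lim_seq_eps. intros eps He. destruct (H eps He) as [N HN]. exists N.
  intros n Hn. eapply Rle_trans; [|apply (HN n Hn)]. apply (Re_le_Cmod (v n - l)).
Qed.
Lemma Cconv_im v l : Cconv v l -> is_lim_seq (fun n => Im (v n)) (Im l).
Proof.
  intros H. apply is_lim_seq_eps. intros eps He. destruct (H eps He) as [N HN]. exists N.
  intros n Hn. eapply Rle_trans; [|apply (HN n Hn)]. apply (Im_le_Cmod (v n - l)).
Qed.

Lemma Cconv_pair v l : is_lim_seq (fun n => Re (v n)) (Re l) -> is_lim_seq (fun n => Im (v n)) (Im l) -> Cconv v l.
Proof.
  intros H1 H2 eps He. apply is_lim_seq_spec in H1, H2.
  assert (He2 : 0 < eps / 2) by lra.
  destruct (H1 (mkposreal _ He2)) as [N1 K1]; destruct (H2 (mkposreal _ He2)) as [N2 K2]; simpl in *.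
  exists (N1 + N2)%nat. intros n Hn. specialize (K1 n ltac:(lia)); specialize (K2 n ltac:(lia)).
  eapply Rle_trans; [apply Cmod_le_sum|]. unfold Re, Im, Rminus in *; simpl in *; lra.
Qed.

Lemma Clim_eq v l : Cconv v l -> Clim v = l.
Proof.
  intros H. unfold Clim.
  rewrite (is_lim_seq_unique _ _ (Cconv_re _ _ H)), (is_lim_seq_unique _ _ (Cconv_im _ _ H)).
  now destruct l.
Qed.

Lemma Cconv_ext v w l : (forall n, v n = w n) -> Cconv v l -> Cconv w l.
Proof. intros E H eps He. destruct (H eps He) as [N HN]. exists N. intros; rewrite <- E; auto. Qed.

Lemma Cconv_scal c v l : Cconv v l -> Cconv (fun n => Cmult c (v n)) (Cmult c l).
Proof.
  intros H eps He. pose proof (Cmod_ge_0 c) as Hc.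
  destruct (H (eps / (Cmod c + 1))) as [N HN]; [apply Rdiv_lt_0_compat; lra|].
  exists N. intros n Hn. replace (c * v n - c * l)%C with (c * (v n - l))%C by ring.
  rewrite Cmod_mult. specialize (HN n Hn). pose proof (Cmod_ge_0 (v n - l)).
  apply Rle_trans with ((Cmod c + 1) * (eps / (Cmod c + 1))); [|right; field; lra].
  apply Rmult_le_compat; lra.
Qed.

Lemma Cconv_unique v l l' : Cconv v l -> Cconv v l' -> l = l'.
Proof. intros H H'. rewrite <- (Clim_eq _ _ H). now apply Clim_eq. Qed.

(** Integration by parts: the functional equation Gamma(n+1+z) = (n+z) Gamma(n+z). *)
Lemma laplace_gammaden_S n z : (1 <= n)%nat -> Rabs (Re z) <= / 4 ->
  laplace (gammaden (S n)) z = Cmult (Cplus (RtoC (INR n)) z) (laplace (gammaden n) z).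
Proof.
  intros Hn Hz. destruct (gammaden_dom1 n Hn) as [K1 H1]. destruct (gammaden_dom1 (S n) ltac:(lia)) as [K2 H2].
  pose proof (dom1_scal (INR n) _ _ H1) as H3. pose proof (dom1_scal (-1) _ _ H2) as H4.
  pose proof (laplace_derive _ _ (gammaden n) (fun v => INR n * gammaden n v + -1 * gammaden (S n) v) z Hz H1 (dom1_plus _ _ _ _ H3 H4)) as E.
  erewrite laplace_plus, !laplace_scal in E by eassumption.
  rewrite Cmult_plus_distr_r.
  assert (E' := E ltac:(intros x; replace (INR n * gammaden n x + -1 * gammaden (S n) x) with (INR n * gammaden n x - gammaden (S n) x) by ring; apply gammaden_derive)).
  clear E. replace (RtoC (-1)) with (Copp (RtoC 1)) in E' by (unfold Copp, RtoC; simpl; f_equal; ring).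
  transitivity (Cplus (Cmult (RtoC (INR n)) (laplace (gammaden n) z)) (Copp (Cplus (Cmult (RtoC (INR n)) (laplace (gammaden n) z)) (Cmult (Copp (RtoC 1)) (laplace (gammaden (S n)) z))))).
  - ring.
  - rewrite E'. ring.
Qed.

Lemma RIntR_gammaden_1 : RIntR (gammaden 1) = 1.
Proof.
  destruct (gammaden_dom1 1 (le_n 1)) as [K H].
  rewrite (RIntR_derive K (fun v => - exp (- exp v)) (gammaden 1) (-1) 0); [ring|now apply dom1_dom| | |].
  - intros x. unfold gammaden. auto_derive; [trivial|].
    replace (INR 1 * x - exp x) with (x + - exp x) by (simpl; ring). rewrite exp_plus. ring.
  - replace (Finite (-1)) with (Rbar_opp 1) by (simpl; f_equal; ring). apply is_lim_opp.
    rewrite <- exp_0. apply (is_lim_comp exp (fun v => - exp v) m_infty (exp 0) 0).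
    + apply is_lim_continuity, derivable_continuous_pt, derivable_pt_exp.
    + replace (Finite 0) with (Rbar_opp 0) by (simpl; f_equal; ring). apply is_lim_opp, is_lim_exp_m.
    + exists 0. intros y _ E. pose proof (exp_pos y). injection E. lra.
  - replace (Finite 0) with (Rbar_opp 0) by (simpl; f_equal; ring). apply is_lim_opp.
    apply (is_lim_comp exp (fun v => - exp v) p_infty 0 m_infty).
    + apply is_lim_exp_m.
    + apply (is_lim_opp exp p_infty p_infty), is_lim_exp_p.
    + exists 0. intros y _; discriminate.
Qed.

Lemma RIntR_gammaden n : RIntR (gammaden (S n)) = INR (fact n).
Proof.
  induction n as [|n IH]; [apply RIntR_gammaden_1|].
  destruct (gammaden_dom1 (S n) ltac:(lia)) as [K1 H1]. destruct (gammaden_dom1 (S (S n)) ltac:(lia)) as [K2 H2].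
  pose proof (dom1_scal (INR (S n)) _ _ H1) as H3.
  assert (E : RIntR (fun v => INR (S n) * gammaden (S n) v + -1 * gammaden (S (S n)) v) = 0).
  { eapply RIntR_derive_0; [|eapply dom1_dom, H1|].
    - apply dom_plus; [apply dom_scal, dom1_dom, H1|apply dom_scal, dom1_dom, H2].
    - intros x. replace (INR (S n) * gammaden (S n) x + -1 * gammaden (S (S n)) x) with (INR (S n) * gammaden (S n) x - gammaden (S (S n)) x) by ring.
      apply gammaden_derive. }
  erewrite RIntR_plus, !RIntR_scal in E by (try apply dom_scal; eapply dom1_dom; eassumption).
  rewrite fact_simpl, mult_INR, <- IH. lra.
Qed.

Lemma sq_le_cosh y : y * y <= exp y - 2 + exp (- y).
Proof.
  assert (H : forall x, 0 <= x -> 2 * x <= exp x - exp (- x)).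
  { intros x Hx. destruct (mvt (fun x => exp x - exp (- x) - 2 * x) (fun x => exp x + exp (- x) - 2) 0 x) as [c [Hc E]].
    - intros z. auto_derive; [trivial|ring].
    - rewrite Ropp_0, exp_0 in E.
      assert (0 <= exp c + exp (- c) - 2).
      { rewrite exp_Ropp. pose proof (exp_pos c) as P.
        replace (exp c + / exp c - 2) with ((exp c - 1) * (exp c - 1) * / exp c) by (field; lra).
        apply Rmult_le_pos; [apply (Rle_0_sqr (exp c - 1))|left; now apply Rinv_0_lt_compat]. }
      rewrite Rminus_0_r in E. pose proof (Rmult_le_pos _ _ H Hx). lra. }
  assert (G : forall x, 0 <= x -> x * x <= exp x - 2 + exp (- x)).
  { intros x Hx. specialize (H (x / 2) ltac:(lra)).
    replace (exp x - 2 + exp (- x)) with ((exp (x / 2) - exp (- (x / 2))) * (exp (x / 2) - exp (- (x / 2)))).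
    - nra.
    - replace (exp x) with (exp (x / 2) * exp (x / 2)) by (rewrite <- exp_plus; f_equal; field).
      replace (exp (- x)) with (exp (- (x / 2)) * exp (- (x / 2))) by (rewrite <- exp_plus; f_equal; field).
      assert (exp (x / 2) * exp (- (x / 2)) = 1) by (rewrite <- exp_plus, Rplus_opp_r, exp_0; reflexivity).
      nra. }
  destruct (Rle_dec 0 y) as [P|P]; [now apply G|].
  specialize (G (- y) ltac:(lra)). rewrite Ropp_involutive in G. lra.
Qed.

Lemma Rabs_le_half_exp y : Rabs y <= 2 * exp (3 / 4 * Rabs y).
Proof.
  pose proof (Rabs_pos y). pose proof (exp_ineq1_le (3 / 4 * Rabs y)). lra.
Qed.

(* [P] is the density of [ln (T / n)] for a Gamma(n+1) variable [T]. By [(ln x)^2 <= x - 2 + 1/x] and the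
   exact moments of [T] and [1/T], it concentrates at [0], which yields both Gauss' limit and Euler's constant. *)
Section Concentration.
Variable n : nat.
Hypothesis Hn : (1 <= n)%nat.
Let c := ln (INR n).
Let P (y : R) := / INR (fact n) * gammaden (S n) (y + c).

Let n_pos : 0 < INR n. Proof. apply lt_0_INR; lia. Qed.
Let f_pos : 0 < INR (fact n). Proof. apply INR_fact_lt_0. Qed.
Let exp_c : exp c = INR n. Proof. apply exp_ln, n_pos. Qed.

Lemma conc_dom : exists K, dom1 K P.
Proof.
  destruct (gammaden_dom1 (S n) ltac:(lia)) as [K H].
  eexists. apply dom1_scal, (dom1_shift _ _ c H).
Qed.

Lemma conc_mass : RIntR P = 1.
Proof.
  destruct (gammaden_dom1 (S n) ltac:(lia)) as [K H]. unfold P.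
  erewrite RIntR_scal, RIntR_shift, RIntR_gammaden; [field; lra|eapply dom1_dom, H|eapply dom1_dom, dom1_shift, H].
Qed.

Let Q (y : R) := P y * (exp y - 2 + exp (- y)).

(** The moments are E[T/n] = (n+1)/n and E[n/T] = 1, so the mean of T/n - 2 + n/T is 1/n. The
    hypothesis n >= 1 makes the density of the inverse moment integrable. *)
Lemma conc_Q : (exists K, dom K Q) /\ RIntR Q = / INR n.
Proof.
  destruct (gammaden_dom1 (S (S n)) ltac:(lia)) as [K2 H2]. destruct (gammaden_dom1 (S n) ltac:(lia)) as [K1 H1].
  destruct (gammaden_dom1 n Hn) as [K0 H0].
  pose (R2 := fun y => / INR (fact n) / INR n * gammaden (S (S n)) (y + c)).
  pose (R1 := fun y => - 2 * / INR (fact n) * gammaden (S n) (y + c)).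
  pose (R0 := fun y => / INR (fact n) * INR n * gammaden n (y + c)).
  assert (D2 := dom_scal (/ INR (fact n) / INR n) _ _ (dom1_dom _ _ (dom1_shift _ _ c H2))).
  assert (D1 := dom_scal (- 2 * / INR (fact n)) _ _ (dom1_dom _ _ (dom1_shift _ _ c H1))).
  assert (D0 := dom_scal (/ INR (fact n) * INR n) _ _ (dom1_dom _ _ (dom1_shift _ _ c H0))).
  assert (E : Q = fun y => R2 y + (R1 y + R0 y)).
  { apply functional_extensionality. intros y. unfold Q, P, R2, R1, R0.
    rewrite !gammaden_S, exp_plus, exp_c, exp_Ropp. pose proof (exp_pos y). field. lra. }
  rewrite E. split.
  - eexists. apply dom_plus; [apply D2|apply dom_plus; [apply D1|apply D0]].
  - erewrite RIntR_plus; [|apply D2|apply dom_plus; [apply D1|apply D0]].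
    erewrite RIntR_plus; [|apply D1|apply D0].
    unfold R2, R1, R0.
    erewrite !RIntR_scal by (eapply dom1_dom, dom1_shift; eassumption).
    erewrite !RIntR_shift by (eapply dom1_dom; eassumption).
    destruct n as [|m]; [lia|].
    rewrite !RIntR_gammaden. rewrite !fact_simpl, !mult_INR, (S_INR (S m)).
    pose proof (INR_fact_neq_0 m). field. lra.
Qed.

Lemma conc_bound k a b : 0 <= a -> 0 <= b -> (exists K, dom K (fun y => P y * k y)) ->
  (forall y, Rabs (k y) <= a + b * (exp y - 2 + exp (- y))) ->
  Rabs (RIntR (fun y => P y * k y)) <= a + b / INR n.
Proof.
  intros Ha Hb [K HK] Hk. destruct conc_Q as [[KQ HQ] EQ]. destruct conc_dom as [KP HP].
  apply dom1_dom in HP.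
  assert (HT := dom_plus _ _ _ _ (dom_scal a _ _ HP) (dom_scal b _ _ HQ)).
  assert (ET : RIntR (fun y => a * P y + b * Q y) = a + b / INR n).
  { erewrite RIntR_plus, !RIntR_scal, conc_mass, EQ; [unfold Rdiv; ring|eassumption|eassumption|apply dom_scal; eassumption|apply dom_scal; eassumption]. }
  assert (PP : forall y, 0 <= P y).
  { intros y. unfold P. apply Rmult_le_pos; [left; now apply Rinv_0_lt_compat|left; apply exp_pos]. }
  assert (B : forall y, Rabs (P y * k y) <= a * P y + b * Q y).
  { intros y. rewrite Rabs_mult, (Rabs_pos_eq (P y)) by apply PP. specialize (Hk y). specialize (PP y).
    unfold Q. nra. }
  apply Rabs_le. rewrite <- ET. split.
  - replace (- RIntR (fun y => a * P y + b * Q y)) with (RIntR (fun y => -1 * (a * P y + b * Q y)))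
      by (erewrite RIntR_scal by eassumption; ring).
    eapply RIntR_le; [apply dom_scal, HT|apply HK|]. intros y; specialize (B y).
    pose proof (Rle_abs (- (P y * k y))). rewrite Rabs_Ropp in *. lra.
  - eapply RIntR_le; [apply HK|apply HT|]. intros y; specialize (B y).
    pose proof (Rle_abs (P y * k y)). lra.
Qed.

(** The inequality of means with weight sqrt n: after integration the constant and the quadratic
    part contribute equally, 1/(2 sqrt n) each. *)
Lemma abs_le_amgm y : Rabs y <= / 2 * / sqrt (INR n) + sqrt (INR n) / 2 * (exp y - 2 + exp (- y)).
Proof.
  assert (Hs : 0 < sqrt (INR n)) by (apply sqrt_lt_R0, n_pos).
  pose proof (sq_le_cosh y) as H.
  apply Rle_trans with (/ 2 * / sqrt (INR n) + sqrt (INR n) / 2 * (y * y)).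
  - replace (y * y) with (Rabs y * Rabs y) by (rewrite <- Rabs_mult; apply Rabs_pos_eq; nra).
    apply (Rmult_le_reg_l (2 * sqrt (INR n))); [lra|].
    replace (2 * sqrt (INR n) * (/ 2 * / sqrt (INR n) + sqrt (INR n) / 2 * (Rabs y * Rabs y)))
      with (1 + (sqrt (INR n) * Rabs y) * (sqrt (INR n) * Rabs y)) by (field; lra).
    pose proof (Rle_0_sqr (1 - sqrt (INR n) * Rabs y)) as S; unfold Rsqr in S; lra.
  - apply Rplus_le_compat_l, Rmult_le_compat_l; lra.
Qed.

Lemma sqrt_inv_sum : / 2 * / sqrt (INR n) + sqrt (INR n) / 2 / INR n = / sqrt (INR n).
Proof.
  assert (Hs : 0 < sqrt (INR n)) by (apply sqrt_lt_R0, n_pos).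
  rewrite <- (sqrt_sqrt (INR n)) at 3 by lra. field. lra.
Qed.

Lemma conc_id : (exists K, dom K (fun y => P y * y)) /\ Rabs (RIntR (fun y => P y * y)) <= / sqrt (INR n).
Proof.
  destruct conc_dom as [K HK].
  assert (D : exists K, dom K (fun y => P y * y)).
  { exists (K * 2). apply (dom_of_dom1 K P (fun y => y) 2); [assumption|intros; apply continuous_id|apply Rabs_le_half_exp]. }
  split; [assumption|].
  assert (Hs : 0 < sqrt (INR n)) by (apply sqrt_lt_R0, n_pos).
  rewrite <- sqrt_inv_sum. apply (conc_bound (fun y => y)); [|lra|assumption|apply abs_le_amgm].
  apply Rmult_le_pos; [lra|left; now apply Rinv_0_lt_compat].
Qed.

(** The characteristic function of a law concentrated at 0 is close to 1: the real part uses 1 -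
    cos(ty) <= t^2 y^2, the imaginary part |sin(ty)| <= |t| |y|, each followed by [conc_bound]. *)
Lemma conc_transform t : Cmod (laplace P (0, t) - 1) <= (t * t + Rabs t) / sqrt (INR n).
Proof.
  destruct conc_dom as [K HK].
  assert (Hs : 0 < sqrt (INR n)) by (apply sqrt_lt_R0, n_pos).
  assert (H0 : Rabs 0 <= / 4) by (rewrite Rabs_R0; lra).
  pose proof (dom_wcos _ _ 0 t H0 HK) as Dc. pose proof (dom_wsin _ _ 0 t H0 HK) as Ds.
  pose proof (dom1_dom _ _ HK) as DP.
  assert (Wc : forall y, wcos 0 t y = cos (t * y)) by (intros; unfold wcos; rewrite Rmult_0_l, exp_0; ring).
  assert (Ws : forall y, wsin 0 t y = sin (t * y)) by (intros; unfold wsin; rewrite Rmult_0_l, exp_0; ring).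
  eapply Rle_trans; [apply Cmod_le_sum|]. unfold laplace, Re, Im; simpl. rewrite Ropp_0, Rplus_0_r.
  replace (Ropp 1) with (-1) by ring.
  assert (Hsn : / INR n <= / sqrt (INR n)).
  { apply Rinv_le_contravar; [assumption|]. rewrite <- (sqrt_sqrt (INR n)) at 2 by lra.
    assert (1 <= sqrt (INR n)); [|nra]. rewrite <- sqrt_1. apply sqrt_le_1; [lra|lra|].
    apply (le_INR 1); assumption. }
  assert (A1 : Rabs (RIntR (fun w => P w * wcos 0 t w) + -1) <= t * t / sqrt (INR n)).
  { assert (E1 : RIntR (fun y => P y * (wcos 0 t y - 1)) = RIntR (fun w => P w * wcos 0 t w) + -1).
    { rewrite (RIntR_ext _ (fun y => P y * wcos 0 t y - P y)) by (intros; ring).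
      erewrite RIntR_minus, conc_mass by eassumption. ring. }
    rewrite <- E1.
    eapply Rle_trans; [apply (conc_bound _ 0 (t * t)); [lra|nra| |]|].
    - exists (K + K). pose proof (dom_minus _ _ _ _ Dc DP) as D.
      replace (fun y : R => P y * (wcos 0 t y - 1)) with (fun y => P y * wcos 0 t y - P y)
        by (apply functional_extensionality; intros; ring). exact D.
    - intros y. rewrite Wc. pose proof (sq_le_cosh y) as Hy.
      assert (Hc : 1 - cos (t * y) <= (t * y) * (t * y)).
      { replace (t * y) with (2 * (t * y / 2)) at 1 by field. rewrite cos_2a_sin.
        assert (Hsin : sin (t * y / 2) * sin (t * y / 2) <= (t * y / 2) * (t * y / 2)).
        { destruct (mvt sin cos 0 (t * y / 2)) as [x [_ E]]; [intros; apply is_derive_Reals, derivable_pt_lim_sin|].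
          rewrite sin_0, !Rminus_0_r in E. rewrite E. pose proof (COS_bound x).
          replace (cos x * (t * y / 2) * (cos x * (t * y / 2))) with ((cos x * cos x) * ((t * y / 2) * (t * y / 2))) by ring.
          rewrite <- (Rmult_1_l (t * y / 2 * (t * y / 2))) at 2.
          apply Rmult_le_compat_r; [apply (Rle_0_sqr (t * y / 2))|].
          clear - H. nra. }
        pose proof (Rle_0_sqr (t * y)) as S; unfold Rsqr in S; lra. }
      pose proof (COS_bound (t * y)). rewrite Rabs_left1 by lra.
      pose proof (Rle_0_sqr t) as St; unfold Rsqr in St.
      pose proof (Rmult_le_compat_l _ _ _ St Hy). lra.
    - rewrite Rplus_0_l. unfold Rdiv. apply Rmult_le_compat_l; [nra|assumption]. }
  assert (A2 : Rabs (RIntR (fun w => P w * wsin 0 t w)) <= Rabs t / sqrt (INR n)).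
  { replace (Rabs t / sqrt (INR n)) with (Rabs t * (/ 2 * / sqrt (INR n)) + Rabs t * (sqrt (INR n) / 2) / INR n).
    - pose proof (Rabs_pos t). apply conc_bound; [|nra|eexists; eassumption|].
      + apply Rmult_le_pos; [assumption|]. apply Rmult_le_pos; [lra|left; now apply Rinv_0_lt_compat].
      + intros y. rewrite Ws. pose proof (abs_le_amgm y).
        assert (Rabs (sin (t * y)) <= Rabs t * Rabs y).
        { rewrite <- Rabs_mult. destruct (mvt sin cos 0 (t * y)) as [x [_ E]]; [intros; apply is_derive_Reals, derivable_pt_lim_sin|].
          rewrite sin_0, !Rminus_0_r in E. rewrite E, Rabs_mult. pose proof (Rabs_cos_le x). pose proof (Rabs_pos (t * y)). nra. }
        nra.
    - unfold Rdiv. rewrite Rmult_assoc, <- Rmult_plus_distr_l. f_equal. apply sqrt_inv_sum. }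
  apply Rle_trans with (t * t / sqrt (INR n) + Rabs t / sqrt (INR n)); [lra|right; field; lra].
Qed.
End Concentration.

Lemma factorial_fact n : ssrnat.factorial n = fact n.
Proof. induction n as [|n IH]; [reflexivity|]. rewrite ssrnat.factS, IH. reflexivity. Qed.

Lemma Cexp_plus a b : Cexp (a + b) = Cmult (Cexp a) (Cexp b).
Proof.
  destruct a as [a1 a2], b as [b1 b2]. unfold Cexp, Cmult, Cplus; simpl.
  rewrite exp_plus, cos_plus, sin_plus. f_equal; ring.
Qed.

Lemma Cexp_0 : Cexp 0 = (RtoC 1).
Proof. unfold Cexp; simpl. rewrite exp_0, cos_0, sin_0. unfold RtoC; f_equal; ring. Qed.

Lemma Cexp_neq_0 a : Cexp a <> (RtoC 0).
Proof.
  intros E. assert (H : Cmult (Cexp a) (Cexp (- a)) = (RtoC 1)) by (rewrite <- Cexp_plus, <- Cexp_0; f_equal; ring).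
  rewrite E in H. rewrite Cmult_0_l in H. injection H. lra.
Qed.

Lemma inv_sqrt_small c eps : 0 <= c -> 0 < eps -> exists N, (1 <= N)%nat /\ forall n, (N <= n)%nat -> c / sqrt (INR n) <= eps.
Proof.
  intros Hc He. destruct (INR_eventually_ge ((c / eps) * (c / eps) + 1)) as [N HN].
  exists (S N). split; [lia|]. intros n Hn. specialize (HN n ltac:(lia)).
  assert (Hce : 0 <= c / eps) by (apply Rmult_le_pos; [assumption|left; now apply Rinv_0_lt_compat]).
  assert (H : c / eps <= sqrt (INR n)).
  { rewrite <- (sqrt_square (c / eps)) by assumption. apply sqrt_le_1; [nra|apply pos_INR|lra]. }
  assert (Hp : 0 < sqrt (INR n)).
  { apply sqrt_lt_R0. nra. }
  apply (Rmult_le_reg_r (sqrt (INR n))); [assumption|].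
  replace (c / sqrt (INR n) * sqrt (INR n)) with (eps * (c / eps)) by (field; lra).
  apply Rmult_le_compat_l; lra.
Qed.

Lemma Cprod_gammaden z n : Rabs (Re z) <= / 4 ->
  Cmult (Cprod (fun j => z + RtoC (INR j))%C n) (laplace (gammaden 1) z) = Cmult z (laplace (gammaden (S n)) z).
Proof.
  intros Hz. induction n as [|n IH].
  - simpl. f_equal. apply Cplus_0_r.
  - change (Cprod (fun j => z + RtoC (INR j))%C (S n)) with
      (Cmult (Cprod (fun j => z + RtoC (INR j))%C n) (z + RtoC (INR (S n)))%C).
    rewrite (laplace_gammaden_S (S n)) by (lia || assumption).
    transitivity (Cmult (z + RtoC (INR (S n)))%C (Cmult (Cprod (fun j => z + RtoC (INR j))%C n) (laplace (gammaden 1) z))); [ring|].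
    rewrite IH. ring.
Qed.

(** Gauss' quotient equals Gamma(1+z)/z divided by r, the transform at z of the concentrated
    density, and r tends to 1 by [conc_transform]. The arguments of Gamma in [delta_term] all lie on
    the imaginary axis. *)
Lemma Gamma_imag t : t <> 0 -> Gamma (0, t) = Cdiv (laplace (gammaden 1) (0, t)) (0, t).
Proof.
  intros Ht. set (z := (0, t) : C). set (G := laplace (gammaden 1) z).
  assert (Hz : Rabs (Re z) <= / 4) by (simpl; rewrite Rabs_R0; lra).
  assert (Hz0 : z <> (RtoC 0)) by (intros E; injection E; assumption).
  unfold Gamma. apply Clim_eq. intros eps He.
  set (B := Cmod (Cdiv G z)). assert (HB : 0 <= B) by apply Cmod_ge_0.
  set (c := t * t + Rabs t). assert (Hc : 0 <= c) by (unfold c; pose proof (Rabs_pos t); pose proof (Rle_0_sqr t) as S; unfold Rsqr in S; lra).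
  destruct (inv_sqrt_small c (Rmin (/ 2) (eps / (2 * B + 1)))) as [N [HN1 HN]]; [assumption| |].
  { apply Rmin_pos; [lra|apply Rdiv_lt_0_compat; lra]. }
  exists N. intros n Hn. specialize (HN n Hn). assert (Hn1 : (1 <= n)%nat) by lia.
  pose proof (conc_transform n Hn1 t) as HT. fold z c in HT.
  pose proof (Rmin_l (/ 2) (eps / (2 * B + 1))). pose proof (Rmin_r (/ 2) (eps / (2 * B + 1))).
  destruct (gammaden_dom1 (S n) ltac:(lia)) as [K HK].
  rewrite (laplace_scal (/ INR (fact n)) _ _ z Hz (dom1_shift _ _ (ln (INR n)) HK)) in HT.
  rewrite (laplace_shift (ln (INR n)) _ _ z Hz HK) in HT.
  set (r := Cmult (RtoC (/ INR (fact n))) (Cmult (Cexp (- z * ln (INR n))) (laplace (gammaden (S n)) z))) in HT.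
  assert (Hr : / 2 <= Cmod r).
  { pose proof (Cmod_triangle (1 - r) r) as T. replace (1 - r + r)%C with (RtoC 1) in T by ring.
    rewrite Cmod_1 in T. replace (1 - r)%C with (- (r - 1))%C in T by ring. rewrite Cmod_opp in T. lra. }
  assert (Hr0 : r <> (RtoC 0)) by (intros E; rewrite E, Cmod_0 in Hr; lra).
  assert (Hf : RtoC (INR (fact n)) <> (RtoC 0)) by (intros E; injection E; apply INR_fact_neq_0).
  assert (Hprod : forall m, Cprod (fun j => z + RtoC (INR j))%C m <> (RtoC 0)).
  { assert (Hj : forall j, (z + RtoC (INR j))%C <> (RtoC 0)).
    { intros j E. apply (f_equal snd) in E. simpl in E. lra. }
    intros m; induction m as [|m IHm]; [apply (Hj 0%nat)|]. apply Cmult_neq_0; [assumption|apply (Hj (S m))]. }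
  assert (E : (Defs.Cpow (INR n) z * RtoC (INR (ssrnat.factorial n)) / Cprod (fun j => z + RtoC (INR j))%C n)%C = (G / z / r)%C).
  { rewrite factorial_fact. pose proof (Cprod_gammaden z n Hz) as HP. fold G in HP.
    specialize (Hprod n). set (Pr := Cprod _ n) in *.
    assert (HL : laplace (gammaden (S n)) z = (Pr * G / z)%C) by (rewrite HP; field; assumption).
    assert (Hrdef : r = (/ RtoC (INR (fact n)) * (Cexp (- z * ln (INR n)) * (Pr * G / z)))%C).
    { unfold r. rewrite HL. rewrite RtoC_inv by apply INR_fact_neq_0. reflexivity. }
    assert (HG : G <> (RtoC 0)). { intros E. apply Hr0. rewrite Hrdef, E. field. auto. }
    unfold Defs.Cpow. rewrite Hrdef.
    assert (HX : Cmult (Cexp (z * ln (INR n))) (Cexp (- z * ln (INR n))) = (RtoC 1)).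
    { rewrite <- Cexp_plus, <- Cexp_0. f_equal. ring. }
    pose proof (Cexp_neq_0 (- z * ln (INR n))) as HE.
    replace (Cexp (z * ln (INR n))) with (/ Cexp (- z * ln (INR n)))%C.
    - field. repeat split; assumption.
    - apply (f_equal (fun w => (w / Cexp (- z * ln (INR n)))%C)) in HX.
      transitivity (1 / Cexp (- z * ln (INR n)))%C; [field; assumption|]. rewrite <- HX. field; assumption. }
  rewrite E.
  replace (G / z / r - G / z)%C with (G / z * ((1 - r) / r))%C by (field; split; assumption).
  rewrite Cmod_mult. fold B. rewrite Cmod_div by assumption.
  replace (1 - r)%C with (- (r - 1))%C by ring. rewrite Cmod_opp.
  assert (Hm : Cmod (r - 1) <= eps / (2 * B + 1)) by lra.
  apply Rle_trans with (B * (2 * (eps / (2 * B + 1)))).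
  - apply Rmult_le_compat_l; [assumption|].
    apply (Rmult_le_reg_r (Cmod r)); [lra|]. unfold Rdiv at 1. rewrite Rmult_assoc, Rinv_l, Rmult_1_r by lra.
    assert (0 <= eps / (2 * B + 1)) by (left; apply Rdiv_lt_0_compat; lra). nra.
  - apply (Rmult_le_reg_r (2 * B + 1)); [lra|]. field_simplify; [|lra]. nra.
Qed.

(** Integration by parts again, in the form Gamma'(n+1) = n! (Gamma'(1) + H_n), where the [match] is
    the harmonic number H_n with H_0 = 0. *)
Lemma RIntR_gammaden_log n : (exists K, dom K (fun v => gammaden (S n) v * v)) /\
  RIntR (fun v => gammaden (S n) v * v) = INR (fact n) * (RIntR (fun v => gammaden 1 v * v) +
     match n with O => 0 | S m => sum_f_R0 (fun k => / INR (S k)) m end).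
Proof.
  assert (D : forall n, exists K, dom K (fun v => gammaden (S n) v * v)).
  { intros m. destruct (gammaden_dom1 (S m) ltac:(lia)) as [K HK]. exists (K * 2).
    apply (dom_of_dom1 K _ (fun y => y) 2); [assumption|intros; apply continuous_id|apply Rabs_le_half_exp]. }
  split; [apply D|]. induction n as [|n IH]; [simpl; ring|].
  destruct (D n) as [K1 D1]. destruct (D (S n)) as [K2 D2].
  destruct (gammaden_dom1 (S n) ltac:(lia)) as [K0 H0]. pose proof (dom1_dom _ _ H0) as D0.
  pose proof (dom_scal (INR (S n)) _ _ D1) as D1'. pose proof (dom_scal (-1) _ _ D2) as D2'.
  assert (E : RIntR (fun v => gammaden (S n) v + (INR (S n) * (gammaden (S n) v * v) + -1 * (gammaden (S (S n)) v * v))) = 0).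
  { apply (RIntR_derive_0 (K0 + (Rabs (INR (S n)) * K1 + Rabs (-1) * K2)) K1 (fun v => gammaden (S n) v * v)).
    - apply dom_plus; [assumption|]. apply dom_plus; assumption.
    - assumption.
    - intros v. replace (gammaden (S n) v + (INR (S n) * (gammaden (S n) v * v) + -1 * (gammaden (S (S n)) v * v)))
        with ((INR (S n) * gammaden (S n) v - gammaden (S (S n)) v) * v + gammaden (S n) v * 1) by ring.
      apply (is_derive_mult (gammaden (S n)) (fun v => v)); [apply gammaden_derive|auto_derive; trivial|intros; apply Rmult_comm]. }
  rewrite (RIntR_plus K0 (Rabs (INR (S n)) * K1 + Rabs (-1) * K2)), (RIntR_plus (Rabs (INR (S n)) * K1) (Rabs (-1) * K2)),
    (RIntR_scal _ K1), (RIntR_scal _ K2), RIntR_gammaden in E by (assumption || (apply dom_plus; assumption)).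
  rewrite IH in E. replace (RIntR (fun v => gammaden (S (S n)) v * v)) with (INR (fact n) + INR (S n) *
       (INR (fact n) * (RIntR (fun v => gammaden 1 v * v) + match n with 0%nat => 0 | S m => sum_f_R0 (fun k => / INR (S k)) m end))) by lra.
  rewrite fact_simpl, mult_INR. destruct n as [|n].
  - simpl. field.
  - rewrite tech5. field. apply not_0_INR; lia.
Qed.

(** The constant is -Gamma'(1): the mean of ln(T/n) is Gamma'(1) + H_n - ln n by the preceding
    lemma, and it tends to 0 by concentration. *)
Lemma euler_gamma_RIntR : euler_gamma = - RIntR (fun v => gammaden 1 v * v).
Proof.
  unfold euler_gamma.
  assert (H : is_lim_seq (fun n => sum_n (fun k => / INR (S k)) n - ln (INR (S n))) (- RIntR (fun v => gammaden 1 v * v))).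
  { apply is_lim_seq_eps. intros eps He. destruct (inv_sqrt_small 1 eps) as [N [HN1 HN]]; [lra|assumption|].
    exists N. intros n Hn. specialize (HN (S n) ltac:(lia)).
    assert (Hn1 : (1 <= S n)%nat) by lia.
    destruct (conc_id (S n) Hn1) as [_ HC].
    destruct (RIntR_gammaden_log (S n)) as [[K1 D1] E1].
    destruct (gammaden_dom1 (S (S n)) ltac:(lia)) as [K0 H0].
    pose proof (INR_fact_lt_0 (S n)) as Hf.
    assert (E : RIntR (fun y => / INR (fact (S n)) * gammaden (S (S n)) (y + ln (INR (S n))) * y) =
      RIntR (fun v => gammaden 1 v * v) + sum_f_R0 (fun k => / INR (S k)) n - ln (INR (S n))).
    { pose proof (dom_scal (/ INR (fact (S n))) _ _ D1) as D1'.
      pose proof (dom_scal (/ INR (fact (S n)) * ln (INR (S n))) _ _ (dom1_dom _ _ H0)) as D0'.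
      transitivity (RIntR (fun y => / INR (fact (S n)) * (gammaden (S (S n)) y * y) - / INR (fact (S n)) * ln (INR (S n)) * gammaden (S (S n)) y)).
      - rewrite <- (RIntR_shift _ _ (ln (INR (S n))) (dom_minus _ _ _ _ D1' D0')). apply RIntR_ext; intros; ring.
      - rewrite (RIntR_minus _ _ _ _ D1' D0'), (RIntR_scal _ _ _ D1), (RIntR_scal _ _ _ (dom1_dom _ _ H0)), RIntR_gammaden, E1. field. lra. }
    rewrite E in HC. rewrite sum_n_Reals.
    replace (sum_f_R0 (fun k => / INR (S k)) n - ln (INR (S n)) - - RIntR (fun v => gammaden 1 v * v))
      with (RIntR (fun v => gammaden 1 v * v) + sum_f_R0 (fun k => / INR (S k)) n - ln (INR (S n))) by ring.
    unfold Rdiv in HN. rewrite Rmult_1_l in HN. lra. }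
  apply is_lim_seq_unique in H. now rewrite H.
Qed.

(** * Euler transformation of alternating series *)

(** With this orientation the n-th difference is sum (-1)^k C(n,k) f(m+k), the inner sum of Hasse's
    series without a further sign. *)
Definition fdiff (f : nat -> R) (m : nat) : R := f m - f (S m).
Fixpoint fdiffs (n : nat) (f : nat -> R) : nat -> R :=
  match n with O => f | S n => fdiffs n (fdiff f) end.
Definition altsum (f : nat -> R) : R := Series (fun m => (-1) ^ m * f m).
(* Hasse's series for the zeta function is this transformation applied to [sum (-1)^m (m+1)^(-s)]. *)
Definition euler_sum (N : nat) (f : nat -> R) : R := sum_f_R0 (fun n => / 2 ^ S n * fdiffs n f 0%nat) N.

Definition geo (G rho : R) (f : nat -> R) : Prop := forall m, Rabs (f m) <= G * rho ^ m.

Lemma fdiffs_S_r n f m : fdiffs (S n) f m = fdiffs n f m - fdiffs n f (S m).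
Proof. revert f; induction n as [|n IH]; intros f; [reflexivity|]. apply (IH (fdiff f)). Qed.

Lemma pow_m1_abs m : Rabs ((-1) ^ m) = 1.
Proof. rewrite <- RPow_abs. replace (Rabs (-1)) with 1 by (rewrite Rabs_left; lra). apply pow1. Qed.

Lemma geo_nonneg G rho f : geo G rho f -> 0 <= G.
Proof. intros H. specialize (H 0%nat). simpl in H. pose proof (Rabs_pos (f 0%nat)). lra. Qed.

Lemma geo_fdiff G rho f : 0 <= rho -> geo G rho f -> geo (G * (1 + rho)) rho (fdiff f).
Proof.
  intros Hr H m. unfold fdiff. pose proof (H m) as H1. pose proof (H (S m)) as H2.
  replace (f m - f (S m)) with (f m + - f (S m)) by ring.
  eapply Rle_trans; [apply Rabs_triang|]. rewrite Rabs_Ropp. simpl in H2. lra.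
Qed.

Lemma geo_fdiffs n G rho f : 0 <= rho -> geo G rho f -> geo (G * (1 + rho) ^ n) rho (fdiffs n f).
Proof.
  intros Hr. revert G f; induction n as [|n IH]; intros G f H; simpl.
  - now rewrite Rmult_1_r.
  - rewrite <- Rmult_assoc. now apply IH, geo_fdiff.
Qed.

Lemma geo_series rho : 0 <= rho < 1 -> is_series (fun m => rho ^ m) (/ (1 - rho)).
Proof. intros H. apply is_series_geom. rewrite Rabs_pos_eq; lra. Qed.

Lemma geo_ex G rho f : 0 <= rho < 1 -> geo G rho f -> ex_series (fun m => Rabs ((-1) ^ m * f m)).
Proof.
  intros Hr H. apply (@ex_series_le R_AbsRing R_CompleteNormedModule _ (fun m => G * rho ^ m)).
  - intros m. unfold norm; simpl; unfold abs; simpl. rewrite Rabs_Rabsolu, Rabs_mult, pow_m1_abs, Rmult_1_l. apply H.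
  - apply (ex_series_scal_l G (fun m => rho ^ m)). eexists; now apply geo_series.
Qed.

Lemma geo_is_series G rho f : 0 <= rho < 1 -> geo G rho f -> is_series (fun m => (-1) ^ m * f m) (altsum f).
Proof. intros Hr H. apply Series_correct, ex_series_Rabs. now apply (geo_ex G rho). Qed.

Lemma altsum_bound G rho f : 0 <= rho < 1 -> geo G rho f -> Rabs (altsum f) <= G / (1 - rho).
Proof.
  intros Hr H. eapply Rle_trans; [apply Series_Rabs; now apply (geo_ex G rho)|].
  unfold Rdiv. rewrite <- (is_series_unique _ _ (geo_series rho Hr)), <- Series_scal_l.
  apply Series_le.
  - intros m; split; [apply Rabs_pos|]. rewrite Rabs_mult, pow_m1_abs, Rmult_1_l. apply H.
  - apply (ex_series_scal_l G (fun m => rho ^ m)). eexists; now apply geo_series.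
Qed.

(** Splitting the alternating sum of f m - f (m+1) gives twice the alternating sum of f minus f 0.
    Iterated, this is Euler's transformation with an exact remainder. *)
Lemma altsum_step G rho f : 0 <= rho < 1 -> geo G rho f ->
  altsum f = / 2 * f 0%nat + / 2 * altsum (fdiff f).
Proof.
  intros Hr H. unfold altsum.
  pose proof (ex_intro _ _ (geo_is_series _ _ _ Hr H) : ex_series (fun m => (-1) ^ m * f m)) as Hx.
  assert (E1 := Series_incr_1 _ Hx).
  assert (Hs : ex_series (fun k => (-1) ^ S k * f (S k))) by (apply (ex_series_incr_1 (fun m => (-1) ^ m * f m)), Hx).
  assert (E2 : Series (fun m => (-1) ^ m * fdiff f m) =
     Series (fun m => (-1) ^ m * f m) + Series (fun k => (-1) ^ S k * f (S k))).
  { rewrite <- Series_plus by assumption. apply Series_ext. intros m. unfold fdiff; simpl; ring. }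
  rewrite E2, E1. rewrite pow_O. field.
Qed.

Lemma altsum_euler N G rho f : 0 <= rho < 1 -> geo G rho f ->
  altsum f = euler_sum N f + / 2 ^ S N * altsum (fdiffs (S N) f).
Proof.
  intros Hr H. induction N as [|N IH].
  - unfold euler_sum. simpl. rewrite (altsum_step G rho f Hr H). field.
  - rewrite IH. unfold euler_sum. rewrite tech5.
    rewrite (altsum_step _ rho (fdiffs (S N) f) Hr (geo_fdiffs _ _ _ _ (proj1 Hr) H)).
    replace (altsum (fdiff (fdiffs (S N) f))) with (altsum (fdiffs (S (S N)) f)).
    + simpl pow. pose proof (pow_nonzero 2 N ltac:(lra)). field. assumption.
    + f_equal. apply functional_extensionality; intros m. now rewrite fdiffs_S_r.
Qed.

(** Geometric convergence for a fixed ratio. It yields local uniformity in w, but deteriorates as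
    the sampling step tends to 0, where rho tends to 1. *)
Lemma euler_geo_bound N G rho f : 0 <= rho < 1 -> geo G rho f ->
  Rabs (altsum f - euler_sum N f) <= ((1 + rho) / 2) ^ S N * (G / (1 - rho)).
Proof.
  intros Hr H. rewrite (altsum_euler N G rho f Hr H).
  replace (euler_sum N f + / 2 ^ S N * altsum (fdiffs (S N) f) - euler_sum N f)
    with (/ 2 ^ S N * altsum (fdiffs (S N) f)) by ring.
  rewrite Rabs_mult. pose proof (pow_lt 2 (S N) ltac:(lra)) as P.
  rewrite Rabs_pos_eq by (left; now apply Rinv_0_lt_compat).
  eapply Rle_trans; [apply Rmult_le_compat_l; [left; now apply Rinv_0_lt_compat|]|].
  - apply (altsum_bound (G * (1 + rho) ^ S N) rho); [assumption|]. apply geo_fdiffs; [apply Hr|apply H].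
  - right. unfold Rdiv. rewrite Rpow_mult_distr, pow_inv. field. split; lra.
Qed.

Lemma sum_abs_fdiff B f : (forall M, sum_f_R0 (fun m => Rabs (f m)) M <= B) ->
  forall M, sum_f_R0 (fun m => Rabs (fdiff f m)) M <= 2 * B.
Proof.
  intros H M.
  apply Rle_trans with (sum_f_R0 (fun m => Rabs (f m)) M + sum_f_R0 (fun m => Rabs (f (S m))) M).
  - rewrite <- sum_plus. apply sum_Rle. intros m _. unfold fdiff, Rminus.
    eapply Rle_trans; [apply Rabs_triang|]. rewrite Rabs_Ropp; lra.
  - pose proof (H M). pose proof (H (S M)) as H2. rewrite decomp_sum in H2 by lia. simpl pred in H2.
    pose proof (Rabs_pos (f 0%nat)). lra.
Qed.

Lemma sum_abs_fdiffs n B f : (forall M, sum_f_R0 (fun m => Rabs (f m)) M <= B) ->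
  forall M, sum_f_R0 (fun m => Rabs (fdiffs n f m)) M <= 2 ^ n * B.
Proof.
  revert B f; induction n as [|n IH]; intros B f H M; simpl.
  - rewrite Rmult_1_l; apply H.
  - replace (2 * 2 ^ n * B) with (2 ^ n * (2 * B)) by ring. apply IH, sum_abs_fdiff, H.
Qed.

Lemma altsum_sum_bound G rho B f : 0 <= rho < 1 -> geo G rho f ->
  (forall M, sum_f_R0 (fun m => Rabs (f m)) M <= B) -> Rabs (altsum f) <= B.
Proof.
  intros Hr H HB. pose proof (geo_is_series _ _ _ Hr H) as Hs.
  apply (is_lim_seq_abs _ (Finite (altsum f))) in Hs.
  assert (Rbar_le (Rabs (altsum f)) B) as K; [|exact K].
  eapply is_lim_seq_le; [|apply Hs|apply (is_lim_seq_const B)].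
  intros n. simpl. rewrite sum_n_Reals. eapply Rle_trans; [apply Rsum_abs|].
  eapply Rle_trans; [|apply (HB n)]. right. apply sum_eq. intros m _.
  rewrite Rabs_mult, pow_m1_abs; ring.
Qed.

(** A bound that does not see the ratio: beyond the fourth, every further difference at most doubles
    the absolute sum, which the factor 2^(-N-1) absorbs. It is uniform in N and therefore provides
    the majorant for dominated convergence; N >= 3 guarantees four differences. *)
Lemma euler_smooth_bound N G rho B f : 0 <= rho < 1 -> geo G rho f -> (3 <= N)%nat ->
  (forall M, sum_f_R0 (fun m => Rabs (fdiffs 4 f m)) M <= B) ->
  Rabs (altsum f - euler_sum N f) <= B.
Proof.
  intros Hr H HN HB. rewrite (altsum_euler N G rho f Hr H).
  replace (euler_sum N f + / 2 ^ S N * altsum (fdiffs (S N) f) - euler_sum N f)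
    with (/ 2 ^ S N * altsum (fdiffs (S N) f)) by ring.
  rewrite Rabs_mult. pose proof (pow_lt 2 (S N) ltac:(lra)) as P.
  rewrite Rabs_pos_eq by (left; now apply Rinv_0_lt_compat).
  destruct (Nat.le_exists_sub 3 N HN) as [j [-> _]].
  assert (E : forall i f, fdiffs (i + 4) f = fdiffs i (fdiffs 4 f)).
  { clear. intros i f. replace (i + 4)%nat with (4 + i)%nat by lia.
    apply functional_extensionality. induction i as [|i IH]; intros m; [reflexivity|].
    replace (4 + S i)%nat with (S (4 + i)) by lia. now rewrite !fdiffs_S_r, !IH. }
  replace (S (j + 3)) with (j + 4)%nat in * by lia.
  assert (HB' : Rabs (altsum (fdiffs (j + 4) f)) <= 2 ^ j * B).
  { apply (altsum_sum_bound _ rho _ _ Hr (geo_fdiffs (j + 4) _ _ _ (proj1 Hr) H)).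
    rewrite E. now apply sum_abs_fdiffs. }
  pose proof (HB 0%nat) as H0. cbn [sum_f_R0] in H0. pose proof (Rabs_pos (fdiffs 4 f 0)) as Hp.
  assert (HBp : 0 <= B) by lra.
  apply (Rmult_le_reg_l (2 ^ (j + 4))); [assumption|]. rewrite <- Rmult_assoc, Rinv_r, Rmult_1_l by lra.
  eapply Rle_trans; [apply HB'|]. apply Rmult_le_compat_r; [assumption|].
  apply Rle_pow; [lra|lia].
Qed.

(** * Sampled smooth functions *)

(* [smooth_decay j F]: [F] has a [j]-th derivative that is [O(1 / (1 + x^2))] on [x >= 0]. *)
Fixpoint smooth_decay (j : nat) (F : R -> R) : Prop :=
  match j with
  | O => exists C, 0 <= C /\ forall x, 0 <= x -> Rabs (F x) <= C / (1 + x * x)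
  | S j => exists F', (forall x, is_derive F x (F' x)) /\ smooth_decay j F'
  end.

Fixpoint dsteps (y : R) (n : nat) (F : R -> R) (x : R) : R :=
  match n with O => F x | S n => dsteps y n F x - dsteps y n F (x + y) end.

Lemma dsteps_derive y n F F' : (forall x, is_derive F x (F' x)) -> forall x, is_derive (dsteps y n F) x (dsteps y n F' x).
Proof.
  intros H; induction n as [|n IH]; intros x; [apply H|].
  simpl. apply (is_derive_minus (dsteps y n F) (fun x => dsteps y n F (x + y))); [apply IH|].
  replace (dsteps y n F' (x + y)) with (1 * dsteps y n F' (x + y)) by ring.
  apply (is_derive_comp (dsteps y n F) (fun x => x + y)); [apply IH|]. auto_derive; [trivial|ring].
Qed.

Lemma one_add_sq_pos x : 0 < 1 + x * x.
Proof. pose proof (Rle_0_sqr x) as H; unfold Rsqr in H; lra. Qed.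

(** Each step difference is y times a derivative at an intermediate point to the right of x, where
    the bound 1/(1+x^2) is no larger. *)
Lemma dsteps_bound n F : smooth_decay n F -> exists C, 0 <= C /\ forall y x, 0 < y -> 0 <= x ->
  Rabs (dsteps y n F x) <= y ^ n * C / (1 + x * x).
Proof.
  revert F; induction n as [|n IH]; intros F H.
  - destruct H as [C [HC H]]. exists C. split; [assumption|]. intros y x _ Hx. simpl. rewrite Rmult_1_l. now apply H.
  - destruct H as [F' [HD H]]. destruct (IH _ H) as [C [HC B]]. exists C. split; [assumption|].
    intros y x Hy Hx. simpl dsteps.
    destruct (mvt (dsteps y n F) (dsteps y n F') x (x + y) (dsteps_derive y n F F' HD)) as [c [Hc E]].
    rewrite Rmin_left, Rmax_right in Hc by lra.
    rewrite Rabs_minus_sym, E. replace (x + y - x) with y by ring.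
    rewrite Rabs_mult, (Rabs_pos_eq y) by lra. specialize (B y c Hy ltac:(lra)).
    replace (y ^ S n * C / (1 + x * x)) with (y ^ n * C / (1 + x * x) * y) by (simpl; unfold Rdiv; ring).
    apply Rmult_le_compat_r; [lra|]. eapply Rle_trans; [apply B|].
    apply Rmult_le_compat_l; [apply Rmult_le_pos; [apply pow_le; lra|assumption]|].
    apply Rinv_le_contravar; [apply one_add_sq_pos|]. nra.
Qed.

(** For F(x) = x h(x) the division by y gives the terms j h(j y) with j = m+1, those of the
    alternating sum that defines the fluctuation. *)
Definition samp (F : R -> R) (y : R) (m : nat) : R := F (INR (S m) * y) / y.

Lemma fdiffs_samp F y n m : fdiffs n (samp F y) m = dsteps y n F (INR (S m) * y) / y.
Proof.
  revert m; induction n as [|n IH]; intros m; [reflexivity|].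
  rewrite fdiffs_S_r, !IH. cbn [dsteps]. rewrite (S_INR (S m)).
  replace ((INR (S m) + 1) * y) with (INR (S m) * y + y) by ring. unfold Rdiv; ring.
Qed.

(** A Riemann sum of 1/(1+x^2), compared with atan on each interval; the limit pi/2 is at most 2. *)
Lemma sum_inv_sq y M : 0 < y -> sum_f_R0 (fun m => y / (1 + INR (S m) * y * (INR (S m) * y))) M <= 2.
Proof.
  intros Hy. assert (H : forall M, sum_f_R0 (fun m => y / (1 + INR (S m) * y * (INR (S m) * y))) M <= atan (INR (S M) * y)).
  { assert (St : forall m, y / (1 + INR (S m) * y * (INR (S m) * y)) <= atan (INR (S m) * y) - atan (INR m * y)).
    { intros m. pose proof (pos_INR m) as Pm. rewrite S_INR.
      destruct (mvt atan (fun x => / (1 + x * x)) (INR m * y) ((INR m + 1) * y)) as [c [Hc E]].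
      { intros x. apply is_derive_Reals. replace (/ (1 + x * x)) with (/ (1 + x ^ 2)) by (f_equal; ring). apply derivable_pt_lim_atan. }
      rewrite Rmin_left, Rmax_right in Hc by nra. rewrite E.
      replace ((INR m + 1) * y - INR m * y) with y by ring. unfold Rdiv. rewrite Rmult_comm.
      apply Rmult_le_compat_r; [lra|]. apply Rinv_le_contravar; [apply one_add_sq_pos|].
      assert (0 <= INR m * y) by nra. nra. }
    induction M0 as [|K IH].
    - cbn [sum_f_R0]. pose proof (St 0%nat) as H0. change (INR 0) with 0 in H0. rewrite Rmult_0_l, atan_0 in H0. lra.
    - rewrite tech5. pose proof (St (S K)). lra. }
  eapply Rle_trans; [apply H|]. pose proof (atan_bound (INR (S M) * y)). pose proof PI_4. lra.
Qed.

Definition decays (F : R -> R) : Prop := exists C, 0 <= C /\ forall x, 0 <= x -> Rabs (F x) <= C * exp (- x).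

Lemma samp_geo C F y0 y : (forall x, 0 <= x -> Rabs (F x) <= C * exp (- x)) -> 0 <= C -> 0 < y0 <= y ->
  geo (C * exp (- y) / y) (exp (- y0)) (samp F y).
Proof.
  intros H HC Hy m. unfold samp. unfold Rdiv at 1. rewrite Rabs_mult, (Rabs_pos_eq (/ y)) by (left; apply Rinv_0_lt_compat; lra).
  pose proof (pos_INR m) as Pm. rewrite S_INR.
  eapply Rle_trans; [apply Rmult_le_compat_r; [left; apply Rinv_0_lt_compat; lra|apply H; nra]|].
  replace (C * exp (- y) / y * exp (- y0) ^ m) with (C * (exp (- y) * exp (- y0) ^ m) * / y) by (unfold Rdiv; ring).
  apply Rmult_le_compat_r; [left; apply Rinv_0_lt_compat; lra|]. apply Rmult_le_compat_l; [assumption|].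
  rewrite exp_pow, <- exp_plus. apply exp_le_mono. nra.
Qed.

Lemma exp_neg_lt_1 y : 0 < y -> 0 <= exp (- y) < 1.
Proof. intros H. split; [left; apply exp_pos|]. rewrite <- exp_0. apply exp_increasing. lra. Qed.

(** Four differences give y^4, the normalisation of the samples costs 1/y and the sum over the
    sample points another 1/y, which leaves y^2. With y = e^(w/2) this is e^w, exactly the decay at
    minus infinity that [dom1] demands. *)
Lemma samp_euler_smooth F : decays F -> smooth_decay 4 F -> exists C, 0 <= C /\ forall y N, 0 < y -> (3 <= N)%nat ->
  Rabs (altsum (samp F y) - euler_sum N (samp F y)) <= C * (y * y).
Proof.
  intros [C1 [HC1 H1]] H4. destruct (dsteps_bound 4 F H4) as [C [HC B]].
  exists (2 * C). split; [lra|]. intros y N Hy HN.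
  apply (euler_smooth_bound N _ _ _ _ (exp_neg_lt_1 y Hy) (samp_geo C1 F y y H1 HC1 ltac:(lra)) HN).
  intros M. apply Rle_trans with (C * (y * y) * sum_f_R0 (fun m => y / (1 + INR (S m) * y * (INR (S m) * y))) M).
  - rewrite scal_sum. apply sum_Rle. intros m _. rewrite fdiffs_samp.
    unfold Rdiv at 1. rewrite Rabs_mult, (Rabs_pos_eq (/ y)) by (left; now apply Rinv_0_lt_compat).
    pose proof (pos_INR (S m)). pose proof (one_add_sq_pos (INR (S m) * y)).
    eapply Rle_trans; [apply Rmult_le_compat_r; [left; now apply Rinv_0_lt_compat|apply B; [assumption|nra]]|].
    right. field. lra.
  - pose proof (sum_inv_sq y M Hy). assert (0 <= C * (y * y)) by (apply Rmult_le_pos; nra). nra.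
Qed.

Lemma samp_large F : decays F -> exists C, 0 <= C /\ forall y, 1 <= y ->
  Rabs (altsum (samp F y)) <= C * exp (- y) /\ forall N, Rabs (euler_sum N (samp F y)) <= C * exp (- y).
Proof.
  intros [C [HC H]]. pose proof (exp_neg_lt_1 1 Rlt_0_1) as Hr. set (rho := exp (- (1))) in *.
  assert (Hi : 0 < / (1 - rho)) by (apply Rinv_0_lt_compat; lra).
  exists (2 * C * / (1 - rho)). split; [apply Rmult_le_pos; lra|].
  intros y Hy. pose proof (samp_geo C F 1 y H HC ltac:(lra)) as G. fold rho in G.
  pose proof (exp_pos (- y)) as Py.
  assert (HG : C * exp (- y) / y <= C * exp (- y)).
  { unfold Rdiv. rewrite <- (Rmult_1_r (C * exp (- y))) at 2. apply Rmult_le_compat_l; [nra|].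
    rewrite <- Rinv_1. apply Rinv_le_contravar; lra. }
  assert (A1 : Rabs (altsum (samp F y)) <= C * exp (- y) * / (1 - rho)).
  { eapply Rle_trans; [apply (altsum_bound _ _ _ Hr G)|]. unfold Rdiv at 1. apply Rmult_le_compat_r; lra. }
  assert (P0 : 0 <= C * exp (- y) * / (1 - rho)) by (apply Rmult_le_pos; nra).
  split.
  { replace (2 * C * / (1 - rho) * exp (- y)) with (C * exp (- y) * / (1 - rho) + C * exp (- y) * / (1 - rho)) by ring. lra. }
  intros N.
  pose proof (euler_geo_bound N _ _ _ Hr G) as A2.
  assert (A3 : ((1 + rho) / 2) ^ S N * (C * exp (- y) / y / (1 - rho)) <= C * exp (- y) * / (1 - rho)).
  { rewrite <- (Rmult_1_l (C * exp (- y) * / (1 - rho))). apply Rmult_le_compat.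
    - apply pow_le; lra.
    - apply Rmult_le_pos; [|lra]. apply Rmult_le_pos; [nra|left; apply Rinv_0_lt_compat; lra].
    - eapply Rle_trans; [apply (pow_incr _ 1); lra|rewrite pow1; lra].
    - unfold Rdiv at 1. apply Rmult_le_compat_r; lra. }
  set (S0 := altsum _) in *. set (e := euler_sum _ _) in *.
  replace e with (S0 - (S0 - e)) by ring. eapply Rle_trans; [apply Rabs_triang|]. rewrite Rabs_Ropp.
  replace (2 * C * / (1 - rho) * exp (- y)) with (C * exp (- y) * / (1 - rho) + C * exp (- y) * / (1 - rho)) by ring.
  lra.
Qed.

Lemma euler_sum_3 f : euler_sum 3 f = 15 / 16 * f 0%nat - 11 / 16 * f 1%nat + 5 / 16 * f 2%nat - / 16 * f 3%nat.
Proof. unfold euler_sum, fdiffs, fdiff; simpl. field. Qed.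

(** For small y the alternating sum is compared with the Euler sum of four terms, which involves
    only the samples at y, 2y, 3y, 4y and thus reflects the order of vanishing of F at 0. *)
Lemma samp_euler_3 F C k y : 0 < y -> 0 <= C -> (forall x, 0 <= x -> Rabs (F x) <= C * x ^ S k) ->
  Rabs (euler_sum 3 (samp F y)) <= 2 * C * 4 ^ S k * y ^ k.
Proof.
  intros Hy HC H. rewrite euler_sum_3.
  assert (B : forall j, (j <= 3)%nat -> Rabs (samp F y j) <= C * 4 ^ S k * y ^ k).
  { intros j Hj. unfold samp. unfold Rdiv. rewrite Rabs_mult, (Rabs_pos_eq (/ y)) by (left; now apply Rinv_0_lt_compat).
    pose proof (pos_INR (S j)) as Pj. assert (Hj4 : INR (S j) <= 4) by (replace 4 with (INR 4) by (simpl; ring); apply le_INR; lia).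
    apply (Rmult_le_reg_r y); [assumption|]. rewrite Rmult_assoc, Rinv_l, Rmult_1_r by lra.
    eapply Rle_trans; [apply H; nra|]. rewrite Rpow_mult_distr.
    replace (C * 4 ^ S k * y ^ k * y) with (C * (4 ^ S k * y ^ S k)) by (simpl; ring).
    apply Rmult_le_compat_l; [assumption|]. apply Rmult_le_compat_r; [apply pow_le; lra|]. apply pow_incr; lra. }
  pose proof (B 0%nat ltac:(lia)) as B0; pose proof (B 1%nat ltac:(lia)) as B1.
  pose proof (B 2%nat ltac:(lia)) as B2; pose proof (B 3%nat ltac:(lia)) as B3.
  replace (2 * C * 4 ^ S k * y ^ k) with (2 * (C * 4 ^ S k * y ^ k)) by ring.
  set (K := C * 4 ^ S k * y ^ k) in *.
  apply Rabs_le_between in B0, B1, B2, B3. apply Rabs_le. lra.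
Qed.

(** * Gaussian samples and the fluctuation function *)

Definition gaussmon (k : nat) (x : R) : R := x ^ k * exp (- (x * x)).

Lemma gaussmon_decay k : decays (gaussmon k).
Proof.
  exists (INR k ^ k * exp 1).
  assert (P : 0 <= INR k ^ k * exp 1) by (apply Rmult_le_pos; [apply pow_le, pos_INR|left; apply exp_pos]).
  split; [assumption|]. intros x Hx. unfold gaussmon.
  rewrite Rabs_pos_eq by (apply Rmult_le_pos; [now apply pow_le|left; apply exp_pos]).
  apply Rle_trans with (INR k ^ k * exp x * exp (- (x * x))).
  - apply Rmult_le_compat_r; [left; apply exp_pos|now apply pow_le_exp].
  - rewrite !Rmult_assoc. apply Rmult_le_compat_l; [apply pow_le, pos_INR|].
    rewrite <- !exp_plus. apply exp_le_mono. pose proof (Rle_0_sqr (x - 1)) as S; unfold Rsqr in S. lra.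
Qed.

Lemma decays_lin a b F G : decays F -> decays G -> decays (fun x => a * F x + b * G x).
Proof.
  intros [C [HC H]] [C' [HC' H']]. exists (Rabs a * C + Rabs b * C').
  pose proof (Rabs_pos a); pose proof (Rabs_pos b).
  split; [apply Rplus_le_le_0_compat; now apply Rmult_le_pos|]. intros x Hx.
  eapply Rle_trans; [apply Rabs_triang|]. rewrite !Rabs_mult. specialize (H x Hx); specialize (H' x Hx).
  rewrite Rmult_plus_distr_r, !Rmult_assoc.
  apply Rplus_le_compat; apply Rmult_le_compat_l; assumption.
Qed.

Lemma smooth_decay_lin a b j : forall F G, smooth_decay j F -> smooth_decay j G -> smooth_decay j (fun x => a * F x + b * G x).
Proof.
  induction j as [|j IH]; intros F G HF HG.
  - destruct HF as [C [HC H]], HG as [C' [HC' H']]. exists (Rabs a * C + Rabs b * C').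
    pose proof (Rabs_pos a); pose proof (Rabs_pos b).
    split; [apply Rplus_le_le_0_compat; now apply Rmult_le_pos|]. intros x Hx.
    eapply Rle_trans; [apply Rabs_triang|]. rewrite !Rabs_mult. specialize (H x Hx); specialize (H' x Hx).
    unfold Rdiv in *. rewrite Rmult_plus_distr_r, !Rmult_assoc.
    apply Rplus_le_compat; apply Rmult_le_compat_l; assumption.
  - destruct HF as [F' [DF HF]], HG as [G' [DG HG]]. exists (fun x => a * F' x + b * G' x).
    split; [|now apply IH]. intros x.
    apply (is_derive_plus (fun x => a * F x) (fun x => b * G x)); [apply (is_derive_scal F)|apply (is_derive_scal G)]; auto.
Qed.

Lemma smooth_decay_gaussmon j : forall k, smooth_decay j (gaussmon k).
Proof.
  induction j as [|j IH]; intros k.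
  - destruct (gaussmon_decay k) as [C [HC H]], (gaussmon_decay (2 + k)) as [C' [HC' H']].
    exists (C + C'). split; [lra|]. intros x Hx. specialize (H x Hx); specialize (H' x Hx).
    pose proof (one_add_sq_pos x) as P. apply (Rmult_le_reg_r (1 + x * x)); [assumption|].
    unfold Rdiv. rewrite Rmult_assoc, Rinv_l, Rmult_1_r by lra.
    assert (E : Rabs (gaussmon (2 + k) x) = Rabs (gaussmon k x) * (x * x)).
    { unfold gaussmon. replace (x ^ (2 + k) * exp (- (x * x))) with (x ^ k * exp (- (x * x)) * (x * x)) by (simpl; ring).
      rewrite Rabs_mult. f_equal. apply Rabs_pos_eq; nra. }
    pose proof (exp_neg_lt_1 1 Rlt_0_1).
    assert (exp (- x) <= 1) by (rewrite <- exp_0; apply exp_le_mono; lra).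
    pose proof (exp_pos (- x)). nra.
  - exists (fun x => INR k * gaussmon (pred k) x + - 2 * gaussmon (S k) x). split; [|apply smooth_decay_lin; apply IH].
    intros x. unfold gaussmon. auto_derive; [trivial|]. simpl pow. ring.
Qed.

Lemma lim_unif_continuous (fn : nat -> R -> R) (g : R -> R) (T : R) :
  (forall n x, continuous (fn n) x) ->
  (forall eps, 0 < eps -> exists N, forall n, (N <= n)%nat -> forall x, Rabs x < T -> Rabs (fn n x - g x) <= eps) ->
  forall x, Rabs x < T -> continuous g x.
Proof.
  intros Hc Hu x Hx. assert (HT : 0 < T) by (pose proof (Rabs_pos x); lra).
  apply continuity_pt_filterlim. apply (CVU_continuity fn g 0 (mkposreal T HT)).
  - intros eps He. destruct (Hu (eps / 2) ltac:(lra)) as [N HN]. exists N. intros n y Hn Hy.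
    unfold Boule in Hy; simpl in Hy. rewrite Rminus_0_r in Hy.
    rewrite Rabs_minus_sym. specialize (HN n Hn y Hy). lra.
  - intros n y _. apply continuity_pt_filterlim, Hc.
  - unfold Boule; simpl. rewrite Rminus_0_r. assumption.
Qed.

Lemma lim_derive (fn fn' : nat -> R -> R) (f g : R -> R) (T : R) :
  (forall n x, is_derive (fn n) x (fn' n x)) -> (forall n x, continuous (fn' n) x) ->
  (forall x, Rabs x < T -> is_lim_seq (fun n => fn n x) (f x)) ->
  (forall eps, 0 < eps -> exists N, forall n, (N <= n)%nat -> forall x, Rabs x < T -> Rabs (fn' n x - g x) <= eps) ->
  forall x, Rabs x < T -> is_derive f x (g x).
Proof.
  intros Hd Hc Hl Hu x Hx. assert (HT : 0 < T) by (pose proof (Rabs_pos x); lra).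
  apply is_derive_Reals. apply (derivable_pt_lim_CVU fn fn' f g x 0 (mkposreal T HT)).
  - unfold Boule; simpl. rewrite Rminus_0_r. assumption.
  - intros y n _. apply is_derive_Reals, Hd.
  - intros y Hy. unfold Boule in Hy; simpl in Hy. rewrite Rminus_0_r in Hy.
    apply is_lim_seq_Reals. now apply Hl.
  - intros eps He. destruct (Hu (eps / 2) ltac:(lra)) as [N HN]. exists N. intros n y Hn Hy.
    unfold Boule in Hy; simpl in Hy. rewrite Rminus_0_r in Hy.
    rewrite Rabs_minus_sym. specialize (HN n Hn y Hy). lra.
  - intros y Hy. unfold Boule in Hy; simpl in Hy. rewrite Rminus_0_r in Hy.
    apply continuity_pt_filterlim. now apply (lim_unif_continuous fn' g T).
Qed.

(* With [X = x^2]: [gauss_main] is [x (4X - 2) e^(-X)], i.e. [x] times the second derivative of [e^(-x^2)]; [gauss_dmain] gives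
   the derivative of its samples with respect to [ln X], and [gauss_corr] is the correction of order [1/n] to [gauss_main] in the
   Gaussian approximation of the binomial coefficients. *)
Definition gauss_main (x : R) : R := 4 * gaussmon 3 x + -2 * gaussmon 1 x.
Definition gauss_dmain (x : R) : R := 6 * gaussmon 3 x + -4 * gaussmon 5 x.
Definition gauss_corr (x : R) : R := 1 * (-2 / 3 * gaussmon 7 x + 13 / 3 * gaussmon 5 x) + -4 * gaussmon 3 x.

Definition exp_half (w : R) : R := exp (w / 2).
(** The function a of the overview. Below, [dfluct] is its derivative, [dfluct_euler] the Euler sums
    of that derivative, and [fluct_corr] the alternating sum of the 1/n correction. *)
Definition fluct (w : R) : R := altsum (samp gauss_main (exp_half w)).
Definition dfluct (w : R) : R := altsum (samp gauss_dmain (exp_half w)).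
Definition dfluct_euler (N : nat) (w : R) : R := euler_sum N (samp gauss_dmain (exp_half w)).
Definition fluct_corr (w : R) : R := altsum (samp gauss_corr (exp_half w)).

Lemma exp_half_pos w : 0 < exp_half w. Proof. apply exp_pos. Qed.
Lemma exp_half_sq w : exp_half w * exp_half w = exp w.
Proof. unfold exp_half. rewrite <- exp_plus. f_equal. field. Qed.
Lemma exp_half_le_1 w : w <= 0 -> exp_half w <= 1.
Proof. intros H. unfold exp_half. rewrite <- exp_0. apply exp_le_mono. lra. Qed.
Lemma exp_half_ge_1 w : 0 <= w -> 1 <= exp_half w.
Proof. intros H. unfold exp_half. rewrite <- exp_0. apply exp_le_mono. lra. Qed.

Lemma exp_neg_exp_half w : exp (- exp_half w) <= 4 * exp (- w).
Proof.
  pose proof (pow_le_exp 2 (exp_half w) (Rlt_le _ _ (exp_half_pos w))) as H. simpl in H.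
  rewrite !Rmult_1_r, exp_half_sq in H.
  rewrite !exp_Ropp. pose proof (exp_pos w). pose proof (exp_pos (exp_half w)).
  apply (Rmult_le_reg_r (exp w * exp (exp_half w))); [nra|].
  replace (/ exp (exp_half w) * (exp w * exp (exp_half w))) with (exp w) by (field; lra).
  replace (4 * / exp w * (exp w * exp (exp_half w))) with (4 * exp (exp_half w)) by (field; lra). lra.
Qed.

Lemma gauss_main_decays : decays gauss_main. Proof. apply decays_lin; apply gaussmon_decay. Qed.
Lemma gauss_dmain_decays : decays gauss_dmain. Proof. apply decays_lin; apply gaussmon_decay. Qed.
Lemma gauss_corr_decays : decays gauss_corr.
Proof. apply (decays_lin 1 (-4) (fun x => -2 / 3 * gaussmon 7 x + 13 / 3 * gaussmon 5 x)); [apply decays_lin|]; apply gaussmon_decay. Qed.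
Lemma gauss_main_smooth_decay : smooth_decay 4 gauss_main. Proof. apply smooth_decay_lin; apply smooth_decay_gaussmon. Qed.
Lemma gauss_dmain_smooth_decay : smooth_decay 4 gauss_dmain. Proof. apply smooth_decay_lin; apply smooth_decay_gaussmon. Qed.
Lemma gauss_corr_smooth_decay : smooth_decay 4 gauss_corr.
Proof. apply (smooth_decay_lin 1 (-4) 4 (fun x => -2 / 3 * gaussmon 7 x + 13 / 3 * gaussmon 5 x)); [apply smooth_decay_lin|]; apply smooth_decay_gaussmon. Qed.

Lemma gaussmon_le k j x : 0 <= x -> Rabs (gaussmon (k + j) x) <= INR j ^ j * 3 * x ^ k.
Proof.
  intros Hx. unfold gaussmon. rewrite Rabs_pos_eq by (apply Rmult_le_pos; [now apply pow_le|left; apply exp_pos]).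
  rewrite pow_add.
  assert (H : x ^ j * exp (- (x * x)) <= INR j ^ j * 3).
  { apply Rle_trans with (INR j ^ j * exp x * exp (- (x * x))).
    - apply Rmult_le_compat_r; [left; apply exp_pos|now apply pow_le_exp].
    - rewrite Rmult_assoc. apply Rmult_le_compat_l; [apply pow_le, pos_INR|].
      rewrite <- exp_plus. apply Rle_trans with (exp 1); [|apply exp_le_3].
      apply exp_le_mono. pose proof (Rle_0_sqr (x - 1)) as S; unfold Rsqr in S. nra. }
  pose proof (pow_le x k Hx). nra.
Qed.

Lemma gauss_dmain_cubic : exists C, 0 <= C /\ forall x, 0 <= x -> Rabs (gauss_dmain x) <= C * x ^ 3.
Proof.
  exists (6 * (INR 0 ^ 0 * 3) + 4 * (INR 2 ^ 2 * 3)). split; [simpl; lra|]. intros x Hx.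
  pose proof (gaussmon_le 3 0 x Hx) as H1. pose proof (gaussmon_le 3 2 x Hx) as H2. unfold gauss_dmain.
  eapply Rle_trans; [apply Rabs_triang|]. rewrite !Rabs_mult.
  rewrite (Rabs_pos_eq 6), (Rabs_left (-4)) by lra. simpl Nat.add in *. lra.
Qed.

Lemma gauss_corr_linear : exists C, 0 <= C /\ forall x, 0 <= x -> Rabs (gauss_corr x) <= C * x ^ 1.
Proof.
  exists (2 / 3 * (INR 6 ^ 6 * 3) + 13 / 3 * (INR 4 ^ 4 * 3) + 4 * (INR 2 ^ 2 * 3)). split; [simpl; lra|]. intros x Hx.
  pose proof (gaussmon_le 1 6 x Hx) as H1. pose proof (gaussmon_le 1 4 x Hx) as H2. pose proof (gaussmon_le 1 2 x Hx) as H3.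
  unfold gauss_corr. simpl Nat.add in *.
  apply Rabs_le_between in H1, H2, H3. apply Rabs_le. lra.
Qed.

Lemma gauss_main_linear : exists C, 0 <= C /\ forall x, 0 <= x -> Rabs (gauss_main x + 2 * x) <= C * x ^ 3.
Proof.
  exists (4 * (INR 0 ^ 0 * 3) + 2). split; [simpl; lra|]. intros x Hx.
  pose proof (gaussmon_le 3 0 x Hx) as H1. simpl Nat.add in H1.
  assert (H2 : Rabs (2 * x * (1 - exp (- (x * x)))) <= 2 * x ^ 3).
  { pose proof (exp_ineq1_le (- (x * x))). pose proof (exp_pos (- (x * x))).
    assert (exp (- (x * x)) <= 1) by (rewrite <- exp_0; apply exp_le_mono; nra).
    rewrite Rabs_pos_eq by (apply Rmult_le_pos; lra).
    replace (2 * x ^ 3) with (2 * x * (x * x)) by ring. apply Rmult_le_compat_l; lra. }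
  replace (gauss_main x + 2 * x) with (4 * gaussmon 3 x + 2 * x * (1 - exp (- (x * x)))) by (unfold gauss_main, gaussmon; ring).
  eapply Rle_trans; [apply Rabs_triang|]. rewrite (Rabs_mult 4), (Rabs_pos_eq 4) by lra. lra.
Qed.

(** For w >= 0 the samples decay geometrically. For w < 0 the four-term Euler sum is O(y^2) because
    [gauss_dmain] vanishes to third order, and all other Euler sums and the series differ from it by
    O(y^2) = O(e^w). The bound common to all Euler sums is the majorant for Hasse's series. *)
Lemma dfluct_bound : exists K, 0 <= K /\ (forall w, Rabs (dfluct w) <= K * exp (- Rabs w)) /\
  forall N w, (3 <= N)%nat -> Rabs (dfluct_euler N w) <= K * exp (- Rabs w).
Proof.
  destruct (samp_euler_smooth gauss_dmain gauss_dmain_decays gauss_dmain_smooth_decay) as [C1 [HC1 H1]].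
  destruct (samp_large gauss_dmain gauss_dmain_decays) as [C2 [HC2 H2]].
  destruct gauss_dmain_cubic as [C3 [HC3 H3]].
  exists (2 * C3 * 4 ^ 3 + 2 * C1 + 4 * C2).
  assert (H0 : 0 <= 2 * C3 * 4 ^ 3) by lra.
  split; [lra|].
  assert (G : forall w, Rabs (dfluct w) <= (2 * C3 * 4 ^ 3 + 2 * C1 + 4 * C2) * exp (- Rabs w) /\
     forall N, (3 <= N)%nat -> Rabs (dfluct_euler N w) <= (2 * C3 * 4 ^ 3 + 2 * C1 + 4 * C2) * exp (- Rabs w)).
  { intros w. pose proof (exp_pos (- Rabs w)) as P. destruct (Rle_dec 0 w) as [L|L].
    - destruct (H2 (exp_half w) (exp_half_ge_1 w L)) as [A B]. pose proof (exp_neg_exp_half w) as E.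
      rewrite (Rabs_pos_eq w L) in *.
      assert (C2 * exp (- exp_half w) <= 4 * C2 * exp (- w)) by nra.
      assert (0 <= (2 * C3 * 4 ^ 3 + 2 * C1) * exp (- w)) by (apply Rmult_le_pos; lra).
      split; [unfold dfluct; lra|]. intros N _. unfold dfluct_euler. specialize (B N). lra.
    - rewrite (Rabs_left w) in * by lra. rewrite Ropp_involutive in *.
      pose proof (exp_half_pos w) as Y. rewrite <- exp_half_sq in *.
      pose proof (samp_euler_3 gauss_dmain C3 2 (exp_half w) Y HC3 H3) as E3.
      pose proof (H1 (exp_half w) 3%nat Y (le_n 3)) as E1. fold (dfluct w) in E1.
      replace (exp_half w ^ 2) with (exp_half w * exp_half w) in E3 by ring.
      set (q := exp_half w * exp_half w) in *. set (e3 := euler_sum 3 _) in *.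
      assert (Hq : 0 <= q) by (unfold q; apply Rmult_le_pos; lra).
      assert (0 <= C2 * q) by (now apply Rmult_le_pos). assert (0 <= C1 * q) by (now apply Rmult_le_pos).
      apply Rabs_le_between in E3, E1.
      split; [apply Rabs_le; lra|]. intros N HN.
      pose proof (H1 (exp_half w) N Y HN) as EN. fold (dfluct w) in EN. fold (dfluct_euler N w) in EN. fold q in EN.
      apply Rabs_le_between in EN. apply Rabs_le. lra. }
  split; [intros; apply G|]. intros N w HN. now apply G.
Qed.

(** Boundedness rests on the signs: the sum of absolute values would grow like 1/y^2 as y tends to
    0. With it, the first correction contributes only O(1/n) per level. *)
Lemma fluct_corr_bound : exists K, 0 <= K /\ forall w, Rabs (fluct_corr w) <= K.
Proof.
  destruct (samp_euler_smooth gauss_corr gauss_corr_decays gauss_corr_smooth_decay) as [C1 [HC1 H1]].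
  destruct (samp_large gauss_corr gauss_corr_decays) as [C2 [HC2 H2]].
  destruct gauss_corr_linear as [C3 [HC3 H3]].
  exists (2 * C3 * 4 ^ 1 + C1 + C2). split; [lra|]. intros w.
  destruct (Rle_dec 0 w) as [L|L].
  - destruct (H2 (exp_half w) (exp_half_ge_1 w L)) as [A _]. fold (fluct_corr w) in A.
    pose proof (exp_neg_lt_1 (exp_half w) (exp_half_pos w)). nra.
  - pose proof (exp_half_pos w) as Y. pose proof (exp_half_le_1 w ltac:(lra)) as Y1.
    pose proof (samp_euler_3 gauss_corr C3 0 (exp_half w) Y HC3 H3) as E3.
    pose proof (H1 (exp_half w) 3%nat Y (le_n 3)) as E1. fold (fluct_corr w) in E1.
    set (e3 := euler_sum 3 _) in *. assert (Hyy : exp_half w * exp_half w <= 1) by nra. assert (C1 * (exp_half w * exp_half w) <= C1) by (rewrite <- (Rmult_1_r C1) at 2; now apply Rmult_le_compat_l).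
    apply Rabs_le_between in E3, E1. apply Rabs_le. simpl pow in *. lra.
Qed.

Lemma fluct_bound : exists K, 0 <= K /\ (forall w, w <= 0 -> Rabs (fluct w + / 2) <= K * exp w) /\
  forall w, 0 <= w -> Rabs (fluct w) <= K * exp (- w).
Proof.
  destruct (samp_euler_smooth gauss_main gauss_main_decays gauss_main_smooth_decay) as [C1 [HC1 H1]].
  destruct (samp_large gauss_main gauss_main_decays) as [C2 [HC2 H2]].
  destruct gauss_main_linear as [C3 [HC3 H3]].
  assert (H0 : 0 <= 2 * C3 * 4 ^ 3) by lra.
  exists (2 * C3 * 4 ^ 3 + C1 + 4 * C2). split; [lra|]. split; intros w L.
  - pose proof (exp_half_pos w) as Y. rewrite <- exp_half_sq in *.
    pose proof (samp_euler_3 (fun x => gauss_main x + 2 * x) C3 2 (exp_half w) Y HC3 H3) as E3.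
    (* The linear part -2x of [gauss_main] has the samples -2, -4, -6, ..., and the Euler value 1/4
       of 1 - 2 + 3 - ... produces the limit -1/2. *)
    assert (E : euler_sum 3 (samp (fun x => gauss_main x + 2 * x) (exp_half w)) = euler_sum 3 (samp gauss_main (exp_half w)) + / 2).
    { rewrite !euler_sum_3. unfold samp. simpl INR. field. lra. }
    rewrite E in E3.
    pose proof (H1 (exp_half w) 3%nat Y (le_n 3)) as E1. fold (fluct w) in E1.
    replace (exp_half w ^ 2) with (exp_half w * exp_half w) in E3 by ring.
    set (q := exp_half w * exp_half w) in *. set (e3 := euler_sum 3 _) in *.
    assert (0 <= q) by (unfold q; apply Rmult_le_pos; lra). assert (0 <= C2 * q) by (now apply Rmult_le_pos).
    apply Rabs_le_between in E3, E1. apply Rabs_le. lra.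
  - destruct (H2 (exp_half w) (exp_half_ge_1 w L)) as [A _]. fold (fluct w) in A. pose proof (exp_neg_exp_half w) as E.
    pose proof (exp_pos (- w)).
    assert (C2 * exp (- exp_half w) <= 4 * C2 * exp (- w)) by nra.
    assert (0 <= (2 * C3 * 4 ^ 3 + C1) * exp (- w)) by (apply Rmult_le_pos; lra). lra.
Qed.

Lemma samp_geo_local F T : decays F -> exists G rho, 0 <= rho < 1 /\ forall w, Rabs w <= T -> geo G rho (samp F (exp_half w)).
Proof.
  intros [C [HC H]]. exists (C * / exp_half (- T)), (exp (- exp_half (- T))).
  split; [apply exp_neg_lt_1, exp_half_pos|]. intros w Hw m.
  assert (Hy : exp_half (- T) <= exp_half w) by (unfold exp_half; apply exp_le_mono; apply Rabs_le_between in Hw; lra).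
  pose proof (exp_half_pos (- T)) as P.
  eapply Rle_trans; [apply (samp_geo C F (exp_half (- T)) (exp_half w) H HC); lra|].
  apply Rmult_le_compat_r; [apply pow_le; left; apply exp_pos|].
  unfold Rdiv. apply Rmult_le_compat.
  - apply Rmult_le_pos; [assumption|left; apply exp_pos].
  - left; apply Rinv_0_lt_compat; lra.
  - pose proof (exp_neg_lt_1 (exp_half w) (exp_half_pos w)). nra.
  - apply Rinv_le_contravar; lra.
Qed.

Lemma pow_small rho c eps : 0 <= rho < 1 -> 0 <= c -> 0 < eps -> exists N, forall n, (N <= n)%nat -> rho ^ n * c <= eps.
Proof.
  intros Hr Hc He. destruct (pow_lt_1_zero rho ltac:(rewrite Rabs_pos_eq; lra) (eps / (c + 1))) as [N HN].
  { apply Rdiv_lt_0_compat; lra. }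
  exists N. intros n Hn. specialize (HN n Hn). rewrite Rabs_pos_eq in HN by (apply pow_le; lra).
  apply Rle_trans with (eps / (c + 1) * c); [apply Rmult_le_compat_r; lra|].
  apply (Rmult_le_reg_r (c + 1)); [lra|]. field_simplify; [nra|lra].
Qed.

Lemma altsum_partial G rho f n : 0 <= rho < 1 -> geo G rho f ->
  Rabs (sum_f_R0 (fun m => (-1) ^ m * f m) n - altsum f) <= rho ^ n * (G / (1 - rho)).
Proof.
  intros Hr H. pose proof (geo_is_series _ _ _ Hr H) as Hs. pose proof (geo_nonneg _ _ _ H) as HG.
  assert (E : altsum f = sum_f_R0 (fun m => (-1) ^ m * f m) n + (-1) ^ S n * altsum (fun m => f (S n + m)%nat)).
  { unfold altsum. rewrite (Series_incr_n _ (S n)) by (lia || (eexists; apply Hs)). simpl pred. f_equal.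
    rewrite <- Series_scal_l. apply Series_ext. intros k. rewrite pow_add. ring. }
  rewrite E. replace (sum_f_R0 (fun m => (-1) ^ m * f m) n - (sum_f_R0 (fun m => (-1) ^ m * f m) n + (-1) ^ S n * altsum (fun m => f (S n + m)%nat)))
    with (- ((-1) ^ S n * altsum (fun m => f (S n + m)%nat))) by ring.
  rewrite Rabs_Ropp, Rabs_mult, pow_m1_abs, Rmult_1_l.
  eapply Rle_trans; [apply (altsum_bound (G * rho ^ S n) rho); [assumption|]|].
  - intros m. eapply Rle_trans; [apply H|]. rewrite pow_add. right; ring.
  - simpl. unfold Rdiv. assert (0 < / (1 - rho)) by (apply Rinv_0_lt_compat; lra).
    pose proof (pow_le rho n ltac:(lra)).
    replace (G * (rho * rho ^ n) * / (1 - rho)) with (rho * (rho ^ n * (G * / (1 - rho)))) by ring.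
    rewrite <- (Rmult_1_l (rho ^ n * (G * / (1 - rho)))) at 2. apply Rmult_le_compat_r; [|lra].
    apply Rmult_le_pos; [assumption|]. apply Rmult_le_pos; lra.
Qed.

Lemma samp_partial_unif F T : decays F -> forall eps, 0 < eps -> exists N, forall n, (N <= n)%nat ->
  forall w, Rabs w <= T -> Rabs (sum_f_R0 (fun m => (-1) ^ m * samp F (exp_half w) m) n - altsum (samp F (exp_half w))) <= eps.
Proof.
  intros HF eps He. destruct (samp_geo_local F T HF) as [G [rho [Hr H]]].
  destruct (Rle_dec 0 T) as [HT|HT].
  - assert (HG : 0 <= G) by (apply (geo_nonneg _ rho _ (H 0 ltac:(rewrite Rabs_R0; assumption)))).
    destruct (pow_small rho (G / (1 - rho)) eps Hr) as [N HN]; [apply Rmult_le_pos; [assumption|left; apply Rinv_0_lt_compat; lra]|assumption|].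
    exists N. intros n Hn w Hw. eapply Rle_trans; [apply (altsum_partial G rho); auto|]. now apply HN.
  - exists 0%nat. intros n _ w Hw. pose proof (Rabs_pos w). lra.
Qed.

Lemma dfluct_euler_unif T : forall eps, 0 < eps -> exists N, forall n, (N <= n)%nat ->
  forall w, Rabs w <= T -> Rabs (dfluct_euler n w - dfluct w) <= eps.
Proof.
  intros eps He. destruct (samp_geo_local gauss_dmain T gauss_dmain_decays) as [G [rho [Hr H]]].
  destruct (Rle_dec 0 T) as [HT|HT].
  - assert (HG : 0 <= G) by (apply (geo_nonneg _ rho _ (H 0 ltac:(rewrite Rabs_R0; assumption)))).
    destruct (pow_small ((1 + rho) / 2) (G / (1 - rho)) eps) as [N HN]; [lra|apply Rmult_le_pos; [assumption|left; apply Rinv_0_lt_compat; lra]|assumption|].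
    exists N. intros n Hn w Hw. rewrite Rabs_minus_sym.
    eapply Rle_trans; [apply (euler_geo_bound n G rho); auto|]. apply HN; lia.
  - exists 0%nat. intros n _ w Hw. pose proof (Rabs_pos w). lra.
Qed.

Lemma samp_gauss_main_derive m w : is_derive (fun w => samp gauss_main (exp_half w) m) w (samp gauss_dmain (exp_half w) m).
Proof.
  unfold samp, gauss_main, gauss_dmain, gaussmon, exp_half. generalize (INR (S m)) as c. intros c.
  pose proof (exp_pos (w / 2)). auto_derive; [lra|]. unfold Rdiv.
  simpl pow. field. lra.
Qed.

Lemma samp_gauss_dmain_derive m w : ex_derive (fun w => samp gauss_dmain (exp_half w) m) w.
Proof.
  unfold samp, gauss_dmain, gaussmon, exp_half. generalize (INR (S m)) as c. intros c.
  pose proof (exp_pos (w / 2)). auto_derive. lra.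
Qed.

Lemma sum_derive (f df : nat -> R -> R) n x : (forall m, is_derive (f m) x (df m x)) ->
  is_derive (fun x => sum_f_R0 (fun m => f m x) n) x (sum_f_R0 (fun m => df m x) n).
Proof.
  intros H; induction n as [|n IH]; simpl; [apply H|].
  apply (is_derive_plus (fun x => sum_f_R0 (fun m => f m x) n) (f (S n))); [apply IH|apply H].
Qed.

Lemma sum_continuous (f : nat -> R -> R) n x : (forall m, continuous (f m) x) ->
  continuous (fun x => sum_f_R0 (fun m => f m x) n) x.
Proof.
  intros H; induction n as [|n IH]; simpl; [apply H|].
  apply (continuous_plus (fun x => sum_f_R0 (fun m => f m x) n) (f (S n))); [apply IH|apply H].
Qed.

Lemma samp_gauss_dmain_continuous m w : continuous (fun w => samp gauss_dmain (exp_half w) m) w.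
Proof. apply (ex_derive_continuous (fun w => samp gauss_dmain (exp_half w) m)), samp_gauss_dmain_derive. Qed.

Lemma dfluct_partial_continuous n w : continuous (fun w => sum_f_R0 (fun m => (-1) ^ m * samp gauss_dmain (exp_half w) m) n) w.
Proof.
  apply (sum_continuous (fun m w => (-1) ^ m * samp gauss_dmain (exp_half w) m)). intros m.
  apply (continuous_scal_r ((-1) ^ m) (fun w => samp gauss_dmain (exp_half w) m)), samp_gauss_dmain_continuous.
Qed.

Lemma fluct_derive w : is_derive fluct w (dfluct w).
Proof.
  apply (lim_derive (fun n w => sum_f_R0 (fun m => (-1) ^ m * samp gauss_main (exp_half w) m) n)
    (fun n w => sum_f_R0 (fun m => (-1) ^ m * samp gauss_dmain (exp_half w) m) n) fluct dfluct (Rabs w + 1)); [| | | |lra].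
  - intros n x. apply (sum_derive (fun m w => (-1) ^ m * samp gauss_main (exp_half w) m) (fun m w => (-1) ^ m * samp gauss_dmain (exp_half w) m)). intros m.
    apply (is_derive_scal (fun w => samp gauss_main (exp_half w) m)), samp_gauss_main_derive.
  - apply dfluct_partial_continuous.
  - intros x Hx. apply is_lim_seq_eps. intros eps He.
    destruct (samp_partial_unif gauss_main (Rabs w + 1) gauss_main_decays eps He) as [N HN].
    exists N. intros n Hn. apply HN; [assumption|lra].
  - intros eps He. destruct (samp_partial_unif gauss_dmain (Rabs w + 1) gauss_dmain_decays eps He) as [N HN].
    exists N. intros n Hn x Hx. apply HN; [assumption|lra].
Qed.

Lemma dfluct_continuous w : continuous dfluct w.
Proof.
  apply (lim_unif_continuous (fun n w => sum_f_R0 (fun m => (-1) ^ m * samp gauss_dmain (exp_half w) m) n) dfluct (Rabs w + 1)); [|  |lra].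
  - apply dfluct_partial_continuous.
  - intros eps He. destruct (samp_partial_unif gauss_dmain (Rabs w + 1) gauss_dmain_decays eps He) as [N HN].
    exists N. intros n Hn x Hx. apply HN; [assumption|lra].
Qed.

Lemma fluct_continuous w : continuous fluct w.
Proof. apply (cont_of_derive fluct dfluct fluct_derive). Qed.

(** * Hasse's series and the Mellin transform of the fluctuation *)

(** With X = e^v this is X d/dX ((4X-2) e^(-X)). Every sample of [gauss_dmain] is a multiple m+1 of
    a translate of this bump by 2 ln(m+1), so one transform serves for all samples. *)
Definition dbump (v : R) : R := 6 * gammaden 1 v + -4 * gammaden 2 v.

Lemma dbump_dom1 : exists K, dom1 K dbump.
Proof.
  destruct (gammaden_dom1 1 ltac:(lia)) as [K1 H1]. destruct (gammaden_dom1 2 ltac:(lia)) as [K2 H2].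
  eexists. apply dom1_plus; apply dom1_scal; eassumption.
Qed.

Lemma samp_gauss_dmain_dbump w m : samp gauss_dmain (exp_half w) m = INR (S m) * dbump (w + 2 * ln (INR (S m))).
Proof.
  assert (Hc : 0 < INR (S m)) by (apply lt_0_INR; lia).
  unfold samp, gauss_dmain, dbump, gaussmon. set (c := INR (S m)) in *.
  assert (HE : exp (w + 2 * ln c) = c * c * (exp_half w * exp_half w)).
  { rewrite exp_plus, exp_half_sq. replace (2 * ln c) with (ln c + ln c) by ring. rewrite exp_plus, exp_ln by assumption. ring. }
  rewrite (gammaden_S 1). unfold gammaden. simpl (INR 1). rewrite Rmult_1_l. unfold Rminus. rewrite exp_plus, HE.
  replace (c * exp_half w * (c * exp_half w)) with (c * c * (exp_half w * exp_half w)) by ring.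
  pose proof (exp_half_pos w). field. lra.
Qed.

Lemma fdiffs_binom n f m : fdiffs n f m =
  sum_f_R0 (fun k => (-1) ^ k * INR (binomial.binomial n k) * f (m + k)%nat) n.
Proof.
  revert m; induction n as [|n IH]; intros m.
  - cbn [fdiffs sum_f_R0]. rewrite Nat.add_0_r, binom_0_r. simpl; ring.
  - rewrite fdiffs_S_r, !IH. rewrite (decomp_sum _ (S n)) by lia. simpl pred.
    rewrite binom_0_r.
    rewrite (sum_eq (fun i => (-1) ^ S i * INR (binomial.binomial (S n) (S i)) * f (m + S i)%nat)
      (fun i => (-1) ^ S i * INR (binomial.binomial n (S i)) * f (m + S i)%nat
        - (-1) ^ i * INR (binomial.binomial n i) * f (S m + i)%nat)).
    + rewrite minus_sum.
      assert (E : sum_f_R0 (fun k => (-1) ^ k * INR (binomial.binomial n k) * f (m + k)%nat) (S n) =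
         sum_f_R0 (fun k => (-1) ^ k * INR (binomial.binomial n k) * f (m + k)%nat) n).
      { rewrite tech5, binom_small by lia. simpl (INR 0). ring. }
      rewrite <- E, (decomp_sum _ (S n)) by lia. simpl pred. rewrite binom_0_r. simpl pow. ring.
    + intros i _. rewrite binom_pascal, plus_INR. replace (S m + i)%nat with (m + S i)%nat by lia. simpl pow. ring.
Qed.

Lemma dom1_sum (g : nat -> R -> R) n : (forall k, exists K, dom1 K (g k)) ->
  exists K, dom1 K (fun w => sum_f_R0 (fun k => g k w) n).
Proof.
  intros H; induction n as [|n [K IH]]; simpl; [apply H|].
  destruct (H (S n)) as [K' H']. exists (K + K'). now apply (dom1_plus K K' (fun w => sum_f_R0 (fun k => g k w) n)).
Qed.

Lemma laplace_sum (g : nat -> R -> R) n z : Rabs (Re z) <= / 4 -> (forall k, exists K, dom1 K (g k)) ->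
  laplace (fun w => sum_f_R0 (fun k => g k w) n) z = Csum (fun k => laplace (g k) z) n.
Proof.
  intros Hz H; induction n as [|n IH]; simpl; [reflexivity|].
  destruct (dom1_sum g n H) as [K1 H1]. destruct (H (S n)) as [K2 H2].
  rewrite (laplace_plus K1 K2 (fun w => sum_f_R0 (fun k => g k w) n)) by assumption. now rewrite IH.
Qed.

Lemma Csum_ext f g n : (forall k, f k = g k) -> Csum f n = Csum g n.
Proof. intros H; induction n as [|n IH]; simpl; [apply H|]. now rewrite IH, H. Qed.

Lemma Csum_mult_r f c n : Csum (fun k => Cmult (f k) c) n = Cmult (Csum f n) c.
Proof. induction n as [|n IH]; simpl; [reflexivity|]. rewrite IH. ring. Qed.

Definition hasse (s : C) (N : nat) : C :=
  Csum (fun n => Cmult (RtoC (/ 2 ^ (S n))) (Csum (fun k =>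
    Cmult (RtoC ((-1) ^ k * INR (binomial.binomial n k))) (Defs.Cpow (INR (S k)) (- s)%C)) n)) N.

Lemma zeta_hasse s : zeta s = Cmult (/ (RtoC 1 - Defs.Cpow 2 (RtoC 1 - s)))%C (Clim (hasse s)).
Proof. reflexivity. Qed.

Lemma dfluct_euler_expand N w : dfluct_euler N w = sum_f_R0 (fun n => / 2 ^ S n * sum_f_R0 (fun k =>
   (-1) ^ k * INR (binomial.binomial n k) * (INR (S k) * dbump (w + 2 * ln (INR (S k))))) n) N.
Proof.
  unfold dfluct_euler, euler_sum. apply sum_eq. intros n _. f_equal. rewrite fdiffs_binom. apply sum_eq. intros k _.
  now rewrite samp_gauss_dmain_dbump.
Qed.

Lemma dfluct_euler_dom1 N : exists K, dom1 K (dfluct_euler N).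
Proof.
  destruct dbump_dom1 as [KB HB].
  replace (dfluct_euler N) with (fun w => sum_f_R0 (fun n => / 2 ^ S n * sum_f_R0 (fun k =>
   (-1) ^ k * INR (binomial.binomial n k) * (INR (S k) * dbump (w + 2 * ln (INR (S k))))) n) N)
   by (apply functional_extensionality; intros; symmetry; apply dfluct_euler_expand).
  apply (dom1_sum (fun n w => / 2 ^ S n * sum_f_R0 (fun k =>
   (-1) ^ k * INR (binomial.binomial n k) * (INR (S k) * dbump (w + 2 * ln (INR (S k))))) n)). intros n.
  destruct (dom1_sum (fun k w => (-1) ^ k * INR (binomial.binomial n k) * (INR (S k) * dbump (w + 2 * ln (INR (S k))))) n) as [K H].
  - intros k. eexists. eapply (dom1_scal ((-1) ^ k * INR (binomial.binomial n k)) _ (fun w => INR (S k) * dbump (w + 2 * ln (INR (S k))))).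
    eapply (dom1_scal (INR (S k)) _ (fun w => dbump (w + 2 * ln (INR (S k))))), dom1_shift, HB.
  - eexists. now apply (dom1_scal (/ 2 ^ S n)) in H; apply H.
Qed.

(** The translation by 2 ln j and the factor j give j^(1-2z) = j^(-s) with s = 2z-1: the transform
    of the N-th Euler sum is the N-th partial sum of Hasse's series times the transform of the
    single bump. *)
Lemma laplace_dfluct_euler N z : Rabs (Re z) <= / 4 ->
  laplace (dfluct_euler N) z = Cmult (hasse (RtoC 2 * z - RtoC 1)%C N) (laplace dbump z).
Proof.
  intros Hz. destruct dbump_dom1 as [KB HB].
  replace (dfluct_euler N) with (fun w => sum_f_R0 (fun n => / 2 ^ S n * sum_f_R0 (fun k =>
   (-1) ^ k * INR (binomial.binomial n k) * (INR (S k) * dbump (w + 2 * ln (INR (S k))))) n) N)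
   by (apply functional_extensionality; intros; symmetry; apply dfluct_euler_expand).
  assert (Dk : forall n k, exists K, dom1 K (fun w => (-1) ^ k * INR (binomial.binomial n k) * (INR (S k) * dbump (w + 2 * ln (INR (S k)))))).
  { intros n k. eexists. eapply (dom1_scal ((-1) ^ k * INR (binomial.binomial n k)) _ (fun w => INR (S k) * dbump (w + 2 * ln (INR (S k))))).
    eapply (dom1_scal (INR (S k)) _ (fun w => dbump (w + 2 * ln (INR (S k))))), dom1_shift, HB. }
  rewrite (laplace_sum (fun n w => / 2 ^ S n * sum_f_R0 (fun k =>
   (-1) ^ k * INR (binomial.binomial n k) * (INR (S k) * dbump (w + 2 * ln (INR (S k))))) n) N z Hz).
  2: { intros n. destruct (dom1_sum _ n (Dk n)) as [K H]. eexists. now apply (dom1_scal (/ 2 ^ S n)) in H; apply H. }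
  unfold hasse. rewrite <- Csum_mult_r. apply Csum_ext. intros n.
  destruct (dom1_sum _ n (Dk n)) as [K H].
  rewrite (laplace_scal (/ 2 ^ S n) K _ z Hz H), (laplace_sum _ n z Hz (Dk n)).
  rewrite <- Cmult_assoc, <- Csum_mult_r. f_equal. apply Csum_ext. intros k.
  pose proof (dom1_shift _ _ (2 * ln (INR (S k))) HB) as HS.
  pose proof (dom1_scal (INR (S k)) _ _ HS) as HS2.
  rewrite (laplace_scal _ _ _ z Hz HS2), (laplace_scal _ _ _ z Hz HS), (laplace_shift _ _ _ z Hz HB).
  rewrite <- Cmult_assoc. f_equal.
  unfold Defs.Cpow.
  replace (- (RtoC 2 * z - RtoC 1) * RtoC (ln (INR (S k))))%C with
    (RtoC (ln (INR (S k))) + - z * RtoC (2 * ln (INR (S k))))%C by (rewrite RtoC_mult; ring).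
  rewrite Cexp_plus.
  replace (Cexp (RtoC (ln (INR (S k))))) with (RtoC (INR (S k))); [ring|].
  unfold Cexp, RtoC, Re, Im; cbn [fst snd]. rewrite cos_0, sin_0, exp_ln by (apply lt_0_INR; lia).
  f_equal; ring.
Qed.

Lemma dom1_dfluct : exists K, dom1 K dfluct.
Proof. destruct dfluct_bound as [K [_ [H _]]]. exists K. split; [apply dfluct_continuous|apply H]. Qed.

(** Convergence is locally uniform by [dfluct_euler_unif]; the majorant of [dfluct_bound] holds for
    Euler sums from index 3 on, hence the shift. *)
Lemma laplace_dfluct_euler_conv z : Rabs (Re z) <= / 4 -> Cconv (fun N => laplace (dfluct_euler N) z) (laplace dfluct z).
Proof.
  intros Hz. destruct dfluct_bound as [K [HK [H1 H2]]].
  assert (D : dom1 K dfluct) by (split; [apply dfluct_continuous|apply H1]).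
  assert (DN : forall n, dom1 K (dfluct_euler (n + 3))).
  { intros n. destruct (dfluct_euler_dom1 (n + 3)) as [K' [Hc _]]. split; [apply Hc|]. intros; apply H2; lia. }
  destruct z as [s t]. simpl in Hz.
  assert (W : forall (k : R -> R), (forall w, Rabs (k w) <= exp (/ 4 * Rabs w)) -> forall T eps, 0 < eps ->
     exists N, forall n, (N <= n)%nat -> forall x, Rabs x <= T -> Rabs (dfluct_euler (n + 3) x * k x - dfluct x * k x) <= eps).
  { intros k Hk T eps He. pose proof (exp_pos (/ 4 * T)) as P.
    destruct (dfluct_euler_unif T (eps / exp (/ 4 * T)) ltac:(now apply Rdiv_lt_0_compat)) as [N HN].
    exists N. intros n Hn x Hx. rewrite <- Rmult_minus_distr_r, Rabs_mult.
    specialize (HN (n + 3)%nat ltac:(lia) x Hx).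
    assert (Rabs (k x) <= exp (/ 4 * T)) by (eapply Rle_trans; [apply Hk|apply exp_le_mono; lra]).
    apply Rle_trans with (eps / exp (/ 4 * T) * exp (/ 4 * T)); [|right; field; lra].
    apply Rmult_le_compat; (assumption || apply Rabs_pos). }
  apply Cconv_pair; apply (is_lim_seq_incr_n _ 3).
  - apply (RIntR_dominated K (fun n w => dfluct_euler (n + 3) w * wcos s t w)); [intros; now apply dom_wcos|now apply dom_wcos|].
    apply W. intros w. now apply wcos_bound.
  - apply (RIntR_dominated K (fun n w => dfluct_euler (n + 3) w * wsin s t w)); [intros; now apply dom_wsin|now apply dom_wsin|].
    apply W. intros w. now apply wsin_bound.
Qed.

Lemma hasse_laplace z : Rabs (Re z) <= / 4 -> Cmult (laplace dbump z) (Clim (hasse (RtoC 2 * z - RtoC 1)%C)) = laplace dfluct z.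
Proof.
  intros Hz. pose proof (laplace_dfluct_euler_conv z Hz) as H.
  apply (Cconv_ext _ (fun N => Cmult (laplace dbump z) (hasse (RtoC 2 * z - RtoC 1)%C N))) in H.
  2: { intros N. rewrite laplace_dfluct_euler by assumption. ring. }
  destruct (Ceq_dec (laplace dbump z) (RtoC 0)) as [E|E].
  (* At a zero of the transform of [dbump] nothing is known about the limit of Hasse's series; there
     both sides vanish. *)
  - rewrite E, Cmult_0_l. apply (Cconv_unique (fun N => Cmult (laplace dbump z) (hasse (RtoC 2 * z - RtoC 1)%C N))); [|assumption].
    rewrite E. intros eps He. exists 0%nat. intros n _. rewrite Cmult_0_l.
    replace (RtoC 0 - RtoC 0)%C with (RtoC 0) by ring. rewrite Cmod_0. lra.
  - assert (H' : Cconv (hasse (RtoC 2 * z - RtoC 1)%C) (Cmult (/ laplace dbump z)%C (laplace dfluct z))).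
    { eapply Cconv_ext; [|apply (Cconv_scal (/ laplace dbump z)%C _ _ H)]. intros n. cbv beta. set (h := hasse _ n). field. assumption. }
    rewrite (Clim_eq _ _ H'). field. assumption.
Qed.

Lemma laplace_dbump z : Rabs (Re z) <= / 4 -> laplace dbump z = Cmult (RtoC 2 - RtoC 4 * z)%C (laplace (gammaden 1) z).
Proof.
  intros Hz. destruct (gammaden_dom1 1 ltac:(lia)) as [K1 H1]. destruct (gammaden_dom1 2 ltac:(lia)) as [K2 H2].
  unfold dbump. rewrite (laplace_plus _ _ _ _ z Hz (dom1_scal 6 _ _ H1) (dom1_scal (-4) _ _ H2)).
  rewrite (laplace_scal _ _ _ z Hz H1), (laplace_scal _ _ _ z Hz H2), (laplace_gammaden_S 1 z) by (lia || assumption).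
  simpl (INR 1). replace (RtoC (-4)) with (- RtoC 4)%C by (unfold RtoC, Copp; simpl; f_equal; ring).
  replace (RtoC 6) with (RtoC 4 + RtoC 2)%C by (unfold RtoC, Cplus; simpl; f_equal; ring). ring.
Qed.

(** * Terms of [delta] as values of the transform *)

Lemma cos_2kPI k : cos (2 * PI * IZR k) = 1.
Proof.
  assert (H : forall n, cos (2 * PI * INR n) = 1).
  { intros n. replace (2 * PI * INR n) with (0 + 2 * INR n * PI) by ring. rewrite cos_period. apply cos_0. }
  destruct (Z_le_dec 0 k) as [L|L].
  - rewrite <- (Z2Nat.id k L), <- INR_IZR_INZ. apply H.
  - rewrite <- (cos_neg (2 * PI * IZR k)). replace (- (2 * PI * IZR k)) with (2 * PI * IZR (- k)) by (rewrite opp_IZR; ring).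
    rewrite <- (Z2Nat.id (- k)) by lia. rewrite <- INR_IZR_INZ. apply H.
Qed.

Lemma sin_2kPI k : sin (2 * PI * IZR k) = 0.
Proof.
  apply sin_eq_0_1. exists (2 * k)%Z. rewrite mult_IZR. ring.
Qed.

Definition half_chi (k : Z) : C := (0, PI * IZR k / ln 2).

Lemma ln2_pos : 0 < ln 2. Proof. rewrite <- ln_1. apply ln_increasing; lra. Qed.

Lemma half_chi_neq_0 k : k <> 0%Z -> half_chi k <> RtoC 0.
Proof.
  intros Hk E. apply (f_equal snd) in E. simpl in E. pose proof ln2_pos. pose proof PI_RGT_0.
  apply Rmult_integral in E. destruct E as [E|E]; [|revert E; apply Rinv_neq_0_compat; lra].
  apply Rmult_integral in E. destruct E as [E|E]; [lra|]. apply eq_IZR in E. contradiction.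
Qed.

(** Put z = chi_k/2. Then Gamma(z) = Gamma(1+z)/z; the prefactor of zeta at 2z-1 is 1/(1 -
    2^(2-chi_k)) = -1/3 since 2^(chi_k) = 1; and chi_k - 1 = -(2-4z)/2, where (2-4z) Gamma(1+z) is
    the transform of [dbump]. The product has the denominator 6z. *)
Lemma delta_term_eq x k : k <> 0%Z ->
  delta_term x k = Cmult (laplace dfluct (half_chi k) / (RtoC 6 * half_chi k))%C (Cexp (0, 2 * PI * IZR k * x)).
Proof.
  intros Hk. pose proof (half_chi_neq_0 k Hk) as Hz0. pose proof ln2_pos as L2.
  assert (Hz : Rabs (Re (half_chi k)) <= / 4) by (simpl; rewrite Rabs_R0; lra).
  assert (E1 : (chi k / RtoC 2)%C = half_chi k).
  { unfold chi, half_chi, Cdiv, Cinv, Cmult, RtoC; simpl. f_equal; field; lra. }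
  assert (E2 : (chi k - RtoC 1)%C = (RtoC 2 * half_chi k - RtoC 1)%C) by (rewrite <- E1; field; intros E; injection E; lra).
  unfold delta_term. rewrite E1, E2. f_equal.
  assert (Ht : PI * IZR k / ln 2 <> 0) by (intros E; apply Hz0; unfold half_chi; now rewrite E).
  change (Gamma (half_chi k)) with (Gamma (0, PI * IZR k / ln 2)). rewrite Gamma_imag by assumption.
  change (0, PI * IZR k / ln 2) with (half_chi k).
  rewrite zeta_hasse.
  assert (E3 : Defs.Cpow 2 (RtoC 1 - (RtoC 2 * half_chi k - RtoC 1))%C = RtoC 4).
  { unfold Defs.Cpow, Cexp, half_chi, RtoC; simpl.
    replace ((1 + - (2 * 0 - 0 * (PI * IZR k / ln 2) + - (1))) * ln 2 - (0 + - (2 * (PI * IZR k / ln 2) + 0 * 0 + - 0)) * 0) with (ln 2 + ln 2) by ring.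
    replace ((1 + - (2 * 0 - 0 * (PI * IZR k / ln 2) + - (1))) * 0 + (0 + - (2 * (PI * IZR k / ln 2) + 0 * 0 + - 0)) * ln 2)
      with (- (2 * PI * IZR k)) by (field; lra).
    rewrite cos_neg, sin_neg, cos_2kPI, sin_2kPI, exp_plus, exp_ln by lra. f_equal; ring. }
  rewrite E3. pose proof (hasse_laplace (half_chi k) Hz) as H. rewrite laplace_dbump in H by assumption. rewrite <- H.
  set (h := Clim _). set (g := laplace (gammaden 1) (half_chi k)).
  assert (N3 : (RtoC 1 - RtoC 4)%C <> RtoC 0) by (intros E; injection E; lra).
  assert (N6 : RtoC 6 <> RtoC 0) by (intros E; injection E; lra).
  replace (RtoC 1 - RtoC 4)%C with (- RtoC 3)%C in * by (unfold RtoC, Cminus, Cplus, Copp; simpl; f_equal; ring).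
  assert (N3' : RtoC 3 <> RtoC 0) by (intros E; injection E; lra).
  assert (N2 : RtoC 2 <> RtoC 0) by (intros E; injection E; lra).
  replace (RtoC 6) with (RtoC 2 * RtoC 3)%C by (unfold RtoC, Cmult; simpl; f_equal; ring).
  replace (RtoC 4) with (RtoC 2 * RtoC 2)%C by (unfold RtoC, Cmult; simpl; f_equal; ring).
  field. repeat split; assumption.
Qed.

(** * First moments and the derivative of zeta at -1 *)

Lemma exp_taylor2 x : Rabs (exp x - 1 - x) <= x * x * exp (Rabs x).
Proof.
  destruct (mvt (fun x => exp x - x) (fun x => exp x - 1) 0 x) as [c [Hc E]].
  { intros y. auto_derive; [trivial|ring]. }
  destruct (mvt exp exp 0 c) as [d [Hd E2]]; [intros; apply is_derive_exp|].
  rewrite exp_0 in E, E2. rewrite !Rminus_0_r in *.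
  replace (exp x - 1 - x) with (exp x - x - 1) by ring. rewrite E, E2, !Rabs_mult.
  rewrite (Rabs_pos_eq (exp d)) by (left; apply exp_pos).
  assert (Hcx : Rabs c <= Rabs x).
  { unfold Rmin, Rmax in Hc. destruct (Rle_dec 0 x); [rewrite !Rabs_pos_eq by lra; lra|rewrite !Rabs_left1 by lra; lra]. }
  assert (Hdx : d <= Rabs x).
  { eapply Rle_trans; [|apply Hcx]. unfold Rmin, Rmax in Hd. destruct (Rle_dec 0 c); [rewrite Rabs_pos_eq by lra; lra|pose proof (Rabs_pos c); lra]. }
  replace (x * x * exp (Rabs x)) with (exp (Rabs x) * Rabs x * Rabs x).
  - apply Rmult_le_compat_r; [apply Rabs_pos|]. apply Rmult_le_compat; [left; apply exp_pos|apply Rabs_pos| |assumption].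
    now apply exp_le_mono.
  - replace (x * x) with (Rabs x * Rabs x) by (rewrite <- Rabs_mult; apply Rabs_pos_eq; apply (Rle_0_sqr x)). ring.
Qed.

Lemma sq_le_exp w : w * w <= 16 * exp (/ 2 * Rabs w).
Proof.
  pose proof (exp_ineq1_le (/ 4 * Rabs w)) as H. pose proof (Rabs_pos w) as P.
  replace (exp (/ 2 * Rabs w)) with (exp (/ 4 * Rabs w) * exp (/ 4 * Rabs w)) by (rewrite <- exp_plus; f_equal; field).
  replace (w * w) with (Rabs w * Rabs w) by (rewrite <- Rabs_mult; apply Rabs_pos_eq, (Rle_0_sqr w)). nra.
Qed.

Definition rlaplace (g : R -> R) (s : R) : R := RIntR (fun w => g w * exp (s * w)).

Lemma exp_s_dom K g s : Rabs s <= / 4 -> dom1 K g -> dom K (fun w => g w * exp (s * w)).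
Proof.
  intros Hs Hg. pose proof (dom_wcos K g s 0 Hs Hg) as H.
  replace (fun w => g w * exp (s * w)) with (fun x => g x * wcos s 0 x); [assumption|].
  apply functional_extensionality; intros x. unfold wcos. rewrite Rmult_0_l, cos_0. ring.
Qed.

(** Differentiation under the integral by the second order remainder |e^(hw) - 1 - hw| <= (hw)^2
    e^(|hw|). The constant 128 is 8 from [RIntR_bound] times 16 from [sq_le_exp]. *)
Lemma rlaplace_derive K g : dom1 K g -> is_derive (rlaplace g) 0 (RIntR (fun w => g w * w)).
Proof.
  intros Hg. pose proof (dom1_pos _ _ Hg) as HK.
  assert (Did : dom (K * 2) (fun w => g w * w)).
  { apply (dom_of_dom1 K g (fun y => y) 2); [assumption|intros; apply continuous_id|apply Rabs_le_half_exp]. }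
  assert (B : forall h, Rabs h <= / 4 -> Rabs (rlaplace g h - rlaplace g 0 - h * RIntR (fun w => g w * w)) <= 128 * K * (h * h)).
  { intros h Hh.
    assert (D : dom (K * (16 * (h * h))) (fun w => g w * (exp (h * w) - 1 - h * w))).
    { apply dom_of_dom1; [assumption| |].
      - intros x. apply (ex_derive_continuous (fun w => exp (h * w) - 1 - h * w)). auto_derive; trivial.
      - intros x. eapply Rle_trans; [apply exp_taylor2|].
        pose proof (sq_le_exp x) as Hx.
        replace (exp (3 / 4 * Rabs x)) with (exp (/ 2 * Rabs x) * exp (/ 4 * Rabs x)) by (rewrite <- exp_plus; f_equal; field).
        assert (H1 : exp (Rabs (h * x)) <= exp (/ 4 * Rabs x)).
        { apply exp_le_mono. rewrite Rabs_mult. apply Rmult_le_compat_r; [apply Rabs_pos|assumption]. }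
        pose proof (exp_pos (Rabs (h * x))). pose proof (exp_pos (/ 4 * Rabs x)). pose proof (exp_pos (/ 2 * Rabs x)).
        pose proof (Rle_0_sqr h) as Sh; unfold Rsqr in Sh. pose proof (Rle_0_sqr x) as Sx; unfold Rsqr in Sx.
        replace (h * x * (h * x)) with (h * h * (x * x)) by ring.
        replace (16 * (h * h) * (exp (/ 2 * Rabs x) * exp (/ 4 * Rabs x))) with (h * h * (16 * exp (/ 2 * Rabs x)) * exp (/ 4 * Rabs x)) by ring.
        apply Rmult_le_compat; [now apply Rmult_le_pos|lra| |assumption].
        now apply Rmult_le_compat_l. }
    pose proof (exp_s_dom K g h Hh Hg) as Dh.
    assert (D0 : dom K (fun w => g w * exp (0 * w))) by (apply exp_s_dom; [rewrite Rabs_R0; lra|assumption]).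
    replace (rlaplace g h - rlaplace g 0 - h * RIntR (fun w => g w * w)) with (RIntR (fun w => g w * (exp (h * w) - 1 - h * w))).
    - eapply Rle_trans; [apply (RIntR_bound _ _ D)|]. right; ring.
    - unfold rlaplace. rewrite <- (RIntR_scal h _ _ Did), <- (RIntR_minus _ _ _ _ Dh D0),
        <- (RIntR_minus _ _ _ _ (dom_minus _ _ _ _ Dh D0) (dom_scal h _ _ Did)).
      apply RIntR_ext. intros w. rewrite Rmult_0_l, exp_0. ring. }
  apply is_derive_Reals. intros eps He.
  assert (Hd : 0 < Rmin (/ 4) (eps / (128 * K + 1))) by (apply Rmin_pos; [lra|apply Rdiv_lt_0_compat; lra]).
  exists (mkposreal _ Hd). simpl. intros h Hh0 Hh.
  pose proof (Rmin_l (/ 4) (eps / (128 * K + 1))). pose proof (Rmin_r (/ 4) (eps / (128 * K + 1))).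
  specialize (B h ltac:(lra)). rewrite Rplus_0_l.
  replace ((rlaplace g h - rlaplace g 0) / h - RIntR (fun w => g w * w)) with ((rlaplace g h - rlaplace g 0 - h * RIntR (fun w => g w * w)) * / h) by (field; assumption).
  rewrite Rabs_mult, Rabs_inv. pose proof (Rabs_pos_lt h Hh0) as Hp.
  apply (Rmult_lt_reg_r (Rabs h)); [assumption|]. rewrite Rmult_assoc, Rinv_l, Rmult_1_r by lra.
  eapply Rle_lt_trans; [apply B|].
  replace (h * h) with (Rabs h * Rabs h) by (rewrite <- Rabs_mult; apply Rabs_pos_eq, (Rle_0_sqr h)).
  assert (Hq : Rabs h < eps / (128 * K + 1)) by lra.
  apply (Rmult_lt_compat_r (128 * K + 1)) in Hq; [|lra].
  replace (eps / (128 * K + 1) * (128 * K + 1)) with eps in Hq by (field; lra).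
  assert (128 * K * Rabs h < eps) by nra. nra.
Qed.

Lemma rlaplace_0 g : rlaplace g 0 = RIntR g.
Proof. apply RIntR_ext; intros. rewrite Rmult_0_l, exp_0. ring. Qed.

Lemma laplace_real g s : laplace g (RtoC s) = RtoC (rlaplace g s).
Proof.
  unfold laplace, RtoC, rlaplace, Re, Im; cbn [fst snd]. f_equal.
  - apply RIntR_ext; intros. unfold wcos. rewrite Rmult_0_l, cos_0. ring.
  - rewrite (RIntR_ext _ (fun _ => 0)).
    + unfold RIntR. rewrite (Lim_seq_ext _ (fun _ => 0)), Lim_seq_const; [reflexivity|].
      intros n. rewrite RInt_const. unfold scal; simpl; unfold mult; simpl. ring.
    + intros. unfold wsin. rewrite Rmult_0_l, sin_0. ring.
Qed.

Lemma RIntR_dfluct : RIntR dfluct = / 2.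
Proof.
  destruct fluct_bound as [K [HK [Hm Hp]]]. destruct dom1_dfluct as [Kd Hd].
  assert (Lm : is_lim fluct m_infty (- / 2)).
  { apply is_lim_spec. intros eps. destruct (pow_small 0 0 eps ltac:(lra) (Rle_refl 0) (cond_pos eps)) as [_ _].
    exists (Rmin 0 (ln (eps / (K + 1)))). intros w Hw.
    pose proof (Rmin_l 0 (ln (eps / (K + 1)))). pose proof (Rmin_r 0 (ln (eps / (K + 1)))).
    replace (fluct w - - / 2) with (fluct w + / 2) by ring.
    eapply Rle_lt_trans; [apply Hm; lra|].
    assert (He : exp w < eps / (K + 1)).
    { rewrite <- (exp_ln (eps / (K + 1))) by (apply Rdiv_lt_0_compat; [apply eps|lra]). apply exp_increasing. lra. }
    pose proof (exp_pos w). apply (Rmult_lt_compat_r (K + 1)) in He; [|lra].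
    replace (eps / (K + 1) * (K + 1)) with (pos eps) in He by (field; lra). nra. }
  assert (Lp : is_lim fluct p_infty 0).
  { apply is_lim_spec. intros eps.
    exists (Rmax 0 (- ln (eps / (K + 1)))). intros w Hw.
    pose proof (Rmax_l 0 (- ln (eps / (K + 1)))). pose proof (Rmax_r 0 (- ln (eps / (K + 1)))).
    rewrite Rminus_0_r.
    eapply Rle_lt_trans; [apply Hp; lra|].
    assert (He : exp (- w) < eps / (K + 1)).
    { rewrite <- (exp_ln (eps / (K + 1))) by (apply Rdiv_lt_0_compat; [apply eps|lra]). apply exp_increasing. lra. }
    pose proof (exp_pos (- w)). apply (Rmult_lt_compat_r (K + 1)) in He; [|lra].
    replace (eps / (K + 1) * (K + 1)) with (pos eps) in He by (field; lra). nra. }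
  rewrite (RIntR_derive Kd fluct dfluct (- / 2) 0); [lra|now apply dom1_dom|apply fluct_derive|assumption|assumption].
Qed.

Lemma RIntR_dbump : RIntR dbump = 2.
Proof.
  destruct (gammaden_dom1 1 ltac:(lia)) as [K1 H1]. destruct (gammaden_dom1 2 ltac:(lia)) as [K2 H2].
  apply dom1_dom in H1, H2. unfold dbump.
  rewrite (RIntR_plus _ _ _ _ (dom_scal 6 _ _ H1) (dom_scal (-4) _ _ H2)), (RIntR_scal _ _ _ H1), (RIntR_scal _ _ _ H2), !RIntR_gammaden.
  simpl. ring.
Qed.

Lemma RIntR_dbump_log : RIntR (fun w => dbump w * w) = -4 - 2 * euler_gamma.
Proof.
  destruct (RIntR_gammaden_log 0) as [[K1 H1] _]. destruct (RIntR_gammaden_log 1) as [[K2 H2] E2].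
  rewrite euler_gamma_RIntR.
  rewrite (RIntR_ext _ (fun w => 6 * (gammaden 1 w * w) + -4 * (gammaden 2 w * w))) by (intros; unfold dbump; ring).
  rewrite (RIntR_plus _ _ _ _ (dom_scal 6 _ _ H1) (dom_scal (-4) _ _ H2)), (RIntR_scal _ _ _ H1), (RIntR_scal _ _ _ H2), E2.
  simpl. field.
Qed.

Lemma zeta_real s : Rabs ((s + 1) / 2) <= / 4 -> rlaplace dbump ((s + 1) / 2) <> 0 ->
  Re (zeta (RtoC s)) = rlaplace dfluct ((s + 1) / 2) / rlaplace dbump ((s + 1) / 2) / (1 - exp ((1 - s) * ln 2)).
Proof.
  intros Hs HB. set (t := (s + 1) / 2) in *.
  pose proof (hasse_laplace (RtoC t) Hs) as H. rewrite !laplace_real in H.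
  replace (RtoC 2 * RtoC t - RtoC 1)%C with (RtoC s) in H
    by (rewrite <- RtoC_mult, <- RtoC_minus; f_equal; unfold t; field).
  rewrite zeta_hasse.
  replace (Defs.Cpow 2 (RtoC 1 - RtoC s)%C) with (RtoC (exp ((1 - s) * ln 2))).
  2: { unfold Defs.Cpow, Cexp, RtoC, Re, Im, Cminus, Cmult, Cplus, Copp; cbn [fst snd].
    replace ((1 + - s) * 0 + (0 + - 0) * ln 2) with 0 by ring. rewrite cos_0, sin_0.
    replace ((1 + - s) * ln 2 - (0 + - 0) * 0) with ((1 - s) * ln 2) by ring. f_equal; ring. }
  set (h := Clim _) in *. destruct h as [h1 h2].
  assert (H1 : rlaplace dbump t * h1 = rlaplace dfluct t).
  { apply (f_equal fst) in H. unfold Cmult, RtoC in H; cbn [fst snd] in H. lra. }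
  rewrite <- RtoC_minus. set (q := 1 - exp ((1 - s) * ln 2)).
  replace (rlaplace dfluct t / rlaplace dbump t) with h1 by (rewrite <- H1; field; assumption).
  unfold Cinv, Cmult, RtoC, Re; cbn [fst snd].
  destruct (Req_dec q 0) as [E|E].
  - rewrite E. unfold Rdiv. replace (0 ^ 2 + 0 ^ 2) with 0 by ring. rewrite Rinv_0. ring.
  - field; try split; try assumption; nra.
Qed.

(** The formula of [zeta_real] is differentiated at s = -1, that is t = 0, and solved for the
    unknown moment. The values entering are 1/2 and 2 for the transforms and 1 - 2^2 = -3 for the
    prefactor, in accordance with zeta(-1) = -1/12. *)
Lemma RIntR_dfluct_log : RIntR (fun w => dfluct w * w) = -12 * zeta'_m1 - 4 / 3 * ln 2 - 1 - euler_gamma / 2.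
Proof.
  destruct dom1_dfluct as [Kd Hd]. destruct dbump_dom1 as [KB HB].
  pose proof (rlaplace_derive Kd dfluct Hd) as D1. pose proof (rlaplace_derive KB dbump HB) as D2.
  rewrite RIntR_dbump_log in D2. set (m1 := RIntR (fun w => dfluct w * w)) in *.
  assert (V1 : rlaplace dfluct 0 = / 2) by (rewrite rlaplace_0; apply RIntR_dfluct).
  assert (V2 : rlaplace dbump 0 = 2) by (rewrite rlaplace_0; apply RIntR_dbump).
  assert (Z : is_derive (fun s => Re (zeta (RtoC s))) (-1)
     (- / 6 * (m1 / 2 + / 2 + euler_gamma / 4) - ln 2 / 9)).
  { apply (is_derive_ext_loc (fun s => rlaplace dfluct ((s + 1) / 2) / rlaplace dbump ((s + 1) / 2) / (1 - exp ((1 - s) * ln 2)))).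
    - assert (C2 : continuous (rlaplace dbump) 0) by (apply (ex_derive_continuous (rlaplace dbump)); eexists; apply D2).
      (* [zeta_real] divides by this transform; its value 2 at 0 and its continuity keep it away
         from 0 nearby. *)
      assert (L : locally 0 (fun t => rlaplace dbump t <> 0)).
      { apply (C2 (fun v => v <> 0)). rewrite V2. exists (mkposreal 1 Rlt_0_1). intros y Hy.
        unfold ball in Hy; simpl in Hy; unfold AbsRing_ball, abs, minus, plus, opp in Hy; simpl in Hy.
        intros E; rewrite E in Hy. rewrite Rabs_left in Hy; lra. }
      destruct L as [d L].
      assert (He : 0 < Rmin (/ 2) d) by (apply Rmin_pos; [lra|apply d]).
      exists (mkposreal _ He). intros y Hy.
      unfold ball in Hy; simpl in Hy; unfold AbsRing_ball, abs, minus, plus, opp in Hy; simpl in Hy.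
      pose proof (Rmin_l (/ 2) d). pose proof (Rmin_r (/ 2) d).
      assert (Hy2 : Rabs ((y + 1) / 2) <= / 2 * Rabs (y + - -1)).
      { unfold Rdiv. rewrite Rabs_mult, (Rabs_pos_eq (/ 2)) by lra. replace (y + - -1) with (y + 1) by ring. lra. }
      symmetry. apply zeta_real.
      + lra.
      + apply L. unfold ball; simpl; unfold AbsRing_ball, abs, minus, plus, opp; simpl.
        rewrite Ropp_0, Rplus_0_r. pose proof (Rabs_pos (y + - -1)). lra.
    - assert (D1' : is_derive (fun s => rlaplace dfluct ((s + 1) / 2)) (-1) (/ 2 * m1)).
      { apply (is_derive_comp (rlaplace dfluct) (fun s => (s + 1) / 2)); [replace ((-1 + 1) / 2) with 0 by field; assumption|].
        auto_derive; [trivial|field]. }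
      assert (D2' : is_derive (fun s => rlaplace dbump ((s + 1) / 2)) (-1) (/ 2 * (-4 - 2 * euler_gamma))).
      { apply (is_derive_comp (rlaplace dbump) (fun s => (s + 1) / 2)); [replace ((-1 + 1) / 2) with 0 by field; assumption|].
        auto_derive; [trivial|field]. }
      assert (D3 : is_derive (fun s => 1 - exp ((1 - s) * ln 2)) (-1) (4 * ln 2)).
      { auto_derive; [trivial|]. replace ((1 + - -1) * ln 2) with (ln 2 + ln 2) by ring. rewrite exp_plus, exp_ln by lra. ring. }
      assert (E0 : (-1 + 1) / 2 = 0) by field.
      assert (E3 : exp ((1 - -1) * ln 2) = 4).
      { replace ((1 - -1) * ln 2) with (ln 2 + ln 2) by ring. rewrite exp_plus, exp_ln by lra. ring. }
      pose proof (is_derive_div _ _ _ _ _ D1' D2' ltac:(cbv beta; rewrite E0, V2; lra)) as D4.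
      pose proof (is_derive_div _ _ _ _ _ D4 D3 ltac:(cbv beta; rewrite E3; lra)) as D5.
      cbv beta in D5. rewrite E0, V1, V2, E3 in D5.
      match type of D5 with is_derive _ _ ?v => replace (- / 6 * (m1 / 2 + / 2 + euler_gamma / 4) - ln 2 / 9) with v; [exact D5|field] end. }
  assert (Z' : zeta'_m1 = - / 6 * (m1 / 2 + / 2 + euler_gamma / 4) - ln 2 / 9) by exact (is_derive_unique _ _ _ Z).
  rewrite Z'. field.
Qed.

(** * Pointwise convergence of Fourier series *)

Lemma RInt_translate (f : R -> R) c a b : (forall x, continuous f x) ->
  RInt (fun t => f (c + t)) a b = RInt f (c + a) (c + b).
Proof.
  intros Hc.
  assert (H : is_RInt (fun y => scal 1 (f (1 * y + c))) a b (RInt f (c + a) (c + b))).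
  { apply (is_RInt_comp_lin f 1 c).
    replace (1 * a + c) with (c + a) by ring. replace (1 * b + c) with (c + b) by ring.
    apply (@RInt_correct R_CompleteNormedModule), cont_ex_RInt, Hc. }
  apply is_RInt_unique. eapply is_RInt_ext; [|apply H].
  intros x _. unfold scal; simpl; unfold mult; simpl. rewrite Rmult_1_l. f_equal; ring.
Qed.

Lemma RInt_period (g : R -> R) a : (forall x, continuous g x) -> (forall x, g (x + 1) = g x) ->
  RInt g a (a + 1) = RInt g 0 1.
Proof.
  intros Hc Hp. assert (E : forall a b, ex_RInt g a b) by (intros; now apply cont_ex_RInt).
  rewrite <- (RInt_Chasles g a 0 (a + 1)), <- (RInt_Chasles g 0 1 (a + 1)) by apply E.
  assert (H1 : RInt g 1 (a + 1) = RInt g 0 a).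
  { replace 1 with (1 + 0) at 1 by ring. rewrite (Rplus_comm a 1), <- RInt_translate by assumption.
    apply RInt_ext. intros x _. rewrite <- (Hp x). f_equal; ring. }
  rewrite H1, <- (opp_RInt_swap g 0 a) by apply E. unfold plus, opp; simpl. ring.
Qed.

Lemma RInt_cos_full (j : Z) : RInt (fun t => cos (2 * PI * IZR j * t)) (- / 2) (/ 2) = if Z.eq_dec j 0 then 1 else 0.
Proof.
  destruct (Z.eq_dec j 0) as [->|Hj].
  - rewrite (RInt_ext _ (fun _ => 1)) by (intros; replace (2 * PI * 0 * x) with 0 by ring; apply cos_0).
    rewrite RInt_const. unfold scal; simpl; unfold mult; simpl. field.
  - pose proof PI_RGT_0 as HP. assert (Hj' : IZR j <> 0) by (now apply not_0_IZR).
    set (c := 2 * PI * IZR j). assert (Hc : c <> 0) by (unfold c; apply Rmult_integral_contrapositive_currified; [apply Rmult_integral_contrapositive_currified; [lra|apply PI_neq0]|assumption]).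
    rewrite (is_RInt_unique _ _ _ (minus (sin (c * / 2) / c) (sin (c * - / 2) / c))).
    + unfold minus, plus, opp; simpl. replace (c * - / 2) with (- (c * / 2)) by ring. rewrite sin_neg.
      replace (sin (c * / 2)) with 0; [field; assumption|]. symmetry. apply sin_eq_0_1. exists j. unfold c. field.
    + apply (is_RInt_derive (fun t => sin (c * t) / c)).
      * intros x _. auto_derive; [trivial|]. field. assumption.
      * intros x _. apply (ex_derive_continuous (fun t => cos (c * t))). auto_derive; trivial.
Qed.

(** The numerators of the Dirichlet kernels. On [-1/2, 1/2] they are orthogonal with square norm
    1/2, so Bessel's inequality applies to them directly. *)
Definition odd_sin (n : nat) (t : R) : R := sin ((2 * INR n + 1) * PI * t).

Lemma odd_sin_cont n t : continuous (odd_sin n) t.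
Proof. apply (ex_derive_continuous (odd_sin n)). unfold odd_sin. auto_derive; trivial. Qed.

Lemma odd_sin_ortho m n : RInt (fun t => odd_sin m t * odd_sin n t) (- / 2) (/ 2) = if Nat.eq_dec m n then / 2 else 0.
Proof.
  rewrite (RInt_ext _ (fun t => plus (scal (/ 2) (cos (2 * PI * IZR (Z.of_nat m - Z.of_nat n) * t)))
     (scal (- / 2) (cos (2 * PI * IZR (Z.of_nat m + Z.of_nat n + 1) * t))))).
  - assert (C : forall j, ex_RInt (fun t => cos (2 * PI * IZR j * t)) (- / 2) (/ 2)).
    { intros j. apply cont_ex_RInt. intros x. apply (ex_derive_continuous (fun t => cos (2 * PI * IZR j * t))). auto_derive; trivial. }
    rewrite (@RInt_plus R_CompleteNormedModule) by (apply (@ex_RInt_scal R_NormedModule), C).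
    rewrite !(@RInt_scal R_CompleteNormedModule) by apply C. rewrite !RInt_cos_full.
    destruct (Z.eq_dec (Z.of_nat m + Z.of_nat n + 1) 0); [lia|].
    unfold plus, scal; simpl; unfold mult; simpl.
    destruct (Z.eq_dec (Z.of_nat m - Z.of_nat n) 0), (Nat.eq_dec m n); try lia; ring.
  - intros t _. unfold odd_sin, plus, scal; simpl; unfold mult; simpl.
    rewrite minus_IZR, !plus_IZR, <- !INR_IZR_INZ.
    replace (2 * PI * (INR m - INR n) * t) with ((2 * INR m + 1) * PI * t - (2 * INR n + 1) * PI * t) by ring.
    replace (2 * PI * (INR m + INR n + 1) * t) with ((2 * INR m + 1) * PI * t + (2 * INR n + 1) * PI * t) by ring.
    rewrite cos_minus, cos_plus. field.
Qed.

Lemma is_RInt_plus_R (f g : R -> R) (a b l1 l2 : R) : is_RInt f a b l1 -> is_RInt g a b l2 ->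
  is_RInt (fun s => f s + g s) a b (l1 + l2).
Proof. apply (@is_RInt_plus R_NormedModule). Qed.

Lemma is_RInt_ext_R (f g : R -> R) (a b l : R) : (forall x : R, f x = g x) -> is_RInt f a b l -> is_RInt g a b l.
Proof. intros H. apply is_RInt_ext. intros; apply H. Qed.

Section Bessel.
Variable G : R -> R.
Hypothesis HG : forall x, continuous G x.
Let I (f : R -> R) : R := RInt f (- / 2) (/ 2).
Let b (n : nat) : R := I (fun t => G t * odd_sin n t).
(** G minus its orthogonal projection on the first M functions; the factor 2 is the inverse of their
    square norm. *)
Fixpoint resid (M : nat) : R -> R :=
  match M with O => G | S M => fun t => resid M t - 2 * b M * odd_sin M t end.

Let resid_cont M : forall x, continuous (resid M) x.
Proof.
  induction M as [|M IH]; intros x; [apply HG|]. simpl.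
  apply (continuous_minus (resid M) (fun t => 2 * b M * odd_sin M t)); [apply IH|].
  apply (continuous_scal_r (2 * b M) (odd_sin M)), odd_sin_cont.
Qed.

Let I_lin (f g : R -> R) c : (forall x, continuous f x) -> (forall x, continuous g x) ->
  I (fun t => f t - c * g t) = I f - c * I g.
Proof.
  intros Hf Hg. unfold I.
  apply is_RInt_unique.
  apply (@is_RInt_minus R_NormedModule f (fun t => scal c (g t)) _ _ (RInt f (- / 2) (/ 2)) (scal c (RInt g (- / 2) (/ 2)))).
  - apply (@RInt_correct R_CompleteNormedModule), cont_ex_RInt, Hf.
  - apply (@is_RInt_scal R_NormedModule), (@RInt_correct R_CompleteNormedModule), cont_ex_RInt, Hg.
Qed.

Let resid_coef M : forall n, (M <= n)%nat -> I (fun t => resid M t * odd_sin n t) = b n.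
Proof.
  induction M as [|M IH]; intros n Hn; [reflexivity|].
  transitivity (I (fun t => resid M t * odd_sin n t - 2 * b M * (odd_sin M t * odd_sin n t))).
  { apply RInt_ext. intros t _. simpl. ring. }
  rewrite (I_lin (fun t => resid M t * odd_sin n t) (fun t => odd_sin M t * odd_sin n t)).
  - rewrite IH by lia. unfold I at 1. rewrite odd_sin_ortho. destruct (Nat.eq_dec M n); [lia|ring].
  - intros x. apply cont_mult; [apply resid_cont|apply odd_sin_cont].
  - intros x. apply cont_mult; apply odd_sin_cont.
Qed.

Let resid_sq M : I (fun t => resid (S M) t * resid (S M) t) = I (fun t => resid M t * resid M t) - 2 * (b M * b M).
Proof.
  transitivity (I (fun t => (resid M t * resid M t - 4 * b M * (resid M t * odd_sin M t)) - - (4 * (b M * b M)) * (odd_sin M t * odd_sin M t))).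
  { apply RInt_ext. intros t _. simpl. ring. }
  assert (C1 : forall x, continuous (fun t => resid M t * resid M t) x) by (intros; apply cont_mult; apply resid_cont).
  assert (C2 : forall x, continuous (fun t => resid M t * odd_sin M t) x) by (intros; apply cont_mult; [apply resid_cont|apply odd_sin_cont]).
  assert (C3 : forall x, continuous (fun t => odd_sin M t * odd_sin M t) x) by (intros; apply cont_mult; apply odd_sin_cont).
  rewrite (I_lin (fun t => resid M t * resid M t - 4 * b M * (resid M t * odd_sin M t)) (fun t => odd_sin M t * odd_sin M t)).
  - rewrite (I_lin (fun t => resid M t * resid M t) (fun t => resid M t * odd_sin M t)) by assumption.
    rewrite resid_coef by lia. unfold I at 2. rewrite odd_sin_ortho. destruct (Nat.eq_dec M M); [field|lia].
  - intros x. apply (continuous_minus (fun t => resid M t * resid M t) (fun t => 4 * b M * (resid M t * odd_sin M t))); [apply C1|].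
    apply (continuous_scal_r (4 * b M) (fun t => resid M t * odd_sin M t)), C2.
  - assumption.
Qed.

(** The Riemann-Lebesgue lemma for a merely continuous G: the squares of the coefficients have
    bounded partial sums because the residuals have nonnegative square integral. *)
Lemma bessel_coef_lim : is_lim_seq (fun n => RInt (fun t => G t * odd_sin n t) (- / 2) (/ 2)) 0.
Proof.
  change (is_lim_seq b 0).
  assert (S1 : forall M, sum_f_R0 (fun n => b n * b n) M = / 2 * (I (fun t => G t * G t) - I (fun t => resid (S M) t * resid (S M) t))).
  { intros M; induction M as [|M IH].
    - cbn [sum_f_R0]. rewrite resid_sq. simpl resid. field.
    - rewrite tech5, IH, (resid_sq (S M)). field. }
  assert (S2 : forall M, sum_f_R0 (fun n => b n * b n) M <= / 2 * I (fun t => G t * G t)).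
  { intros M. rewrite S1.
    assert (0 <= I (fun t => resid (S M) t * resid (S M) t)); [|lra].
    apply RInt_ge_0; [lra|apply cont_ex_RInt; intros; apply cont_mult; apply (resid_cont (S M))|].
    intros; apply (Rle_0_sqr (resid (S M) x)). }
  assert (Hx : ex_series (fun n => b n * b n)).
  { apply (ex_finite_lim_seq_incr _ (/ 2 * I (fun t => G t * G t))).
    - intros n. rewrite !sum_n_Reals, tech5. pose proof (Rle_0_sqr (b (S n))) as H; unfold Rsqr in H. lra.
    - intros n. rewrite sum_n_Reals. apply S2. }
  apply ex_series_lim_0 in Hx. apply is_lim_seq_spec in Hx. apply is_lim_seq_eps. intros eps He.
  destruct (Hx (mkposreal (eps * eps) ltac:(nra))) as [N HN]. simpl in HN. exists N. intros n Hn.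
  specialize (HN n Hn). rewrite Rminus_0_r in *. rewrite Rabs_mult in HN. pose proof (Rabs_pos (b n)).
  destruct (Rle_dec (Rabs (b n)) eps); [assumption|]. nra.
Qed.
End Bessel.

Lemma slope_continuous (f : R -> R) x : (forall y, continuous f y) -> ex_derive f x ->
  exists phi : R -> R, (forall h, continuous phi h) /\ forall h, f (x + h) - f x = phi h * h.
Proof.
  intros Hc [d Hd].
  exists (fun h => if Req_EM_T h 0 then d else (f (x + h) - f x) / h). split.
  - intros h. destruct (Req_dec h 0) as [->|Hh].
    + apply is_derive_Reals in Hd. apply continuity_pt_filterlim.
      intros eps He. destruct (Hd eps He) as [del H]. exists del. split; [apply del|].
      intros y [_ Hy]. unfold dist in *; simpl in *; unfold Rdist in *. rewrite Rminus_0_r in Hy.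
      destruct (Req_EM_T 0 0) as [_|]; [|lra].
      destruct (Req_EM_T y 0) as [_|Hy0]; [rewrite Rminus_diag, Rabs_R0; lra|]. now apply H.
    + apply (continuous_ext_loc _ (fun h => (f (x + h) - f x) * / h)).
      * assert (Hp : 0 < Rabs h) by now apply Rabs_pos_lt.
        exists (mkposreal _ Hp). intros y Hy.
        unfold ball in Hy; simpl in Hy; unfold AbsRing_ball, abs, minus, plus, opp in Hy; simpl in Hy.
        destruct (Req_EM_T y 0) as [E|_]; [|reflexivity].
        rewrite E, Rplus_0_l, Rabs_Ropp in Hy. lra.
      * apply cont_mult.
        -- apply (continuous_minus (fun h => f (x + h)) (fun _ => f x)); [|apply continuous_const].
           apply (continuous_comp (fun h => x + h) f); [|apply Hc].
           apply (continuous_plus (fun _ => x) (fun h => h)); [apply continuous_const|apply continuous_id].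
        -- apply (ex_derive_continuous (fun h => / h)). auto_derive. assumption.
  - intros h. destruct (Req_EM_T h 0) as [->|Hh]; [rewrite Rplus_0_r; ring|field; assumption].
Qed.

Lemma dirichlet N t : sin (PI * t) * (1 + 2 * sum_f_R0 (fun m => cos (2 * PI * INR (S m) * t)) N) = odd_sin (S N) t.
Proof.
  assert (St : forall n, 2 * sin (PI * t) * cos (2 * PI * INR (S n) * t) = odd_sin (S n) t - odd_sin n t).
  { intros n. unfold odd_sin. rewrite S_INR.
    replace ((2 * (INR n + 1) + 1) * PI * t) with (2 * PI * (INR n + 1) * t + PI * t) by ring.
    replace ((2 * INR n + 1) * PI * t) with (2 * PI * (INR n + 1) * t - PI * t) by ring.
    rewrite sin_plus, sin_minus. ring. }
  induction N as [|N IH].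
  - cbn [sum_f_R0]. pose proof (St 0%nat) as H.
    assert (odd_sin 0 t = sin (PI * t)) by (unfold odd_sin; simpl INR; f_equal; ring). lra.
  - rewrite tech5. pose proof (St (S N)). lra.
Qed.

(** With f(x+t) - f(x) = phi(t) t and sin(pi t) = sg(t) t, the zero of the Dirichlet denominator at
    t = 0 cancels. The error of the N-th partial sum becomes the integral of (phi/sg)(t) times
    [odd_sin (S N)], with a continuous first factor, and tends to 0 by [bessel_coef_lim]. *)
Lemma fourier_pointwise (f : R -> R) : (forall x, continuous f x) -> (forall x, ex_derive f x) ->
  (forall x, f (x + 1) = f x) -> forall x,
  is_lim_seq (fun N => sum_f_R0 (fun m => 2 * RInt (fun s => f s * cos (2 * PI * INR (S m) * (x - s))) 0 1) N)
    (f x - RInt f 0 1).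
Proof.
  intros Hc Hd Hp x.
  destruct (slope_continuous f x Hc (Hd x)) as [phi [Cphi Ephi]].
  destruct (slope_continuous (fun t => sin (PI * t)) 0) as [sg [Csg Esg]].
  { intros y. apply (ex_derive_continuous (fun t => sin (PI * t))). auto_derive; trivial. }
  { auto_derive; trivial. }
  assert (Esg' : forall h, sin (PI * h) = sg h * h).
  { intros h. rewrite <- Esg, Rplus_0_l, Rmult_0_r, sin_0. ring. }
  (* Clamping to [-1/2, 1/2] makes the quotient continuous on the whole line, whereas [sg] itself
     vanishes at the nonzero integers. *)
  pose (cl := fun t => Rmax (- / 2) (Rmin t (/ 2))).
  assert (Hcl : forall t, - / 2 <= t <= / 2 -> cl t = t).
  { intros t Ht. unfold cl. rewrite Rmin_left, Rmax_right; lra. }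
  assert (Rcl : forall t, - / 2 <= cl t <= / 2).
  { intros t. unfold cl. unfold Rmax, Rmin. destruct (Rle_dec t (/ 2)); destruct (Rle_dec _ _); lra. }
  assert (Ccl : forall t, continuous cl t).
  { intros t. apply continuity_pt_filterlim. intros eps He. exists eps. split; [assumption|].
    intros y [_ Hy]. unfold dist in *; simpl in *; unfold Rdist in *. eapply Rle_lt_trans; [|apply Hy].
    unfold cl, Rmax, Rmin. repeat destruct (Rle_dec _ _); unfold Rabs; repeat destruct (Rcase_abs _); lra. }
  assert (Nsg : forall h, - / 2 <= h <= / 2 -> sg h <> 0).
  { intros h Hh E. destruct (Req_dec h 0) as [->|H0].
    - (* the slope at [0] is the derivative [PI] *)
      assert (L : is_derive (fun t => sin (PI * t)) 0 0).
      { apply is_derive_Reals. intros eps He. destruct (proj2 (continuity_pt_filterlim sg 0) (Csg 0) eps He) as [al [Hal H]].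
        exists (mkposreal al Hal). intros k Hk0 Hk. simpl in Hk. rewrite Esg.
        replace (sg k * k / k - 0) with (sg k - sg 0) by (rewrite E; field; assumption).
        apply (H k). split; [split; [exact Logic.I|auto]|]. unfold dist; simpl; unfold Rdist. now rewrite Rminus_0_r. }
      apply is_derive_unique in L.
      assert (L2 : is_derive (fun t => sin (PI * t)) 0 PI).
      { auto_derive; [trivial|]. rewrite Rmult_0_r, cos_0. ring. }
      apply is_derive_unique in L2. pose proof PI_RGT_0. lra.
    - pose proof (Esg' h) as S0. rewrite E, Rmult_0_l in S0. pose proof PI_RGT_0 as HP.
      destruct (Rlt_dec 0 h) as [P|P].
      + assert (0 < sin (PI * h)) by (apply sin_gt_0; nra). lra.
      + assert (0 < sin (PI * - h)) by (apply sin_gt_0; nra).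
        replace (PI * - h) with (- (PI * h)) in H by ring. rewrite sin_neg in H. lra. }
  pose (G := fun t => phi (cl t) * / sg (cl t)).
  assert (CG : forall t, continuous G t).
  { intros t. apply cont_mult.
    - apply (continuous_comp cl phi); [apply Ccl|apply Cphi].
    - apply (continuous_comp (fun t => sg (cl t)) Rinv).
      + apply (continuous_comp cl sg); [apply Ccl|apply Csg].
      + apply (ex_derive_continuous Rinv). apply (ex_derive_inv (fun y => y)); [auto_derive; trivial|]. apply Nsg, Rcl. }
  pose proof (bessel_coef_lim G CG) as HB. apply is_lim_seq_incr_1 in HB.
  assert (Cc : forall m y, continuous (fun s => cos (2 * PI * INR (S m) * (x - s))) y).
  { intros m y. apply (ex_derive_continuous (fun s => cos (2 * PI * INR (S m) * (x - s)))). auto_derive; trivial. }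
  assert (Ksum : forall N, RInt (fun s => (f s - f x) * (1 + 2 * sum_f_R0 (fun m => cos (2 * PI * INR (S m) * (x - s))) N)) 0 1
     = RInt (fun t => G t * odd_sin (S N) t) (- / 2) (/ 2)).
  { intros N. set (g := fun s => (f s - f x) * (1 + 2 * sum_f_R0 (fun m => cos (2 * PI * INR (S m) * (x - s))) N)).
    assert (Cg : forall y, continuous g y).
    { intros y. apply cont_mult.
      - apply (continuous_minus f (fun _ => f x)); [apply Hc|apply continuous_const].
      - apply (continuous_plus (fun _ => 1) (fun s => 2 * sum_f_R0 (fun m => cos (2 * PI * INR (S m) * (x - s))) N)); [apply continuous_const|].
        apply (continuous_scal_r 2 (fun s => sum_f_R0 (fun m => cos (2 * PI * INR (S m) * (x - s))) N)).
        induction N as [|N IH]; simpl; [apply (Cc 0%nat)|].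
        apply (continuous_plus (fun s => sum_f_R0 (fun m => cos (2 * PI * INR (S m) * (x - s))) N)); [apply IH|apply (Cc (S N))]. }
    rewrite <- (RInt_period g (x + - / 2) Cg).
    - replace (x + - / 2 + 1) with (x + / 2) by field. rewrite <- RInt_translate by assumption.
      apply RInt_ext. intros t Ht. rewrite Rmin_left, Rmax_right in Ht by lra.
      unfold g, G. rewrite Hcl by lra. rewrite Ephi, <- dirichlet, Esg'.
      rewrite (sum_eq (fun m => cos (2 * PI * INR (S m) * (x - (x + t)))) (fun m => cos (2 * PI * INR (S m) * t))).
      + match goal with |- @eq _ ?a ?b => change (@eq R a b) end. field. apply Nsg; lra.
      + intros m _. rewrite <- cos_neg. f_equal. ring.
    - intros y. unfold g. rewrite Hp. do 3 f_equal. apply sum_eq. intros m _.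
      rewrite <- (cos_period _ (S m)). f_equal. ring. }
  replace (f x - RInt f 0 1) with (0 + (f x - RInt f 0 1)) by ring.
  eapply is_lim_seq_ext; [|apply is_lim_seq_plus'; [apply HB|apply (is_lim_seq_const (f x - RInt f 0 1))]].
  intros N. cbv beta. rewrite <- Ksum.
  assert (Ec : forall m, ex_RInt (fun s => f s * cos (2 * PI * INR (S m) * (x - s))) 0 1).
  { intros m. apply cont_ex_RInt. intros y; apply cont_mult; [apply Hc|apply Cc]. }
  assert (Ec1 : forall m, ex_RInt (fun s => cos (2 * PI * INR (S m) * (x - s))) 0 1).
  { intros m. apply cont_ex_RInt. apply Cc. }
  assert (Ic : forall m, RInt (fun s => cos (2 * PI * INR (S m) * (x - s))) 0 1 = 0).
  { intros m. set (c := 2 * PI * INR (S m)). pose proof PI_RGT_0. assert (0 < INR (S m)) by (apply lt_0_INR; lia).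
    assert (Hc0 : c <> 0) by (unfold c; apply Rmult_integral_contrapositive_currified; [apply Rmult_integral_contrapositive_currified; [lra|apply PI_neq0]|apply Rgt_not_eq; assumption]).
    rewrite (is_RInt_unique _ _ _ (minus (- sin (c * (x - 1)) / c) (- sin (c * (x - 0)) / c))).
    - unfold minus, plus, opp; simpl.
      replace (sin (c * (x - 0))) with (sin (c * (x - 1))); [field; assumption|].
      rewrite <- (sin_period _ (S m)). f_equal. unfold c. ring.
    - apply (is_RInt_derive (fun s => - sin (c * (x - s)) / c)).
      + intros y _. auto_derive; [trivial|]. unfold Rminus. field. assumption.
      + intros y _. apply Cc. }
  assert (Ef : ex_RInt f 0 1) by now apply cont_ex_RInt.
  assert (K : forall N, is_RInt (fun s => (f s - f x) * (1 + 2 * sum_f_R0 (fun m => cos (2 * PI * INR (S m) * (x - s))) N)) 0 1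
     (RInt f 0 1 - f x + sum_f_R0 (fun m => 2 * RInt (fun s => f s * cos (2 * PI * INR (S m) * (x - s))) 0 1) N)).
  { assert (St : forall m, is_RInt (fun s => 2 * (f s * cos (2 * PI * INR (S m) * (x - s))) - 2 * f x * cos (2 * PI * INR (S m) * (x - s))) 0 1
       (2 * RInt (fun s => f s * cos (2 * PI * INR (S m) * (x - s))) 0 1)).
    { intros m. replace (2 * RInt (fun s => f s * cos (2 * PI * INR (S m) * (x - s))) 0 1) with
        (minus (scal 2 (RInt (fun s => f s * cos (2 * PI * INR (S m) * (x - s))) 0 1)) (scal (2 * f x) (RInt (fun s => cos (2 * PI * INR (S m) * (x - s))) 0 1)) : R).
      - apply (@is_RInt_minus R_NormedModule); apply (@is_RInt_scal R_NormedModule); apply (@RInt_correct R_CompleteNormedModule); [apply Ec|apply Ec1].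
      - rewrite Ic. unfold minus, plus, opp, scal; simpl; unfold mult; simpl. ring. }
    assert (B0 : is_RInt (fun s => f s - f x) 0 1 (RInt f 0 1 - f x)).
    { replace (RInt f 0 1 - f x) with (minus (RInt f 0 1) (scal (1 - 0) (f x)) : R) by (unfold minus, plus, opp, scal; simpl; unfold mult; simpl; ring).
      apply (@is_RInt_minus R_NormedModule); [apply (@RInt_correct R_CompleteNormedModule), Ef|apply (@is_RInt_const R_NormedModule)]. }
    intros M; induction M as [|M IH].
    - cbn [sum_f_R0].
      eapply is_RInt_ext_R; [|apply (is_RInt_plus_R _ _ _ _ _ _ B0 (St 0%nat))].
      intros s. cbv beta. ring.
    - rewrite tech5. rewrite <- Rplus_assoc.
      eapply is_RInt_ext_R; [|apply (is_RInt_plus_R _ _ _ _ _ _ IH (St (S M)))].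
      intros s. rewrite tech5. cbv beta. ring. }
  rewrite (is_RInt_unique _ _ _ _ (K N)).
  match goal with |- @eq _ ?a ?b => change (@eq R a b) end. ring.
Qed.

(** * The periodic fluctuation *)

(** The step of w between consecutive levels, since N = 2^l enters as N^2/n; with x = log_4 n the
    argument of level l is (l - x) ln 4. *)
Definition lam : R := ln 4.
Lemma lam_eq : lam = 2 * ln 2.
Proof. unfold lam. replace 4 with (2 * 2) by ring. rewrite ln_mult by lra. ring. Qed.
Lemma lam_pos : 0 < lam. Proof. rewrite lam_eq. pose proof ln2_pos; lra. Qed.
Lemma exp_lam n : exp (- (INR n * lam)) = / 4 ^ n.
Proof. rewrite exp_Ropp, <- exp_pow. unfold lam. rewrite exp_ln by lra. reflexivity. Qed.

Fixpoint symsum (f : R -> R) (n : nat) : R :=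
  match n with O => f 0 | S k => symsum f k + (f (INR (S k)) + f (- INR (S k))) end.

(** The ratio 1/4 is e^(-ln 4): the increments of the symmetric sums over levels decay at this rate,
    and their tails give both the limit and the speed. *)
Lemma seq_geo (s : nat -> R) A N0 : 0 <= A -> (forall n, (N0 <= n)%nat -> Rabs (s (S n) - s n) <= A * / 4 ^ S n) ->
  is_lim_seq s (real (Lim_seq s)) /\ forall n, (N0 <= n)%nat -> Rabs (s n - real (Lim_seq s)) <= A * / 4 ^ n.
Proof.
  intros HA H.
  assert (P : forall n, 0 < / 4 ^ n) by (intros; apply Rinv_0_lt_compat, pow_lt; lra).
  assert (G : forall n k, (N0 <= n)%nat -> Rabs (s n - s (n + k)%nat) <= A * (/ 4 ^ n - / 4 ^ (n + k))).
  { intros n k Hn. induction k as [|k IH].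
    - rewrite Nat.add_0_r, !Rminus_diag, Rabs_R0; lra.
    - replace (n + S k)%nat with (S (n + k)) by lia. specialize (H (n + k)%nat ltac:(lia)).
      replace (s n - s (S (n + k))) with ((s n - s (n + k)%nat) - (s (S (n + k)) - s (n + k)%nat)) by ring.
      unfold Rminus at 1. eapply Rle_trans; [apply Rabs_triang|]. rewrite Rabs_Ropp.
      assert (E : / 4 ^ (n + k) = 4 * / 4 ^ S (n + k)) by (simpl; field; apply pow_nonzero; lra).
      rewrite E in IH. specialize (P (S (n + k))). nra. }
  assert (G' : forall n k, (N0 <= n)%nat -> Rabs (s n - s (n + k)%nat) <= A * / 4 ^ n).
  { intros n k Hn. eapply Rle_trans; [now apply G|]. apply Rmult_le_compat_l; [assumption|]. specialize (P (n + k)%nat). lra. }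
  assert (L : is_lim_seq s (real (Lim_seq s))).
  { apply Lim_seq_correct', ex_lim_seq_cauchy_corr. intros eps.
    destruct (pow_small (/ 4) A (eps / 2) ltac:(lra) HA ltac:(pose proof (cond_pos eps); lra)) as [N HN].
    assert (K : forall n m, (N + N0 <= n)%nat -> (n <= m)%nat -> Rabs (s n - s m) < eps).
    { intros n m Hn Hm. replace m with (n + (m - n))%nat by lia.
      eapply Rle_lt_trans; [apply G'; lia|]. specialize (HN n ltac:(lia)). rewrite pow_inv in HN.
      pose proof (cond_pos eps). rewrite Rmult_comm. lra. }
    exists (N + N0)%nat. intros n m Hn Hm. destruct (Nat.le_ge_cases n m); [now apply K|].
    rewrite Rabs_minus_sym. now apply K. }
  split; [assumption|]. intros n Hn. apply (lim_abs_le s); [assumption|]. exists n. intros m Hm.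
  replace m with (n + (m - n))%nat by lia. now apply G'.
Qed.

(* [fluct] tends to [-1/2] at minus infinity, hence the compensation by [(n + 1) / 2]. *)
Definition PsiN (n : nat) (x : R) : R := symsum (fun r => fluct ((r - x) * lam)) n + (INR n + 1) / 2.
Definition Psi (x : R) : R := real (Lim_seq (fun n => PsiN n x)).
Definition dPsiN (n : nat) (x : R) : R := symsum (fun r => dfluct ((r - x) * lam)) n.
Definition dPsi (x : R) : R := real (Lim_seq (fun n => dPsiN n x)).

Lemma exp_shift_bound T x n : Rabs x <= T ->
  exp (- ((INR n - x) * lam)) <= exp (T * lam) * / 4 ^ n /\ exp ((- INR n - x) * lam) <= exp (T * lam) * / 4 ^ n.
Proof.
  intros Hx. rewrite <- exp_lam, <- exp_plus. pose proof lam_pos. apply Rabs_le_between in Hx.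
  split; apply exp_le_mono; nra.
Qed.

Lemma PsiN_conv T : 0 <= T -> exists A N0, 0 <= A /\ forall x, Rabs x <= T ->
  is_lim_seq (fun n => PsiN n x) (Psi x) /\ forall n, (N0 <= n)%nat -> Rabs (PsiN n x - Psi x) <= A * / 4 ^ n.
Proof.
  intros HT. destruct fluct_bound as [K [HK [Hm Hp]]]. destruct (INR_eventually_ge T) as [N0 HN0].
  pose proof lam_pos as HL. pose proof (exp_pos (T * lam)) as HE.
  exists (2 * K * exp (T * lam)), N0. split; [nra|]. intros x Hx.
  apply seq_geo; [nra|]. intros n Hn. specialize (HN0 (S n) ltac:(lia)).
  destruct (exp_shift_bound T x (S n) Hx) as [B1 B2]. apply Rabs_le_between in Hx.
  specialize (Hp ((INR (S n) - x) * lam) ltac:(apply Rmult_le_pos; lra)).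
  specialize (Hm ((- INR (S n) - x) * lam) ltac:(nra)).
  replace (PsiN (S n) x - PsiN n x) with (fluct ((INR (S n) - x) * lam) + (fluct ((- INR (S n) - x) * lam) + / 2)).
  - eapply Rle_trans; [apply Rabs_triang|].
    replace (2 * K * exp (T * lam) * / 4 ^ S n) with (K * (exp (T * lam) * / 4 ^ S n) + K * (exp (T * lam) * / 4 ^ S n)) by ring.
    apply Rplus_le_compat; (eapply Rle_trans; [eassumption|]); apply Rmult_le_compat_l; assumption.
  - unfold PsiN. cbn [symsum]. rewrite !S_INR. field.
Qed.

Lemma dPsiN_conv T : 0 <= T -> exists A N0, 0 <= A /\ forall x, Rabs x <= T ->
  forall n, (N0 <= n)%nat -> Rabs (dPsiN n x - dPsi x) <= A * / 4 ^ n.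
Proof.
  intros HT. destruct dfluct_bound as [K [HK [Hd _]]]. destruct (INR_eventually_ge T) as [N0 HN0].
  pose proof lam_pos as HL. pose proof (exp_pos (T * lam)) as HE.
  exists (2 * K * exp (T * lam)), N0. split; [nra|]. intros x Hx.
  apply seq_geo; [nra|]. intros n Hn. specialize (HN0 (S n) ltac:(lia)).
  destruct (exp_shift_bound T x (S n) Hx) as [B1 B2]. apply Rabs_le_between in Hx.
  pose proof (Hd ((INR (S n) - x) * lam)) as H1. pose proof (Hd ((- INR (S n) - x) * lam)) as H2.
  rewrite (Rabs_pos_eq ((INR (S n) - x) * lam)) in H1 by (apply Rmult_le_pos; lra).
  rewrite (Rabs_left1 ((- INR (S n) - x) * lam)), Ropp_involutive in H2 by nra.
  replace (dPsiN (S n) x - dPsiN n x) with (dfluct ((INR (S n) - x) * lam) + dfluct ((- INR (S n) - x) * lam)).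
  - eapply Rle_trans; [apply Rabs_triang|].
    replace (2 * K * exp (T * lam) * / 4 ^ S n) with (K * (exp (T * lam) * / 4 ^ S n) + K * (exp (T * lam) * / 4 ^ S n)) by ring.
    apply Rplus_le_compat; (eapply Rle_trans; [eassumption|]); apply Rmult_le_compat_l; assumption.
  - unfold dPsiN. cbn [symsum]. ring.
Qed.

Lemma symsum_continuous (f : R -> R -> R) n x : (forall r, continuous (f r) x) ->
  continuous (fun x => symsum (fun r => f r x) n) x.
Proof.
  intros H. induction n as [|n IH]; cbn [symsum]; [apply H|].
  apply (continuous_plus (fun x => symsum (fun r => f r x) n) (fun x => f (INR (S n)) x + f (- INR (S n)) x)); [apply IH|].
  apply (continuous_plus (f (INR (S n))) (f (- INR (S n)))); apply H.
Qed.

Lemma symsum_derive (f df : R -> R -> R) n x : (forall r, is_derive (f r) x (df r x)) ->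
  is_derive (fun x => symsum (fun r => f r x) n) x (symsum (fun r => df r x) n).
Proof.
  intros H. induction n as [|n IH]; cbn [symsum]; [apply H|].
  apply (is_derive_plus (fun x => symsum (fun r => f r x) n) (fun x => f (INR (S n)) x + f (- INR (S n)) x)); [apply IH|].
  apply (is_derive_plus (f (INR (S n))) (f (- INR (S n)))); apply H.
Qed.

Lemma symsum_scal c f n : symsum (fun r => c * f r) n = c * symsum f n.
Proof. induction n as [|n IH]; cbn [symsum]; [reflexivity|]. rewrite IH. ring. Qed.

Lemma lin_continuous r x : continuous (fun x => (r - x) * lam) x.
Proof. apply (ex_derive_continuous (fun x => (r - x) * lam)). auto_derive; trivial. Qed.

Lemma dPsiN_continuous n x : continuous (dPsiN n) x.
Proof.
  apply (symsum_continuous (fun r x => dfluct ((r - x) * lam))). intros r.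
  apply (continuous_comp (fun x => (r - x) * lam) dfluct); [apply lin_continuous|apply dfluct_continuous].
Qed.

Lemma PsiN_derive n x : is_derive (PsiN n) x (- lam * dPsiN n x).
Proof.
  unfold PsiN. rewrite <- (Rplus_0_r (- lam * dPsiN n x)).
  apply (is_derive_plus (fun x => symsum (fun r => fluct ((r - x) * lam)) n) (fun _ => (INR n + 1) / 2)); [|auto_derive; trivial].
  unfold dPsiN. rewrite <- symsum_scal.
  apply (symsum_derive (fun r x => fluct ((r - x) * lam)) (fun r x => - lam * dfluct ((r - x) * lam))). intros r.
  apply (is_derive_comp fluct (fun x => (r - x) * lam)); [apply fluct_derive|]. auto_derive; [trivial|ring].
Qed.

Lemma inv4_small A eps : 0 <= A -> 0 < eps -> exists N, forall n, (N <= n)%nat -> A * / 4 ^ n <= eps.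
Proof.
  intros HA He. destruct (pow_small (/ 4) A eps ltac:(lra) HA He) as [N HN]. exists N. intros n Hn.
  specialize (HN n Hn). rewrite pow_inv in HN. lra.
Qed.

Lemma Psi_derive x : is_derive Psi x (- lam * dPsi x).
Proof.
  apply (lim_derive PsiN (fun n x => - lam * dPsiN n x) Psi (fun x => - lam * dPsi x) (Rabs x + 1)); [| | | |lra].
  - apply PsiN_derive.
  - intros n y. apply (continuous_scal_r (- lam) (dPsiN n)), dPsiN_continuous.
  - intros y Hy. destruct (PsiN_conv (Rabs x + 1)) as [A [N0 [HA H]]]; [pose proof (Rabs_pos x); lra|].
    apply H; lra.
  - intros eps He. destruct (dPsiN_conv (Rabs x + 1)) as [A [N0 [HA H]]]; [pose proof (Rabs_pos x); lra|].
    pose proof lam_pos.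
    destruct (inv4_small (lam * A) eps ltac:(nra) He) as [N HN]. exists (N + N0)%nat. intros n Hn y Hy.
    replace (- lam * dPsiN n y - - lam * dPsi y) with (- lam * (dPsiN n y - dPsi y)) by ring.
    rewrite Rabs_mult, Rabs_Ropp, (Rabs_pos_eq lam) by lra.
    eapply Rle_trans; [|apply (HN n ltac:(lia))]. rewrite Rmult_assoc. apply Rmult_le_compat_l; [lra|]. apply H; [lra|lia].
Qed.

Lemma dPsi_continuous x : continuous dPsi x.
Proof.
  apply (lim_unif_continuous dPsiN dPsi (Rabs x + 1)); [apply dPsiN_continuous| |lra].
  intros eps He. destruct (dPsiN_conv (Rabs x + 1)) as [A [N0 [HA H]]]; [pose proof (Rabs_pos x); lra|].
  destruct (inv4_small A eps HA He) as [N HN]. exists (N + N0)%nat. intros n Hn y Hy.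
  eapply Rle_trans; [|apply (HN n ltac:(lia))]. apply H; [lra|lia].
Qed.

Lemma symsum_shift f n : symsum (fun r => f (r - 1)) n = symsum f n - f (INR n) + f (- (INR n + 1)).
Proof.
  induction n as [|n IH]; cbn [symsum].
  - simpl INR. replace (0 - 1) with (- (0 + 1)) by ring. ring.
  - rewrite IH, !S_INR. replace (INR n + 1 - 1) with (INR n) by ring.
    replace (- (INR n + 1) - 1) with (- (INR n + 1 + 1)) by ring. ring.
Qed.

Lemma symsum_ext f g n : (forall r, f r = g r) -> symsum f n = symsum g n.
Proof. intros H. induction n as [|n IH]; cbn [symsum]; [apply H|]. now rewrite IH, !H. Qed.

Lemma fluct_lim_p x : is_lim_seq (fun n => fluct ((INR n - x) * lam)) 0.
Proof.
  destruct fluct_bound as [K [HK [_ Hp]]]. pose proof lam_pos. apply is_lim_seq_eps. intros eps He.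
  destruct (INR_eventually_ge (Rabs x)) as [N1 H1].
  destruct (inv4_small (K * exp (Rabs x * lam)) eps) as [N2 H2]; [pose proof (exp_pos (Rabs x * lam)); nra|assumption|].
  exists (N1 + N2)%nat. intros n Hn. specialize (H1 n ltac:(lia)). specialize (H2 n ltac:(lia)).
  rewrite Rminus_0_r. pose proof (Rle_abs x).
  destruct (exp_shift_bound (Rabs x) x n (Rle_refl _)) as [B _].
  eapply Rle_trans; [apply Hp; apply Rmult_le_pos; lra|].
  eapply Rle_trans; [|apply H2]. rewrite Rmult_assoc. now apply Rmult_le_compat_l.
Qed.

Lemma fluct_lim_m x : is_lim_seq (fun n => fluct ((- INR n - x) * lam)) (- / 2).
Proof.
  destruct fluct_bound as [K [HK [Hm _]]]. pose proof lam_pos. apply is_lim_seq_eps. intros eps He.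
  destruct (INR_eventually_ge (Rabs x)) as [N1 H1].
  destruct (inv4_small (K * exp (Rabs x * lam)) eps) as [N2 H2]; [pose proof (exp_pos (Rabs x * lam)); nra|assumption|].
  exists (N1 + N2)%nat. intros n Hn. specialize (H1 n ltac:(lia)). specialize (H2 n ltac:(lia)).
  replace (fluct ((- INR n - x) * lam) - - / 2) with (fluct ((- INR n - x) * lam) + / 2) by ring.
  pose proof (Rle_abs (- x)) as Ha. rewrite Rabs_Ropp in Ha.
  destruct (exp_shift_bound (Rabs x) x n (Rle_refl _)) as [_ B].
  eapply Rle_trans; [apply Hm; nra|].
  eapply Rle_trans; [|apply H2]. rewrite Rmult_assoc. now apply Rmult_le_compat_l.
Qed.

Lemma Psi_lim x : is_lim_seq (fun n => PsiN n x) (Psi x).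
Proof. destruct (PsiN_conv (Rabs x) (Rabs_pos x)) as [A [N0 [_ H]]]. apply H; lra. Qed.

(** Moving the window of levels by one drops a term that tends to 0 at the top and adds one that
    tends to -1/2 at the bottom. Hence x/2 has to be added to obtain a periodic function, and with
    the factor -1/3 this is the origin of (1/6) log_4 n. *)
Lemma Psi_shift x : Psi (x + 1) = Psi x - / 2.
Proof.
  assert (E : forall n, PsiN n (x + 1) = PsiN n x - fluct ((INR n - x) * lam) + fluct ((- INR (S n) - x) * lam)).
  { intros n. unfold PsiN. rewrite (symsum_ext _ (fun r => (fun r => fluct ((r - x) * lam)) (r - 1))).
    - rewrite (symsum_shift (fun r => fluct ((r - x) * lam))), S_INR. ring.
    - intros r. cbv beta. f_equal. ring. }
  assert (L : is_lim_seq (fun n => PsiN n (x + 1)) (Psi x - 0 + - / 2)).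
  { eapply is_lim_seq_ext; [intros n; symmetry; apply E|].
    apply is_lim_seq_plus'; [apply is_lim_seq_minus'; [apply Psi_lim|apply fluct_lim_p]|].
    apply (is_lim_seq_incr_1 (fun n => fluct ((- INR n - x) * lam))), fluct_lim_m. }
  apply is_lim_seq_unique in L. unfold Psi at 1. rewrite L. simpl. ring.
Qed.

(** * Mean value and Fourier coefficients of the periodic function *)

Definition pfun (x : R) : R := Psi x + x / 2.

Lemma pfun_period x : pfun (x + 1) = pfun x.
Proof. unfold pfun. rewrite Psi_shift. field. Qed.

Lemma pfun_derive x : is_derive pfun x (- lam * dPsi x + / 2).
Proof.
  apply (is_derive_plus Psi (fun x => x / 2)); [apply Psi_derive|]. auto_derive; [trivial|field].
Qed.

Lemma pfun_continuous x : continuous pfun x.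
Proof. apply (cont_of_derive _ _ pfun_derive). Qed.
Lemma Psi_continuous x : continuous Psi x.
Proof. apply (cont_of_derive _ _ Psi_derive). Qed.
Lemma PsiN_continuous n x : continuous (PsiN n) x.
Proof. apply (cont_of_derive _ _ (PsiN_derive n)). Qed.

Lemma RInt_unfold_1 (F : R -> R) r : (forall w, continuous F w) ->
  lam * RInt (fun s => F ((r - s) * lam)) 0 1 = RInt F ((r - 1) * lam) (r * lam).
Proof.
  intros HF. pose proof lam_pos.
  assert (H1 : is_RInt (fun s => scal (- lam) (F (- lam * s + r * lam))) 0 1 (RInt F (r * lam) ((r - 1) * lam))).
  { apply (is_RInt_comp_lin F (- lam) (r * lam)).
    replace (- lam * 0 + r * lam) with (r * lam) by ring. replace (- lam * 1 + r * lam) with ((r - 1) * lam) by ring.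
    apply (@RInt_correct R_CompleteNormedModule), cont_ex_RInt, HF. }
  apply (@is_RInt_scal R_NormedModule _ _ _ (/ - lam)) in H1.
  rewrite (is_RInt_unique (fun s => F ((r - s) * lam)) 0 1 (scal (/ - lam) (RInt F (r * lam) ((r - 1) * lam)))).
  - rewrite <- (opp_RInt_swap F (r * lam) ((r - 1) * lam)) by now apply cont_ex_RInt.
    unfold scal, opp; simpl; unfold mult; simpl. field. lra.
  - eapply is_RInt_ext_R; [|apply H1]. intros s. unfold scal; simpl; unfold mult; simpl.
    replace (- lam * s + r * lam) with ((r - s) * lam) by ring. field. lra.
Qed.

(** As s runs through [0,1], level r covers [(r-1) ln 4, r ln 4], so the levels from -n to n tile an
    interval that reaches one step further to the left. *)
Lemma RInt_unfold (F : R -> R) n : (forall w, continuous F w) ->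
  symsum (fun r => lam * RInt (fun s => F ((r - s) * lam)) 0 1) n = RInt F (- ((INR n + 1) * lam)) (INR n * lam).
Proof.
  intros HF. assert (E : forall a b, ex_RInt F a b) by (intros; now apply cont_ex_RInt).
  induction n as [|n IH]; cbn [symsum].
  - rewrite RInt_unfold_1 by assumption. simpl INR. replace (- ((0 + 1) * lam)) with ((0 - 1) * lam) by ring. reflexivity.
  - rewrite IH, !RInt_unfold_1 by assumption.
    rewrite <- (RInt_Chasles F (- ((INR (S n) + 1) * lam)) (- ((INR n + 1) * lam)) (INR (S n) * lam)),
       <- (RInt_Chasles F (- ((INR n + 1) * lam)) (INR n * lam) (INR (S n) * lam)) by apply E.
    rewrite !S_INR.
    replace ((INR n + 1 - 1) * lam) with (INR n * lam) by ring.
    replace ((- (INR n + 1) - 1) * lam) with (- ((INR n + 1 + 1) * lam)) by ring.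
    replace (- (INR n + 1) * lam) with (- ((INR n + 1) * lam)) by ring.
    unfold plus; simpl. match goal with |- @eq _ ?a ?b => change (@eq R a b) end. ring.
Qed.

Lemma symsum_is_RInt (f : R -> R -> R) n a b : (forall r x, continuous (f r) x) ->
  is_RInt (fun x => symsum (fun r => f r x) n) a b (symsum (fun r => RInt (f r) a b) n).
Proof.
  intros H. assert (E : forall r, is_RInt (f r) a b (RInt (f r) a b)).
  { intros r. apply (@RInt_correct R_CompleteNormedModule), cont_ex_RInt, H. }
  induction n as [|n IH]; cbn [symsum]; [apply E|].
  apply (is_RInt_plus_R (fun x => symsum (fun r => f r x) n) (fun x => f (INR (S n)) x + f (- INR (S n)) x)); [apply IH|].
  apply is_RInt_plus_R; apply E.
Qed.

Lemma RIntR_lim_lam K F : dom K F -> is_lim_seq (fun n => RInt F (- ((INR n + 1) * lam)) (INR n * lam)) (RIntR F).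
Proof.
  intros HF. pose proof lam_pos as HL. apply (RIntR_lim_gen K F (fun n => (INR n + 1) * lam) (fun n => INR n * lam) HF).
  - intros T. destruct (INR_eventually_ge (T / lam)) as [N HN]. exists N. intros n Hn. specialize (HN n Hn).
    apply (Rmult_le_compat_r lam) in HN; [|lra]. replace (T / lam * lam) with T in HN by (field; lra). lra.
  - intros T. destruct (INR_eventually_ge (T / lam)) as [N HN]. exists N. intros n Hn. specialize (HN n Hn).
    apply (Rmult_le_compat_r lam) in HN; [|lra]. replace (T / lam * lam) with T in HN by (field; lra). lra.
Qed.

Lemma RInt_lim_unif (fn : nat -> R -> R) (f : R -> R) : (forall n x, continuous (fn n) x) -> (forall x, continuous f x) ->
  (forall eps, 0 < eps -> exists N, forall n, (N <= n)%nat -> forall x, 0 <= x <= 1 -> Rabs (fn n x - f x) <= eps) ->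
  is_lim_seq (fun n => RInt (fn n) 0 1) (RInt f 0 1).
Proof.
  intros Hn Hf Hu. apply is_lim_seq_eps. intros eps He. destruct (Hu eps He) as [N HN]. exists N. intros n Hn'.
  assert (E : RInt (fn n) 0 1 - RInt f 0 1 = RInt (fun x => fn n x - f x) 0 1).
  { symmetry. apply is_RInt_unique. apply (@is_RInt_minus R_NormedModule); apply (@RInt_correct R_CompleteNormedModule), cont_ex_RInt; [apply Hn|apply Hf]. }
  rewrite E. replace eps with ((1 - 0) * eps) by ring. apply RInt_const_le; [lra| |now apply HN].
  intros x. apply (continuous_minus (fn n) f); [apply Hn|apply Hf].
Qed.

Lemma is_RInt_const_01 (c : R) : is_RInt (fun _ => c) 0 1 c.
Proof.
  pose proof (@is_RInt_const R_NormedModule 0 1 c) as H.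
  refine (eq_ind _ (fun v => is_RInt (fun _ => c) 0 1 v) H c _).
  unfold scal; simpl; unfold mult; simpl. ring.
Qed.

Lemma INR_le_pow2 n : INR n <= 2 ^ n.
Proof.
  induction n as [|n IH]; [simpl; lra|]. rewrite S_INR. simpl. assert (1 <= 2 ^ n) by (apply pow_R1_Rle; lra). lra.
Qed.

Lemma dfluct_id_dom : exists K, dom K (fun w => dfluct w * w).
Proof.
  destruct dom1_dfluct as [K HK]. exists (K * 2).
  apply (dom_of_dom1 K dfluct (fun y => y) 2); [assumption|intros; apply continuous_id|apply Rabs_le_half_exp].
Qed.

Lemma fluct_moment_lim : is_lim_seq (fun n => INR n * fluct (INR n * lam) + (INR n + 1) * (fluct (- ((INR n + 1) * lam)) + / 2)) 0.
Proof.
  destruct fluct_bound as [K [HK [Hm Hp]]]. pose proof lam_pos as HL. apply is_lim_seq_eps. intros eps He.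
  destruct (pow_small (/ 2) (3 * K) eps ltac:(lra) ltac:(lra) He) as [N HN]. exists N. intros n Hn.
  specialize (HN n Hn). rewrite Rminus_0_r. pose proof (pos_INR n) as Pn.
  specialize (Hp (INR n * lam) ltac:(nra)). rewrite exp_lam in Hp.
  specialize (Hm (- ((INR n + 1) * lam)) ltac:(nra)). rewrite <- S_INR, exp_lam, S_INR in Hm.
  eapply Rle_trans; [apply Rabs_triang|]. rewrite !Rabs_mult, (Rabs_pos_eq (INR n)), (Rabs_pos_eq (INR n + 1)) by lra.
  pose proof (INR_le_pow2 n) as P2. assert (H2 : 0 < 2 ^ n) by (apply pow_lt; lra).
  assert (E4 : / 4 ^ n = / 2 ^ n * / 2 ^ n).
  { replace 4 with (2 * 2) by ring. rewrite Rpow_mult_distr. field. lra. }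
  assert (Hi : 0 < / 2 ^ n) by now apply Rinv_0_lt_compat.
  assert (Q : INR n * / 4 ^ n <= / 2 ^ n).
  { rewrite E4, <- Rmult_assoc. rewrite <- (Rmult_1_l (/ 2 ^ n)) at 3. apply Rmult_le_compat_r; [lra|].
    apply (Rmult_le_reg_r (2 ^ n)); [assumption|]. rewrite Rmult_assoc, Rinv_l by lra. lra. }
  assert (Q1 : / 4 ^ n <= / 2 ^ n).
  { rewrite E4. rewrite <- (Rmult_1_l (/ 2 ^ n)) at 3. apply Rmult_le_compat_r; [lra|].
    rewrite <- Rinv_1. apply Rinv_le_contravar; [lra|]. apply pow_R1_Rle; lra. }
  assert (Q2 : / 4 ^ S n <= / 4 ^ n).
  { apply Rinv_le_contravar; [apply pow_lt; lra|]. apply Rle_pow; [lra|lia]. }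
  assert (B1 : INR n * Rabs (fluct (INR n * lam)) <= K * / 2 ^ n).
  { apply Rle_trans with (INR n * (K * / 4 ^ n)); [now apply Rmult_le_compat_l|].
    replace (INR n * (K * / 4 ^ n)) with (K * (INR n * / 4 ^ n)) by ring. now apply Rmult_le_compat_l. }
  assert (B2 : (INR n + 1) * Rabs (fluct (- ((INR n + 1) * lam)) + / 2) <= 2 * K * / 2 ^ n).
  { apply Rle_trans with ((INR n + 1) * (K * / 4 ^ n)).
    - apply Rmult_le_compat_l; [lra|]. eapply Rle_trans; [apply Hm|]. now apply Rmult_le_compat_l.
    - replace ((INR n + 1) * (K * / 4 ^ n)) with (K * (INR n * / 4 ^ n + / 4 ^ n)) by ring.
      replace (2 * K * / 2 ^ n) with (K * (/ 2 ^ n + / 2 ^ n)) by ring. apply Rmult_le_compat_l; lra. }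
  rewrite pow_inv in HN. lra.
Qed.

(** [fluct] is not integrable at minus infinity, so the unfolded integral is integrated by parts.
    The boundary term (n+1) [fluct] at the left end tends to cancel the compensation (n+1)/2,
    because the approach to -1/2 is exponential, and only the first moment of [dfluct] survives. *)
Lemma Psi_mean : RInt Psi 0 1 = - / lam * RIntR (fun w => dfluct w * w).
Proof.
  pose proof lam_pos as HL. destruct dfluct_id_dom as [K HK].
  assert (L1 : is_lim_seq (fun n => RInt (PsiN n) 0 1) (RInt Psi 0 1)).
  { apply RInt_lim_unif; [apply PsiN_continuous|apply Psi_continuous|]. intros eps He.
    destruct (PsiN_conv 1 ltac:(lra)) as [A [N0 [HA H]]]. destruct (inv4_small A eps HA He) as [N HN].
    exists (N + N0)%nat. intros n Hn x Hx. eapply Rle_trans; [|apply (HN n ltac:(lia))].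
    apply H; [apply Rabs_le; lra|lia]. }
  assert (Ca : forall r x, continuous (fun x => fluct ((r - x) * lam)) x).
  { intros r x. apply (continuous_comp (fun x => (r - x) * lam) fluct); [apply lin_continuous|apply fluct_continuous]. }
  assert (E : forall n, RInt (PsiN n) 0 1 = (INR n * fluct (INR n * lam) + (INR n + 1) * (fluct (- ((INR n + 1) * lam)) + / 2))
     + - / lam * RInt (fun w => dfluct w * w) (- ((INR n + 1) * lam)) (INR n * lam)).
  { intros n.
    assert (E1 : RInt (PsiN n) 0 1 = symsum (fun r => RInt (fun x => fluct ((r - x) * lam)) 0 1) n + (INR n + 1) / 2).
    { apply is_RInt_unique. apply is_RInt_plus_R.
      - apply (symsum_is_RInt (fun r x => fluct ((r - x) * lam))), Ca.
      - apply is_RInt_const_01. }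
    assert (E2 : symsum (fun r => RInt (fun x => fluct ((r - x) * lam)) 0 1) n = / lam * RInt fluct (- ((INR n + 1) * lam)) (INR n * lam)).
    { rewrite <- RInt_unfold by apply fluct_continuous. rewrite symsum_scal. field. lra. }
    assert (E3 : RInt fluct (- ((INR n + 1) * lam)) (INR n * lam) + RInt (fun w => dfluct w * w) (- ((INR n + 1) * lam)) (INR n * lam)
       = fluct (INR n * lam) * (INR n * lam) - fluct (- ((INR n + 1) * lam)) * (- ((INR n + 1) * lam))).
    { assert (D : is_RInt (fun w => fluct w + dfluct w * w) (- ((INR n + 1) * lam)) (INR n * lam)
        (minus (fluct (INR n * lam) * (INR n * lam)) (fluct (- ((INR n + 1) * lam)) * (- ((INR n + 1) * lam))))).
      { apply (is_RInt_derive (fun w => fluct w * w)).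
        - intros w _. replace (fluct w + dfluct w * w) with (dfluct w * w + fluct w * 1) by ring.
          apply (is_derive_mult fluct (fun w => w)); [apply fluct_derive|auto_derive; trivial|intros; apply Rmult_comm].
        - intros w _. apply (continuous_plus fluct (fun w => dfluct w * w)); [apply fluct_continuous|apply HK]. }
      apply (@is_RInt_unique R_CompleteNormedModule) in D. change (minus (fluct (INR n * lam) * (INR n * lam)) (fluct (- ((INR n + 1) * lam)) * (- ((INR n + 1) * lam))))
        with (fluct (INR n * lam) * (INR n * lam) - fluct (- ((INR n + 1) * lam)) * (- ((INR n + 1) * lam))) in D.
      rewrite <- D. symmetry. apply is_RInt_unique. apply is_RInt_plus_R; apply (@RInt_correct R_CompleteNormedModule), cont_ex_RInt; [apply fluct_continuous|apply HK]. }
    rewrite E1, E2. replace (RInt fluct (- ((INR n + 1) * lam)) (INR n * lam)) with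
      (fluct (INR n * lam) * (INR n * lam) - fluct (- ((INR n + 1) * lam)) * (- ((INR n + 1) * lam)) - RInt (fun w => dfluct w * w) (- ((INR n + 1) * lam)) (INR n * lam)) by lra.
    match goal with |- @eq _ ?a ?b => change (@eq R a b) end. field. lra. }
  assert (L2 : is_lim_seq (fun n => RInt (PsiN n) 0 1) (0 + - / lam * RIntR (fun w => dfluct w * w))).
  { eapply is_lim_seq_ext; [intros n; symmetry; apply E|].
    apply is_lim_seq_plus'; [apply fluct_moment_lim|].
    apply (is_lim_seq_scal_l (fun n => RInt (fun w => dfluct w * w) (- ((INR n + 1) * lam)) (INR n * lam)) (- / lam) (RIntR (fun w => dfluct w * w))).
    apply (RIntR_lim_lam K), HK. }
  apply is_lim_seq_unique in L1, L2. rewrite L1 in L2. injection L2. lra.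
Qed.

Lemma pfun_mean : RInt pfun 0 1 = - / lam * RIntR (fun w => dfluct w * w) + / 4.
Proof.
  rewrite <- Psi_mean. apply is_RInt_unique. apply is_RInt_plus_R.
  - apply (@RInt_correct R_CompleteNormedModule), cont_ex_RInt, Psi_continuous.
  - replace (/ 4) with (minus (1 * 1 / 4) (0 * 0 / 4) : R) by (unfold minus, plus, opp; simpl; field).
    apply (is_RInt_derive (fun x => x * x / 4)).
    + intros x _. auto_derive; [trivial|field].
    + intros x _. apply (ex_derive_continuous (fun x => x / 2)). auto_derive; trivial.
Qed.

Lemma sin_shift_Z a k : sin (a + 2 * PI * IZR k) = sin a.
Proof. rewrite sin_plus, cos_2kPI, sin_2kPI. ring. Qed.

(** Integration by parts passes to the derivative 1/2 - lam [dPsi], and unfolding the sum over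
    levels gives an integral over the line at frequency 2 pi k / ln 4 = pi k / ln 2. The indices k
    and -k are combined into one real term. *)
Lemma pfun_coef x m : let k := Z.of_nat (S m) in let t := PI * IZR k / ln 2 in let L := laplace dfluct (0, t) in
  2 * RInt (fun s => pfun s * cos (2 * PI * INR (S m) * (x - s))) 0 1 =
  - / (PI * IZR k) * (sin (2 * PI * IZR k * x) * Re L + cos (2 * PI * IZR k * x) * Im L).
Proof.
  intros k t L. pose proof lam_pos as HL. pose proof PI_RGT_0 as HPI. pose proof ln2_pos as H2.
  assert (Hk : INR (S m) = IZR k) by (unfold k; apply INR_IZR_INZ). rewrite Hk.
  assert (Pk : 0 < IZR k) by (rewrite <- Hk; apply lt_0_INR; lia).
  set (c := 2 * PI * IZR k). assert (Hc : 0 < c) by (unfold c; apply Rmult_lt_0_compat; lra).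
  destruct dom1_dfluct as [K HK]. assert (H0 : Rabs 0 <= / 4) by (rewrite Rabs_R0; lra).
  pose proof (dom_wcos K dfluct 0 t H0 HK) as Dc. pose proof (dom_wsin K dfluct 0 t H0 HK) as Ds.
  pose (F := fun w => sin (c * x) * (dfluct w * wcos 0 t w) + cos (c * x) * (dfluct w * wsin 0 t w)).
  assert (DF := dom_plus _ _ _ _ (dom_scal (sin (c * x)) _ _ Dc) (dom_scal (cos (c * x)) _ _ Ds)). fold F in DF.
  assert (EF : RIntR F = sin (c * x) * Re L + cos (c * x) * Im L).
  { unfold F. rewrite (RIntR_plus _ _ _ _ (dom_scal (sin (c * x)) _ _ Dc) (dom_scal (cos (c * x)) _ _ Ds)),
      (RIntR_scal _ _ _ Dc), (RIntR_scal _ _ _ Ds). reflexivity. }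
  assert (F_eq : forall w, F w = dfluct w * sin (c * x + t * w)).
  { intros w. unfold F, wcos, wsin. rewrite Rmult_0_l, exp_0, sin_plus. ring. }
  assert (CS : forall s, continuous (fun s => sin (c * (x - s))) s).
  { intros s. apply (ex_derive_continuous (fun s => sin (c * (x - s)))). auto_derive; trivial. }
  (* At this frequency a shift by an integer number j of levels changes the phase by 2 pi k j, so
     the sine is common to all levels and factors out of the sum. *)
  assert (Sr : forall j s, F ((IZR j - s) * lam) = dfluct ((IZR j - s) * lam) * sin (c * (x - s))).
  { intros j s. rewrite F_eq. f_equal. rewrite <- (sin_shift_Z (c * (x - s)) (k * j)).
    f_equal. rewrite mult_IZR. unfold c, t. rewrite lam_eq. field. lra. }
  assert (SS : forall n s, symsum (fun r => F ((r - s) * lam)) n = dPsiN n s * sin (c * (x - s))).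
  { intros n s. unfold dPsiN. induction n as [|n IH]; cbn [symsum]; [apply (Sr 0%Z)|].
    rewrite IH, INR_IZR_INZ, <- opp_IZR, !Sr. ring. }
  assert (CF : forall r s, continuous (fun s => F ((r - s) * lam)) s).
  { intros r s. apply (continuous_comp (fun s => (r - s) * lam) F); [apply lin_continuous|apply DF]. }
  assert (L1 : is_lim_seq (fun n => RInt (fun s => dPsiN n s * sin (c * (x - s))) 0 1) (RInt (fun s => dPsi s * sin (c * (x - s))) 0 1)).
  { apply RInt_lim_unif.
    - intros n s. apply cont_mult; [apply dPsiN_continuous|apply CS].
    - intros s. apply cont_mult; [apply dPsi_continuous|apply CS].
    - intros eps He. destruct (dPsiN_conv 1 ltac:(lra)) as [A [N0 [HA H]]]. destruct (inv4_small A eps HA He) as [N HN].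
      exists (N + N0)%nat. intros n Hn s Hs. rewrite <- Rmult_minus_distr_r, Rabs_mult.
      specialize (H s ltac:(apply Rabs_le; lra) n ltac:(lia)). specialize (HN n ltac:(lia)).
      pose proof (Rabs_sin_le (c * (x - s))). pose proof (Rabs_pos (sin (c * (x - s)))). pose proof (Rabs_pos (dPsiN n s - dPsi s)). nra. }
  assert (L2 : is_lim_seq (fun n => RInt (fun s => dPsiN n s * sin (c * (x - s))) 0 1) (/ lam * RIntR F)).
  { eapply is_lim_seq_ext; [|apply (is_lim_seq_scal_l (fun n => RInt F (- ((INR n + 1) * lam)) (INR n * lam)) (/ lam) (RIntR F)), (RIntR_lim_lam _ _ DF)].
    intros n. cbv beta. rewrite <- (RInt_unfold F n) by apply DF. rewrite symsum_scal.
    rewrite <- Rmult_assoc, Rinv_l, Rmult_1_l by lra.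
    symmetry. apply is_RInt_unique. eapply is_RInt_ext_R; [|apply (symsum_is_RInt (fun r s => F ((r - s) * lam)) n 0 1 CF)].
    intros s. cbv beta. apply SS. }
  assert (ED : RInt (fun s => dPsi s * sin (c * (x - s))) 0 1 = / lam * RIntR F).
  { apply is_lim_seq_unique in L1, L2. rewrite L1 in L2. now injection L2. }
  assert (IP : is_RInt (fun s => (- lam * dPsi s + / 2) * (- / c * sin (c * (x - s))) + pfun s * cos (c * (x - s))) 0 1 0).
  { replace 0 with (minus (pfun 1 * (- / c * sin (c * (x - 1)))) (pfun 0 * (- / c * sin (c * (x - 0)))) : R) at 2.
    - apply (is_RInt_derive (fun s => pfun s * (- / c * sin (c * (x - s))))).
      + intros s _. apply (is_derive_mult pfun (fun s => - / c * sin (c * (x - s)))); [apply pfun_derive| |intros; apply Rmult_comm].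
        auto_derive; [trivial|]. unfold Rminus. field. lra.
      + intros s _. apply (continuous_plus (fun s => (- lam * dPsi s + / 2) * (- / c * sin (c * (x - s)))) (fun s => pfun s * cos (c * (x - s)))).
        * apply cont_mult.
          -- apply (continuous_plus (fun s => - lam * dPsi s) (fun _ => / 2)); [|apply continuous_const].
             apply (continuous_scal_r (- lam) dPsi), dPsi_continuous.
          -- apply (continuous_scal_r (- / c) (fun s => sin (c * (x - s)))), CS.
        * apply cont_mult; [apply pfun_continuous|]. apply (ex_derive_continuous (fun s => cos (c * (x - s)))). auto_derive; trivial.
    - unfold minus, plus, opp; simpl.
      replace 1 with (0 + 1) at 1 by ring. rewrite pfun_period.
      replace (sin (c * (x - 0))) with (sin (c * (x - 1))); [ring|].
      rewrite <- (sin_shift_Z (c * (x - 1)) k). f_equal. unfold c. ring. }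
  assert (I1 : is_RInt (fun s => / 2 * (- / c * sin (c * (x - s)))) 0 1 0).
  { replace 0 with (minus (/ 2 * (- / c * (/ c * cos (c * (x - 1))))) (/ 2 * (- / c * (/ c * cos (c * (x - 0))))) : R) at 2.
    - apply (is_RInt_derive (fun s => / 2 * (- / c * (/ c * cos (c * (x - s)))))).
      + intros s _. auto_derive; [trivial|]. unfold Rminus. field. lra.
      + intros s _. apply (continuous_scal_r (/ 2) (fun s => - / c * sin (c * (x - s)))), (continuous_scal_r (- / c) (fun s => sin (c * (x - s)))), CS.
    - unfold minus, plus, opp; simpl. replace (cos (c * (x - 0))) with (cos (c * (x - 1))); [ring|].
      replace (c * (x - 0)) with (c * (x - 1) + 2 * PI * IZR k) by (unfold c; ring).
      rewrite cos_plus, cos_2kPI, sin_2kPI. ring. }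
  assert (I2 : is_RInt (fun s => lam * / c * (dPsi s * sin (c * (x - s)))) 0 1 (lam * / c * (/ lam * RIntR F))).
  { rewrite <- ED. apply (@is_RInt_scal R_NormedModule). apply (@RInt_correct R_CompleteNormedModule), cont_ex_RInt.
    intros s. apply cont_mult; [apply dPsi_continuous|apply CS]. }
  assert (I3 : is_RInt (fun s => pfun s * cos (c * (x - s))) 0 1 (0 - (0 + lam * / c * (/ lam * RIntR F)))).
  { pose proof (@is_RInt_minus R_NormedModule _ _ _ _ _ _ IP (is_RInt_plus_R _ _ _ _ _ _ I1 I2)) as H.
    eapply is_RInt_ext_R; [|exact H]. intros s. unfold minus, plus, opp; simpl plus; simpl opp. cbv beta.
    match goal with |- @eq _ ?a ?b => change (@eq R a b) end. simpl. field. lra. }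
  rewrite (is_RInt_unique _ _ _ _ I3), EF.
  match goal with |- @eq _ ?a ?b => change (@eq R a b) end. unfold c. field. lra.
Qed.

(** * Identification of [delta] with the periodic fluctuation *)

Lemma laplace_conj K g t : dom1 K g -> laplace g (0, - t) = (Re (laplace g (0, t)), - Im (laplace g (0, t))).
Proof.
  intros Hg. assert (H0 : Rabs 0 <= / 4) by (rewrite Rabs_R0; lra).
  pose proof (dom_wsin K g 0 t H0 Hg) as Ds.
  unfold laplace, Re, Im; cbn [fst snd]. f_equal.
  - apply RIntR_ext. intros w. unfold wcos. replace (- t * w) with (- (t * w)) by ring. now rewrite cos_neg.
  - replace (- RIntR (fun w => g w * wsin 0 t w)) with (-1 * RIntR (fun w => g w * wsin 0 t w)) by ring.
    rewrite <- (RIntR_scal _ _ _ Ds). apply RIntR_ext. intros w. unfold wsin.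
    replace (- t * w) with (- (t * w)) by ring. rewrite sin_neg. ring.
Qed.

(** The terms for k and -k are complex conjugates because [dfluct] is real; their sum is -(ln 2)/3
    times the m-th real Fourier term of [pfun]. Hence [delta] is real and equals -1/3 of [pfun]
    minus its mean. *)
Lemma delta_pair x m :
  (delta_term x (Z.of_nat (S m)) + delta_term x (- Z.of_nat (S m)))%C =
  RtoC (- ln 2 / 3 * (2 * RInt (fun s => pfun s * cos (2 * PI * INR (S m) * (x - s))) 0 1)).
Proof.
  rewrite pfun_coef. set (k := Z.of_nat (S m)). set (t := PI * IZR k / ln 2).
  pose proof ln2_pos as H2. pose proof PI_RGT_0 as HP. destruct dom1_dfluct as [K HK].
  assert (Hk : 0 < IZR k) by (apply (IZR_lt 0); unfold k; lia).
  assert (Ht : 0 < t) by (unfold t; apply Rdiv_lt_0_compat; nra).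
  rewrite !delta_term_eq by (unfold k; lia).
  assert (E1 : half_chi k = (0, t)) by reflexivity.
  assert (E2 : half_chi (- k) = (0, - t)) by (unfold half_chi; rewrite opp_IZR; f_equal; unfold t, Rdiv; ring).
  rewrite E1, E2, (laplace_conj K) by assumption.
  destruct (laplace dfluct (0, t)) as [a b]. set (th := 2 * PI * IZR k * x).
  replace (2 * PI * IZR (- k) * x) with (- th) by (unfold th; rewrite opp_IZR; ring).
  unfold Cexp, Re, Im; cbn [fst snd]. rewrite exp_0, cos_neg, sin_neg, !Rmult_1_l.
  replace (PI * IZR k) with (t * ln 2) by (unfold t; field; lra).
  unfold RtoC, Cdiv, Cinv, Cmult, Cplus; cbn [fst snd]. f_equal; field; repeat split; try lra; nra.
Qed.

Lemma Csum_RtoC f n : Csum (fun m => RtoC (f m)) n = RtoC (sum_f_R0 f n).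
Proof. induction n as [|n IH]; simpl; [reflexivity|]. now rewrite IH, RtoC_plus. Qed.

Lemma delta_eq x : delta x = RtoC (- / 3 * (pfun x - RInt pfun 0 1)).
Proof.
  pose proof ln2_pos as H2. unfold delta.
  assert (H : Cconv (Csum (fun m => (delta_term x (Z.of_nat (S m)) + delta_term x (- Z.of_nat (S m)))%C))
    (RtoC (- ln 2 / 3 * (pfun x - RInt pfun 0 1)))).
  { apply (Cconv_ext (fun n => RtoC (- ln 2 / 3 * sum_f_R0 (fun m => 2 * RInt (fun s => pfun s * cos (2 * PI * INR (S m) * (x - s))) 0 1) n))).
    - intros n. rewrite scal_sum, <- Csum_RtoC. apply Csum_ext. intros m. rewrite delta_pair. f_equal. ring.
    - apply Cconv_pair.
      + unfold RtoC, Re; cbn [fst].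
        apply (is_lim_seq_scal_l _ (- ln 2 / 3) (Finite (pfun x - RInt pfun 0 1))).
        apply fourier_pointwise; [apply pfun_continuous| |apply pfun_period]. intros y. eexists. apply pfun_derive.
      + unfold RtoC, Im; cbn [snd]. apply is_lim_seq_const. }
  rewrite (Clim_eq _ _ H), <- RtoC_mult. f_equal. field. lra.
Qed.

Lemma delta_period x : delta (x + 1) = delta x.
Proof. now rewrite !delta_eq, pfun_period. Qed.

Lemma delta_mean_re : RInt (fun x => Re (delta x)) 0 1 = 0.
Proof.
  rewrite (RInt_ext _ (fun x => - / 3 * (pfun x + - RInt pfun 0 1))) by (intros x _; rewrite delta_eq; unfold RtoC, Re; cbn [fst];
    match goal with |- @eq _ ?a ?b => change (@eq R a b) end; ring).
  apply is_RInt_unique.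
  replace 0 with (scal (- / 3) (RInt pfun 0 1 + - RInt pfun 0 1) : R) at 2.
  - apply (@is_RInt_scal R_NormedModule). apply is_RInt_plus_R; [|apply is_RInt_const_01].
    apply (@RInt_correct R_CompleteNormedModule), cont_ex_RInt, pfun_continuous.
  - unfold scal; simpl; unfold mult; simpl. ring.
Qed.

Lemma delta_mean_im : RInt (fun x => Im (delta x)) 0 1 = 0.
Proof.
  rewrite (RInt_ext _ (fun _ => 0)) by (intros x _; rewrite delta_eq; reflexivity).
  apply is_RInt_unique, is_RInt_const_01.
Qed.

(** All constants meet here. In particular 43/36 = 4/3 + 1/6 - 1/12 - 2/9: 4/3 from n+1, 1/6 from
    the half subtracted from [Psi], 1/12 from the mean 1/4 of x/2, and 2/9 from the term (4/3) ln 2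
    of the first moment. *)
Lemma main_term_Psi n : (1 <= n)%nat ->
  RtoC (main_term n) = (RtoC (4 / 3 * (INR n + 1) - / 3 * (Psi (log4 (INR n)) - / 2)) - delta (log4 (INR n)))%C.
Proof.
  intros Hn. pose proof ln2_pos as H2. rewrite delta_eq, <- RtoC_minus. f_equal.
  rewrite pfun_mean, RIntR_dfluct_log. unfold main_term, pfun.
  assert (E : ln 4 = 2 * ln 2) by apply lam_eq. rewrite lam_eq. unfold log4. rewrite E. field. lra.
Qed.

(** * Gaussian approximation of the binomial coefficients *)

Definition cbin_ratio (n k : nat) : R := cbin n k / cbin n 0.
Definition level_weight (n k : nat) : R := (INR n + 1) * beta n k / cbin n 0.
(** The shift by 1/2 symmetrises the ratio of neighbouring binomials: (n-k)/(n+k+1) = (1-s)/(1+s)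
    with s = (k+1/2)/nu. The logarithm is then odd in s, and no even powers of s occur. *)
Definition nu (n : nat) : R := INR n + / 2.

Lemma nu_pos n : 0 < nu n. Proof. unfold nu. pose proof (pos_INR n). lra. Qed.

Lemma cbin_ratio_nonneg n k : 0 <= cbin_ratio n k.
Proof.
  unfold cbin_ratio, Rdiv. apply Rmult_le_pos; [unfold cbin; apply pos_INR|].
  left. apply Rinv_0_lt_compat, cbin_pos.
Qed.

Lemma cbin_ratio_0 n : cbin_ratio n 0 = 1.
Proof. unfold cbin_ratio. pose proof (cbin_pos n). field. lra. Qed.

Lemma cbin_ratio_S n k : (INR n + INR k + 1) * cbin_ratio n (S k) = (INR n - INR k) * cbin_ratio n k.
Proof. unfold cbin_ratio, Rdiv. rewrite <- !Rmult_assoc, <- cbin_shift. reflexivity. Qed.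

Lemma cbin_ratio_large n k : (n < k)%nat -> cbin_ratio n k = 0.
Proof.
  intros H. unfold cbin_ratio, cbin. rewrite binom_small by lia. simpl (INR 0). unfold Rdiv. ring.
Qed.

Lemma cbin_ratio_decr n k : cbin_ratio n (S k) <= cbin_ratio n k.
Proof.
  destruct (Nat.le_gt_cases k n) as [H|H].
  - pose proof (cbin_ratio_S n k) as E. pose proof (cbin_ratio_nonneg n k). pose proof (pos_INR k). pose proof (pos_INR n).
    apply le_INR in H. apply (Rmult_le_reg_l (INR n + INR k + 1)); [lra|]. rewrite E.
    apply Rmult_le_compat_r; lra.
  - rewrite !cbin_ratio_large by lia. lra.
Qed.

Lemma level_weight_cbin_ratio n k : level_weight n k = (INR n + 1) * (cbin_ratio n (pred k) - 2 * cbin_ratio n k + cbin_ratio n (S k)).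
Proof. unfold level_weight, beta, cbin_ratio. pose proof (cbin_pos n). field. lra. Qed.

Lemma level_weight_large n k : (S n < k)%nat -> level_weight n k = 0.
Proof. intros H. rewrite level_weight_cbin_ratio, !cbin_ratio_large by lia. ring. Qed.

(** Both neighbours of C(2n, n+k) are rational multiples of it, so the second difference is an exact
    rational factor and no cancellation between approximations has to be controlled. *)
Lemma level_weight_ratio n k : (1 <= k <= n)%nat ->
  level_weight n k = cbin_ratio n k * ((4 * (INR k * INR k) - 2 * INR n - 2) * (INR n + 1) / ((INR n + 1) * (INR n + 1) - INR k * INR k)).
Proof.
  intros [H1 H2]. rewrite level_weight_cbin_ratio. destruct k as [|k]; [lia|]. simpl pred.
  pose proof (cbin_ratio_S n k) as E1. pose proof (cbin_ratio_S n (S k)) as E2.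
  apply le_INR in H2. rewrite S_INR in *. pose proof (pos_INR k).
  assert (D1 : INR n - INR k <> 0) by lra. assert (D2 : INR n + INR k + 2 <> 0) by lra.
  assert (E1' : cbin_ratio n k = (INR n + INR k + 1) * cbin_ratio n (S k) / (INR n - INR k)) by (rewrite E1; field; assumption).
  assert (E2' : cbin_ratio n (S (S k)) = (INR n - (INR k + 1)) * cbin_ratio n (S k) / (INR n + INR k + 2)) by (rewrite <- E2; field; assumption).
  rewrite E1', E2'.
  replace ((INR n + 1) * (INR n + 1) - (INR k + 1) * (INR k + 1)) with ((INR n - INR k) * (INR n + INR k + 2)) by ring.
  field. split; assumption.
Qed.

(** ln((1-s)/(1+s)) = -2s - (2/3) s^3 - ...; the derivative of the remainder is -2 s^4/(1-s^2),
    which is at least -4 s^4 for s <= 1/2. *)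
Lemma log_ratio s : 0 <= s <= / 2 -> - 4 * s ^ 5 <= ln (1 - s) - ln (1 + s) + 2 * s + 2 / 3 * s ^ 3 <= 0.
Proof.
  intros Hs. destruct (Req_dec s 0) as [->|Hs0].
  - rewrite Rminus_0_r, Rplus_0_r, ln_1. simpl. lra.
  - pose (g := fun s => ln (1 - s) - ln (1 + s) + 2 * s + 2 / 3 * s ^ 3).
    destruct (MVT_gen g 0 s (fun s => - 2 * s ^ 4 / (1 - s ^ 2))) as [c [Hc E]].
    + intros x Hx. rewrite Rmin_left, Rmax_right in Hx by lra. unfold g.
      auto_derive; [lra|]. simpl. field. nra.
    + intros x Hx. rewrite Rmin_left, Rmax_right in Hx by lra. apply continuity_pt_filterlim.
      apply (ex_derive_continuous g). unfold g. auto_derive. lra.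
    + rewrite Rmin_left, Rmax_right in Hc by lra.
      change (- 4 * s ^ 5 <= g s <= 0).
      assert (G0 : g 0 = 0) by (unfold g; rewrite Rminus_0_r, Rplus_0_r, ln_1; ring).
      rewrite G0, !Rminus_0_r in E. rewrite E.
      assert (Hc2 : 0 <= c ^ 2 <= / 4) by (simpl; nra).
      assert (Hd : / 2 <= 1 - c ^ 2 <= 1) by lra.
      assert (Hc4 : 0 <= c ^ 4 <= s ^ 4) by (split; [apply pow_le; lra|apply pow_incr; lra]).
      assert (Hq : 0 <= c ^ 4 / (1 - c ^ 2) <= 2 * s ^ 4).
      { split; [apply Rmult_le_pos; [lra|left; apply Rinv_0_lt_compat; lra]|].
        apply (Rmult_le_reg_r (1 - c ^ 2)); [lra|]. unfold Rdiv. rewrite Rmult_assoc, Rinv_l, Rmult_1_r by lra. nra. }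
      replace (- 2 * c ^ 4 / (1 - c ^ 2) * s) with (- 2 * (c ^ 4 / (1 - c ^ 2)) * s) by (unfold Rdiv; ring).
      replace (- 4 * s ^ 5) with (- 2 * (2 * s ^ 4) * s) by ring. nra.
Qed.

(** With s_j = (j+1/2)/nu, this and [cubic_arg] are the exact sums over j < k of 2 s_j and of (2/3)
    s_j^3, the first two orders of the exponent of C(2n, n+k)/C(2n, n). *)
Definition gauss_arg (n k : nat) : R := INR k * INR k / nu n.
Definition cubic_arg (n k : nat) : R := INR k * INR k * (2 * (INR k * INR k) - 1) / (12 * nu n ^ 3).

Lemma sk_ratio n k : (k < n)%nat -> let s := (INR k + / 2) / nu n in
  0 <= s < 1 /\ cbin_ratio n (S k) = (1 - s) / (1 + s) * cbin_ratio n k.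
Proof.
  intros Hk s. pose proof (nu_pos n) as Hn. pose proof (pos_INR k). apply lt_INR in Hk.
  assert (Hs : 0 <= s < 1).
  { unfold s. split; [apply Rmult_le_pos; [lra|left; now apply Rinv_0_lt_compat]|].
    apply (Rmult_lt_reg_r (nu n)); [assumption|]. unfold Rdiv. rewrite Rmult_assoc, Rinv_l, Rmult_1_r by lra. unfold nu. lra. }
  split; [assumption|]. pose proof (cbin_ratio_S n k) as E.
  apply (Rmult_eq_reg_l (INR n + INR k + 1)); [|lra]. rewrite E. unfold s, nu. field. lra.
Qed.

Lemma exp_ratio_upper s : 0 <= s < 1 -> (1 - s) / (1 + s) <= exp (- (2 * s)).
Proof.
  intros Hs. destruct (mvt (fun s => exp (- s) * (1 + s) - exp s * (1 - s)) (fun s => s * (exp s - exp (- s))) 0 s) as [c [Hc E]].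
  - intros x. auto_derive; [trivial|ring].
  - rewrite Rmin_left, Rmax_right in Hc by lra. rewrite Ropp_0, exp_0, !Rminus_0_r in E.
    assert (Hm : exp (- c) <= exp c) by (apply exp_le_mono; lra).
    assert (H : 0 <= c * (exp c - exp (- c)) * s) by (apply Rmult_le_pos; [apply Rmult_le_pos; lra|lra]).
    assert (Hk : exp s * (1 - s) <= exp (- s) * (1 + s)) by lra.
    apply (Rmult_le_reg_r (1 + s)); [lra|]. unfold Rdiv. rewrite Rmult_assoc, Rinv_l, Rmult_1_r by lra.
    replace (- (2 * s)) with (- s + - s) by ring. rewrite exp_plus.
    apply (Rmult_le_reg_l (exp s)); [apply exp_pos|].
    replace (exp s * (exp (- s) * exp (- s) * (1 + s))) with ((exp s * exp (- s)) * (exp (- s) * (1 + s))) by ring.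
    rewrite <- exp_plus, Rplus_opp_r, exp_0. lra.
Qed.

Lemma cbin_ratio_upper n k : (k <= n)%nat -> cbin_ratio n k <= exp (- gauss_arg n k).
Proof.
  intros Hk. pose proof (nu_pos n) as Hn. induction k as [|k IH].
  - rewrite cbin_ratio_0. unfold gauss_arg. simpl (INR 0). replace (- (0 * 0 / nu n)) with 0 by (field; lra). rewrite exp_0. lra.
  - destruct (sk_ratio n k Hk) as [Hs E]. cbv zeta in *. set (s := (INR k + / 2) / nu n) in *.
    rewrite E. replace (- gauss_arg n (S k)) with (- (2 * s) + - gauss_arg n k) by (unfold gauss_arg, s; rewrite S_INR; field; lra).
    rewrite exp_plus. apply Rmult_le_compat; [|apply cbin_ratio_nonneg|now apply exp_ratio_upper|apply IH; lia].
    apply Rmult_le_pos; [lra|left; apply Rinv_0_lt_compat; lra].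
Qed.

(** The ratio is a product of k factors (1-s_j)/(1+s_j); [log_ratio] is summed over them, each
    remainder being at most 4 (k/nu)^5. The restriction on k keeps every s_j below 1/2. *)
Lemma cbin_ratio_expand n k : INR k <= nu n / 2 -> exists D, cbin_ratio n k = exp (- gauss_arg n k) * exp (- D) /\
  cubic_arg n k <= D <= cubic_arg n k + 4 * INR k * (INR k / nu n) ^ 5.
Proof.
  intros Hk. pose proof (nu_pos n) as Hn. induction k as [|k IH].
  - exists 0. rewrite cbin_ratio_0. unfold gauss_arg, cubic_arg. simpl (INR 0). replace (- (0 * 0 / nu n)) with 0 by (field; lra).
    rewrite Ropp_0, exp_0. split; [ring|]. replace (0 * 0 * (2 * (0 * 0) - 1) / (12 * nu n ^ 3)) with 0 by (field; lra). lra.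
  - rewrite S_INR in Hk. pose proof (pos_INR k) as Pk. destruct IH as [D [E [B1 B2]]]; [lra|].
    assert (Hkn : (k < n)%nat) by (apply INR_lt; unfold nu in Hk; lra).
    destruct (sk_ratio n k Hkn) as [Hs E2]. cbv zeta in *. set (s := (INR k + / 2) / nu n) in *.
    assert (Hs2 : s <= / 2).
    { unfold s. apply (Rmult_le_reg_r (nu n)); [assumption|]. unfold Rdiv. rewrite Rmult_assoc, Rinv_l, Rmult_1_r by lra. lra. }
    destruct (log_ratio s ltac:(lra)) as [L1 L2].
    set (lr := ln (1 - s) - ln (1 + s)) in *.
    exists (D - lr - 2 * s). split; [|split].
    + rewrite E2, E. replace ((1 - s) / (1 + s)) with (exp lr).
      * rewrite <- !exp_plus. f_equal. unfold gauss_arg, s. rewrite S_INR. field. lra.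
      * unfold lr, Rminus. rewrite exp_plus, exp_Ropp, !exp_ln by lra. reflexivity.
    + assert (cubic_arg n (S k) = cubic_arg n k + 2 / 3 * s ^ 3) by (unfold cubic_arg, s; rewrite S_INR; field; lra). lra.
    + assert (Y : cubic_arg n (S k) = cubic_arg n k + 2 / 3 * s ^ 3) by (unfold cubic_arg, s; rewrite S_INR; field; lra).
      assert (S5 : s ^ 5 <= (INR (S k) / nu n) ^ 5).
      { apply pow_incr. split; [lra|]. unfold s, Rdiv. apply Rmult_le_compat_r; [left; now apply Rinv_0_lt_compat|]. rewrite S_INR; lra. }
      assert (K5 : (INR k / nu n) ^ 5 <= (INR (S k) / nu n) ^ 5).
      { apply pow_incr. split; [apply Rmult_le_pos; [lra|left; now apply Rinv_0_lt_compat]|].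
        apply Rmult_le_compat_r; [left; now apply Rinv_0_lt_compat|]. rewrite S_INR; lra. }
      rewrite (S_INR k) at 1. set (t := (INR (S k) / nu n) ^ 5) in *. set (t0 := (INR k / nu n) ^ 5) in *.
      assert (INR k * t0 <= INR k * t) by (apply Rmult_le_compat_l; lra). lra.
Qed.

Lemma exp_neg_bounds D : 0 <= D -> 1 - D <= exp (- D) <= 1 - D + D * D / 2.
Proof.
  intros HD. split; [pose proof (exp_ineq1_le (- D)); lra|].
  destruct (mvt (fun x => 1 - x + x * x / 2 - exp (- x)) (fun x => x - 1 + exp (- x)) 0 D) as [c [Hc E]].
  - intros x. auto_derive; [trivial|field].
  - rewrite Ropp_0, exp_0, !Rminus_0_r in E. pose proof (exp_ineq1_le (- c)).
    assert (0 <= (c - 1 + exp (- c)) * D) by (apply Rmult_le_pos; lra). lra.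
Qed.

(** In terms of X = k^2/nu the cubic exponent is X^2/(6 nu) - X/(12 nu^2), and the next order is
    X^3/nu^2. The error nu^(-2) is needed because summation over m later loses a factor nu. *)
Lemma cbin_ratio_second_order n k : (1 <= k)%nat -> INR k <= nu n / 2 ->
  let X := gauss_arg n k in Rabs (cbin_ratio n k - exp (- X) * (1 - X * X / (6 * nu n))) <= exp (- X) * (7 * (1 + X) ^ 4 / nu n ^ 2).
Proof.
  intros H1 Hk X. pose proof (nu_pos n) as Hn. destruct (cbin_ratio_expand n k Hk) as [D [E [B1 B2]]].
  apply (le_INR 1) in H1. simpl (INR 1) in H1.
  assert (HX : INR k * INR k = X * nu n) by (unfold X, gauss_arg; field; lra).
  assert (X0 : 0 <= X) by (unfold X, gauss_arg; apply Rmult_le_pos; [nra|left; now apply Rinv_0_lt_compat]).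
  assert (X4 : X <= nu n / 4).
  { apply (Rmult_le_reg_r (nu n)); [assumption|]. rewrite <- HX. nra. }
  assert (EY : cubic_arg n k = X * X / (6 * nu n) - X / (12 * nu n ^ 2)) by (unfold cubic_arg; rewrite HX; field; lra).
  assert (Y0 : 0 <= cubic_arg n k).
  { unfold cubic_arg. apply Rmult_le_pos; [apply Rmult_le_pos; nra|]. left. apply Rinv_0_lt_compat.
    apply Rmult_lt_0_compat; [lra|]. now apply pow_lt. }
  assert (E5 : INR k * (INR k / nu n) ^ 5 = X ^ 3 / nu n ^ 2).
  { replace (INR k * (INR k / nu n) ^ 5) with ((INR k * INR k) ^ 3 / nu n ^ 5) by (field; lra). rewrite HX. field. lra. }
  rewrite Rmult_assoc, E5 in B2.
  set (v := / nu n). assert (Hv : 0 < v) by (now apply Rinv_0_lt_compat).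
  assert (Xv : X * v <= / 4).
  { apply (Rmult_le_reg_r (nu n)); [assumption|]. unfold v. rewrite Rmult_assoc, Rinv_l by lra. lra. }
  replace (X ^ 3 / nu n ^ 2) with (X ^ 3 * v ^ 2) in B2 by (unfold v; field; lra).
  replace (X * X / (6 * nu n) - X / (12 * nu n ^ 2)) with (X * X * v / 6 - X * v ^ 2 / 12) in EY by (unfold v; field; lra).
  rewrite E. replace (X * X / (6 * nu n)) with (X * X * v / 6) by (unfold v; field; lra).
  replace (7 * (1 + X) ^ 4 / nu n ^ 2) with (7 * (1 + X) ^ 4 * v ^ 2) by (unfold v; field; lra).
  fold X. replace (exp (- X) * exp (- D) - exp (- X) * (1 - X * X * v / 6)) with (exp (- X) * (exp (- D) - (1 - X * X * v / 6))) by ring.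
  rewrite Rabs_mult, (Rabs_pos_eq (exp (- X))) by (left; apply exp_pos).
  apply Rmult_le_compat_l; [left; apply exp_pos|].
  destruct (exp_neg_bounds D ltac:(lra)) as [D1 D2].
  assert (X2 : 0 <= X * X * v) by (apply Rmult_le_pos; nra).
  assert (XX : X ^ 3 * v ^ 2 <= X * X * v / 4).
  { replace (X ^ 3 * v ^ 2) with (X * X * v * (X * v)) by ring. unfold Rdiv. now apply Rmult_le_compat_l. }
  assert (V2 : 0 < v ^ 2) by (now apply pow_lt).
  assert (Xv2 : 0 <= X * v ^ 2) by (apply Rmult_le_pos; lra).
  assert (Du : D <= 2 * (X * X * v)) by lra.
  assert (DD : D * D / 2 <= 2 * (X ^ 4 * v ^ 2)).
  { assert (D * D <= (2 * (X * X * v)) * (2 * (X * X * v))) by (apply Rmult_le_compat; lra).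
    replace (X ^ 4 * v ^ 2) with (X * X * v * (X * X * v)) by ring. lra. }
  assert (P : X + 4 * X ^ 3 + 2 * X ^ 4 <= 7 * (1 + X) ^ 4).
  { pose proof (pow_le X 2 X0). pose proof (pow_le X 3 X0). pose proof (pow_le X 4 X0).
    replace (7 * (1 + X) ^ 4) with (7 * X ^ 4 + 28 * X ^ 3 + 42 * X ^ 2 + 28 * X + 7) by ring. lra. }
  apply (Rmult_le_compat_r (v ^ 2)) in P; [|lra].
  apply Rabs_le. split; lra.
Qed.

(** The product of 1 - X^2 v/6, from the binomial, and 4X - 2 + (4X^2 - 4X) v, from the rational
    factor of [level_weight_ratio], truncated after the first power of v = 1/nu. *)
Definition gmain (X v : R) : R := exp (- X) * ((4 * X - 2) + (-2 / 3 * X ^ 3 + 13 / 3 * X ^ 2 - 4 * X) * v).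

Lemma pow_1X_exp m c X : 0 < c -> 0 <= X -> (1 + X) ^ m <= (INR m / c) ^ m * exp c * exp (c * X).
Proof.
  intros Hc HX. pose proof (pow_le_exp m (c * (1 + X)) ltac:(nra)) as H.
  rewrite Rpow_mult_distr in H. replace (c * (1 + X)) with (c + c * X) in H by ring. rewrite exp_plus in H.
  unfold Rdiv. rewrite Rpow_mult_distr, pow_inv. pose proof (pow_lt c m Hc).
  apply (Rmult_le_reg_l (c ^ m)); [assumption|].
  replace (c ^ m * (INR m ^ m * / c ^ m * exp c * exp (c * X))) with (INR m ^ m * (exp c * exp (c * X))) by (field; lra).
  assumption.
Qed.

Lemma level_weight_near n k : (1 <= n)%nat -> (1 <= k)%nat -> INR k <= nu n / 2 -> let X := gauss_arg n k in
  Rabs (level_weight n k - gmain X (/ nu n)) <= exp (- X) * (1 + X) ^ 7 * 400 * / nu n ^ 2.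
Proof.
  intros Hn1 Hk1 Hk X. pose proof (nu_pos n) as Hn.
  pose proof (cbin_ratio_second_order n k Hk1 Hk) as HQ. cbv zeta in HQ. fold X in HQ.
  pose proof Hk1 as Hk1'. apply (le_INR 1) in Hk1. simpl (INR 1) in Hk1.
  assert (Hkn : (k <= n)%nat) by (apply INR_le; unfold nu in Hk; lra).
  rewrite level_weight_ratio by lia.
  assert (HX : INR k * INR k = X * nu n) by (unfold X, gauss_arg; field; lra).
  assert (X0 : 0 <= X) by (unfold X, gauss_arg; apply Rmult_le_pos; [nra|left; now apply Rinv_0_lt_compat]).
  assert (X4 : X <= nu n / 4).
  { apply (Rmult_le_reg_r (nu n)); [assumption|]. rewrite <- HX. nra. }
  assert (Hn2 : 1 <= nu n) by (unfold nu; apply (le_INR 1) in Hn1; simpl (INR 1) in Hn1; lra).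
  set (v := / nu n). assert (Hv : 0 < v) by (now apply Rinv_0_lt_compat).
  assert (Hv1 : v <= 1) by (unfold v; rewrite <- Rinv_1; apply Rinv_le_contravar; lra).
  rewrite HX. replace (INR n) with (nu n - / 2) by (unfold nu; ring).
  set (R := (4 * (X * nu n) - 2 * (nu n - / 2) - 2) * (nu n - / 2 + 1) / ((nu n - / 2 + 1) * (nu n - / 2 + 1) - X * nu n)).
  assert (Hden : 3 / 4 * nu n ^ 2 <= (nu n - / 2 + 1) * (nu n - / 2 + 1) - X * nu n).
  { assert (X * nu n <= nu n / 4 * nu n) by (apply Rmult_le_compat_r; lra). nra. }
  assert (Hn2p : 0 < nu n ^ 2) by (now apply pow_lt).
  set (W := 1 + X). assert (HW : 1 <= W) by (unfold W; lra).
  set (B := (4 * X - 2) + (4 * X ^ 2 - 4 * X) * v).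
  set (A := 1 - X * X / (6 * nu n)) in *.
  assert (EA : A = 1 - X * X * v / 6) by (unfold A, v; field; lra).
  assert (PW : forall i j, (i <= j)%nat -> W ^ i <= W ^ j) by (intros; apply Rle_pow; assumption).
  assert (V2 : 0 < v ^ 2) by (now apply pow_lt).
  assert (V2' : v ^ 2 <= 1) by (simpl; nra).
  assert (HR : Rabs (R - B) <= 21 * W ^ 3 * v ^ 2).
  { assert (ER : R - B = ((4 * X ^ 3 - 8 * X ^ 2 + 3 * X) - (X ^ 2 - X) * v) / ((nu n - / 2 + 1) * (nu n - / 2 + 1) - X * nu n)).
    { unfold R, B, v. field. split; lra. }
    rewrite ER. unfold Rdiv. rewrite Rabs_mult.
    assert (I1 : Rabs (/ ((nu n - / 2 + 1) * (nu n - / 2 + 1) - X * nu n)) <= 4 / 3 * v ^ 2).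
    { rewrite Rabs_pos_eq by (left; apply Rinv_0_lt_compat; lra).
      replace (4 / 3 * v ^ 2) with (/ (3 / 4 * nu n ^ 2)) by (unfold v; field; lra). apply Rinv_le_contravar; lra. }
    assert (I2 : Rabs (4 * X ^ 3 - 8 * X ^ 2 + 3 * X - (X ^ 2 - X) * v) <= 13 * W ^ 3).
    { pose proof (pow_le X 2 X0) as Q2. pose proof (pow_le X 3 X0) as Q3.
      assert (0 <= X ^ 2 * v <= X ^ 2) by (split; [apply Rmult_le_pos; lra|rewrite <- (Rmult_1_r (X ^ 2)) at 2; apply Rmult_le_compat_l; lra]).
      assert (0 <= X * v <= X) by (split; [apply Rmult_le_pos; lra|rewrite <- (Rmult_1_r X) at 2; apply Rmult_le_compat_l; lra]).
      replace (13 * W ^ 3) with (13 * X ^ 3 + 39 * X ^ 2 + 39 * X + 13) by (unfold W; ring).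
      apply Rabs_le. split; lra. }
    eapply Rle_trans; [apply Rmult_le_compat; [apply Rabs_pos|apply Rabs_pos|apply I2|apply I1]|].
    assert (0 <= W ^ 3 * v ^ 2) by (apply Rmult_le_pos; [apply pow_le; lra|lra]). lra. }
  assert (HB : Rabs B <= 12 * W ^ 2).
  { pose proof (pow_le X 2 X0) as Q2.
    assert (0 <= X ^ 2 * v <= X ^ 2) by (split; [apply Rmult_le_pos; lra|rewrite <- (Rmult_1_r (X ^ 2)) at 2; apply Rmult_le_compat_l; lra]).
    assert (0 <= X * v <= X) by (split; [apply Rmult_le_pos; lra|rewrite <- (Rmult_1_r X) at 2; apply Rmult_le_compat_l; lra]).
    replace (12 * W ^ 2) with (12 * X ^ 2 + 24 * X + 12) by (unfold W; ring). unfold B. apply Rabs_le. split; lra. }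
  assert (HA : Rabs A <= W ^ 2).
  { rewrite EA. assert (0 <= X * X * v <= X * X) by (split; [apply Rmult_le_pos; nra|rewrite <- (Rmult_1_r (X * X)) at 2; apply Rmult_le_compat_l; nra]).
    replace (W ^ 2) with (X * X + 2 * X + 1) by (unfold W; ring). apply Rabs_le. split; lra. }
  replace (7 * W ^ 4 / nu n ^ 2) with (7 * W ^ 4 * v ^ 2) in HQ by (unfold v; field; lra).
  fold W in HQ. replace (7 * W ^ 4 / nu n ^ 2) with (7 * W ^ 4 * v ^ 2) in HQ by (unfold v; field; lra).
  set (q := cbin_ratio n k) in *. set (e := exp (- X)) in *. assert (He : 0 < e) by apply exp_pos.
  replace (/ nu n ^ 2) with (v ^ 2) by (unfold v; field; lra).
  (* The error splits into that of the binomial factor, that of the rational factor, and the v^2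
     term of the product of the two expansions that [gmain] omits. *)
  replace (q * R - gmain X v) with ((q - e * A) * R + e * (A * (R - B)) + e * (X ^ 2 * (4 * X - 4 * X ^ 2) * v ^ 2 / 6)).
  2: { unfold gmain. fold e. rewrite EA. unfold B. field. }
  assert (HR' : Rabs R <= 33 * W ^ 3).
  { replace R with (B + (R - B)) by ring. eapply Rle_trans; [apply Rabs_triang|].
    pose proof (PW 2%nat 3%nat ltac:(lia)). assert (0 <= W ^ 3) by (apply pow_le; lra).
    assert (21 * W ^ 3 * v ^ 2 <= 21 * W ^ 3) by (rewrite <- (Rmult_1_r (21 * W ^ 3)) at 2; apply Rmult_le_compat_l; lra). lra. }
  assert (T1 : Rabs ((q - e * A) * R) <= e * W ^ 7 * v ^ 2 * 231).
  { rewrite Rabs_mult. eapply Rle_trans; [apply Rmult_le_compat; [apply Rabs_pos|apply Rabs_pos|apply HQ|apply HR']|]. right. ring. }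
  assert (T2 : Rabs (e * (A * (R - B))) <= e * W ^ 7 * v ^ 2 * 21).
  { rewrite !Rabs_mult, (Rabs_pos_eq e) by lra.
    apply Rle_trans with (e * (W ^ 2 * (21 * W ^ 3 * v ^ 2))).
    - apply Rmult_le_compat_l; [lra|]. apply Rmult_le_compat; try apply Rabs_pos; assumption.
    - replace (e * (W ^ 2 * (21 * W ^ 3 * v ^ 2))) with (e * v ^ 2 * 21 * W ^ 5) by ring.
      replace (e * W ^ 7 * v ^ 2 * 21) with (e * v ^ 2 * 21 * W ^ 7) by ring.
      apply Rmult_le_compat_l; [|apply PW; lia]. apply Rmult_le_pos; [apply Rmult_le_pos; lra|lra]. }
  assert (T3 : Rabs (e * (X ^ 2 * (4 * X - 4 * X ^ 2) * v ^ 2 / 6)) <= e * W ^ 7 * v ^ 2 * 4).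
  { rewrite Rabs_mult, (Rabs_pos_eq e) by lra.
    replace (e * W ^ 7 * v ^ 2 * 4) with (e * (4 * W ^ 7 * v ^ 2)) by ring. apply Rmult_le_compat_l; [lra|].
    replace (X ^ 2 * (4 * X - 4 * X ^ 2) * v ^ 2 / 6) with ((X ^ 2 * (4 * X - 4 * X ^ 2) / 6) * v ^ 2) by field.
    rewrite Rabs_mult, (Rabs_pos_eq (v ^ 2)) by lra. apply Rmult_le_compat_r; [lra|].
    pose proof (PW 4%nat 7%nat ltac:(lia)). pose proof (pow_le X 2 X0). pose proof (pow_le X 3 X0). pose proof (pow_le X 4 X0).
    assert (W4 : W ^ 4 = X ^ 4 + 4 * X ^ 3 + 6 * X ^ 2 + 4 * X + 1) by (unfold W; ring).
    replace (X ^ 2 * (4 * X - 4 * X ^ 2) / 6) with (4 / 6 * X ^ 3 - 4 / 6 * X ^ 4) by field.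
    apply Rabs_le. split; lra. }
  assert (P : 0 <= e * W ^ 7 * v ^ 2) by (apply Rmult_le_pos; [apply Rmult_le_pos; [lra|apply pow_le; lra]|lra]).
  eapply Rle_trans; [apply Rabs_triang|]. eapply Rle_trans; [apply Rplus_le_compat_r, Rabs_triang|]. lra.
Qed.

Lemma gmain_bound X v : 0 <= X -> 0 <= v <= 1 -> Rabs (gmain X v) <= exp (- X) * (12 * (1 + X) ^ 3).
Proof.
  intros X0 Hv. unfold gmain. rewrite Rabs_mult, (Rabs_pos_eq (exp (- X))) by (left; apply exp_pos).
  apply Rmult_le_compat_l; [left; apply exp_pos|].
  pose proof (pow_le X 2 X0). pose proof (pow_le X 3 X0).
  assert (Q : forall a, 0 <= a -> 0 <= a * v <= a).
  { intros a Ha. split; [apply Rmult_le_pos; lra|rewrite <- (Rmult_1_r a) at 2; apply Rmult_le_compat_l; lra]. }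
  pose proof (Q (X ^ 3) H0). pose proof (Q (X ^ 2) H). pose proof (Q X X0).
  replace (12 * (1 + X) ^ 3) with (12 * X ^ 3 + 36 * X ^ 2 + 36 * X + 12) by ring. apply Rabs_le. split; lra.
Qed.

(** For k > nu/2 one has X > nu/4, so the weight is exponentially small in X and the factor n+1 is
    dominated by 8X. Comparing index k-1 with k costs a constant factor and part of the rate. *)
Lemma level_weight_far n k : (1 <= n)%nat -> (1 <= k)%nat -> nu n / 2 < INR k -> let X := gauss_arg n k in
  Rabs (level_weight n k) <= exp (- X / 4) * (96 * (1 + X)).
Proof.
  intros Hn1 Hk1 Hk X. pose proof (nu_pos n) as Hn.
  assert (Hn2 : 1 <= nu n) by (unfold nu; apply (le_INR 1) in Hn1; simpl (INR 1) in Hn1; lra).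
  assert (HX : INR k * INR k = X * nu n) by (unfold X, gauss_arg; field; lra).
  assert (X4 : nu n <= 4 * X).
  { apply (Rmult_le_reg_r (nu n)); [assumption|]. rewrite Rmult_assoc, <- HX. nra. }
  pose proof (exp_pos (- X / 4)) as He.
  assert (Hq : cbin_ratio n (pred k) <= 3 * exp (- X / 4)).
  { destruct (Nat.le_gt_cases (pred k) n) as [L|L]; [|rewrite cbin_ratio_large by assumption; lra].
    eapply Rle_trans; [now apply cbin_ratio_upper|].
    apply Rle_trans with (exp 1 * exp (- X / 4)); [|apply Rmult_le_compat_r; [lra|apply exp_le_3]].
    rewrite <- exp_plus. apply exp_le_mono.
    assert (E : INR (pred k) = INR k - 1) by (destruct k; [lia|simpl pred; rewrite S_INR; ring]).
    unfold gauss_arg. rewrite E.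
    apply (Rmult_le_reg_r (nu n)); [assumption|].
    replace (- ((INR k - 1) * (INR k - 1) / nu n) * nu n) with (- ((INR k - 1) * (INR k - 1))) by (field; lra).
    replace ((1 + - X / 4) * nu n) with (nu n - (X * nu n) / 4) by field. rewrite <- HX.
    pose proof (Rle_0_sqr (3 * INR k - 4)) as S; unfold Rsqr in S. lra. }
  pose proof (cbin_ratio_nonneg n k). pose proof (cbin_ratio_nonneg n (S k)). pose proof (cbin_ratio_nonneg n (pred k)).
  pose proof (cbin_ratio_decr n k). assert (D : cbin_ratio n k <= cbin_ratio n (pred k)) by (destruct k; [lia|apply cbin_ratio_decr]).
  rewrite level_weight_cbin_ratio, Rabs_mult. pose proof (pos_INR n).
  assert (Hn3 : INR n + 1 <= 8 * X) by (unfold nu in *; lra).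
  rewrite (Rabs_pos_eq (INR n + 1)) by lra.
  apply Rle_trans with ((8 * X) * (4 * (3 * exp (- X / 4)))); [|nra].
  apply Rmult_le_compat; [lra|apply Rabs_pos|assumption|]. apply Rabs_le. split; lra.
Qed.

(** The decay (1+X)^(-2) is the weakest that suffices for [sum_telescope]. In the far range nu <= 4
    (1+X), so 1 <= 16 (1+X)^2/nu^2 turns exponential smallness into the order nu^(-2). *)
Lemma level_weight_approx : exists C, 0 <= C /\ forall n k, (1 <= n)%nat -> (1 <= k)%nat ->
  Rabs (level_weight n k - gmain (gauss_arg n k) (/ nu n)) <= C * / nu n ^ 2 * / ((1 + gauss_arg n k) * (1 + gauss_arg n k)).
Proof.
  pose (C1 := (INR 9 / 1) ^ 9 * exp 1). pose (C2 := (INR 5 / (/ 4)) ^ 5 * exp (/ 4)). pose (C3 := (INR 7 / 1) ^ 7 * exp 1).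
  assert (P1 : 0 <= C1) by (apply Rmult_le_pos; [apply pow_le; simpl; lra|left; apply exp_pos]).
  assert (P2 : 0 <= C2) by (apply Rmult_le_pos; [apply pow_le; simpl; lra|left; apply exp_pos]).
  assert (P3 : 0 <= C3) by (apply Rmult_le_pos; [apply pow_le; simpl; lra|left; apply exp_pos]).
  exists (400 * C1 + 16 * 96 * C2 + 16 * 12 * C3). split; [lra|]. intros n k Hn1 Hk1.
  pose proof (nu_pos n) as Hn.
  assert (Hn2 : 1 <= nu n) by (unfold nu; apply (le_INR 1) in Hn1; simpl (INR 1) in Hn1; lra).
  set (X := gauss_arg n k). assert (X0 : 0 <= X) by (unfold X, gauss_arg; apply Rmult_le_pos; [pose proof (pos_INR k); nra|left; now apply Rinv_0_lt_compat]).
  set (W := 1 + X). assert (HW : 1 <= W) by (unfold W; lra).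
  assert (Hn2p : 0 < nu n ^ 2) by (now apply pow_lt).
  assert (HI : 0 < / nu n ^ 2) by (now apply Rinv_0_lt_compat).
  assert (HWW : 0 < W * W) by nra.
  assert (E9 : exp (- X) * W ^ 9 <= C1).
  { pose proof (pow_1X_exp 9 1 X Rlt_0_1 X0) as H. fold W C1 in H. rewrite Rmult_1_l in H.
    rewrite exp_Ropp. pose proof (exp_pos X). apply (Rmult_le_reg_l (exp X)); [assumption|].
    rewrite <- Rmult_assoc, Rinv_r, Rmult_1_l by lra. lra. }
  assert (E7 : exp (- X) * W ^ 7 <= C3).
  { pose proof (pow_1X_exp 7 1 X Rlt_0_1 X0) as H. fold W C3 in H. rewrite Rmult_1_l in H.
    rewrite exp_Ropp. pose proof (exp_pos X). apply (Rmult_le_reg_l (exp X)); [assumption|].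
    rewrite <- Rmult_assoc, Rinv_r, Rmult_1_l by lra. lra. }
  assert (E5 : exp (- X / 4) * W ^ 5 <= C2).
  { pose proof (pow_1X_exp 5 (/ 4) X ltac:(lra) X0) as H. fold W C2 in H.
    replace (- X / 4) with (- (/ 4 * X)) by field.
    rewrite exp_Ropp. pose proof (exp_pos (/ 4 * X)). apply (Rmult_le_reg_l (exp (/ 4 * X))); [assumption|].
    rewrite <- Rmult_assoc, Rinv_r, Rmult_1_l by lra. lra. }
  apply (Rmult_le_reg_r (W * W)); [assumption|].
  rewrite (Rmult_assoc _ (/ (W * W))), Rinv_l, Rmult_1_r by lra.
  destruct (Rle_dec (INR k) (nu n / 2)) as [L|L].
  - pose proof (level_weight_near n k Hn1 Hk1 L) as H. cbv zeta in H. fold X W in H.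
    apply Rle_trans with (exp (- X) * W ^ 7 * 400 * / nu n ^ 2 * (W * W)); [apply Rmult_le_compat_r; lra|].
    replace (exp (- X) * W ^ 7 * 400 * / nu n ^ 2 * (W * W)) with (400 * (exp (- X) * W ^ 9) * / nu n ^ 2) by ring.
    apply Rmult_le_compat_r; [lra|]. lra.
  - apply Rnot_le_lt in L. pose proof (level_weight_far n k Hn1 Hk1 L) as H. cbv zeta in H. fold X W in H.
    pose proof (gmain_bound X (/ nu n) X0) as G. fold W in G.
    assert (Hv : 0 <= / nu n <= 1) by (split; [left; now apply Rinv_0_lt_compat|rewrite <- Rinv_1; apply Rinv_le_contravar; lra]).
    specialize (G Hv).
    assert (X4 : nu n <= 4 * W).
    { apply Rle_trans with (4 * X); [|unfold W; lra]. apply (Rmult_le_reg_r (nu n)); [assumption|].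
      replace (4 * X * nu n) with (4 * (INR k * INR k)) by (unfold X, gauss_arg; field; lra). nra. }
    assert (N2 : 1 <= 16 * (W * W) * / nu n ^ 2).
    { apply (Rmult_le_reg_r (nu n ^ 2)); [assumption|]. rewrite Rmult_assoc, Rinv_l by lra. simpl. nra. }
    apply Rle_trans with ((exp (- X / 4) * (96 * W) + exp (- X) * (12 * W ^ 3)) * (W * W)).
    + apply Rmult_le_compat_r; [lra|]. unfold Rminus. eapply Rle_trans; [apply Rabs_triang|]. rewrite Rabs_Ropp. lra.
    + set (Z := (exp (- X / 4) * (96 * W) + exp (- X) * (12 * W ^ 3)) * (W * W)).
      pose proof (exp_pos (- X)). pose proof (exp_pos (- X / 4)).
      assert (W3 : 0 < W ^ 3) by (apply pow_lt; lra).
      assert (Z0 : 0 <= Z) by (unfold Z; apply Rmult_le_pos; [|lra]; apply Rplus_le_le_0_compat; apply Rmult_le_pos; lra).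
      apply Rle_trans with (Z * (16 * (W * W) * / nu n ^ 2)); [rewrite <- (Rmult_1_r Z) at 1; now apply Rmult_le_compat_l|].
      replace (Z * (16 * (W * W) * / nu n ^ 2)) with ((16 * 96 * (exp (- X / 4) * W ^ 5) + 16 * 12 * (exp (- X) * W ^ 7)) * / nu n ^ 2) by (unfold Z; ring).
      apply Rmult_le_compat_r; [lra|]. lra.
Qed.

(** Each term is at most a difference of values of 1/(2z (1 + a(a+1) z)) at consecutive a, because
    (1 + a(a+1)z)(1 + (a+1)(a+2)z) <= (1 + (a+1)^2 z)^2. *)
Lemma sum_telescope z M : 0 < z -> sum_f_R0 (fun m => INR (S m) * / ((1 + INR (S m) * INR (S m) * z) * (1 + INR (S m) * INR (S m) * z))) M <= / (2 * z).
Proof.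
  intros Hz.
  assert (St : forall m, INR (S m) * / ((1 + INR (S m) * INR (S m) * z) * (1 + INR (S m) * INR (S m) * z)) <=
    / (2 * z) * (/ (1 + INR m * (INR m + 1) * z) - / (1 + INR (S m) * (INR (S m) + 1) * z))).
  { intros m. rewrite S_INR. pose proof (pos_INR m) as P. set (a := INR m) in *.
    assert (A1 : 0 < 1 + a * (a + 1) * z) by (assert (0 <= a * (a + 1) * z) by (apply Rmult_le_pos; nra); lra).
    assert (A2 : 0 < 1 + (a + 1) * (a + 1 + 1) * z) by (assert (0 <= (a + 1) * (a + 1 + 1) * z) by (apply Rmult_le_pos; nra); lra).
    assert (A3 : 0 < 1 + (a + 1) * (a + 1) * z) by (assert (0 <= (a + 1) * (a + 1) * z) by (apply Rmult_le_pos; nra); lra).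
    replace (/ (2 * z) * (/ (1 + a * (a + 1) * z) - / (1 + (a + 1) * (a + 1 + 1) * z)))
      with ((a + 1) * / ((1 + a * (a + 1) * z) * (1 + (a + 1) * (a + 1 + 1) * z))) by (field; lra).
    apply Rmult_le_compat_l; [lra|]. apply Rinv_le_contravar; [now apply Rmult_lt_0_compat|].
    assert (0 <= (a + 1) * (a + 1) * (z * z)) by (apply Rmult_le_pos; nra). nra. }
  assert (H : sum_f_R0 (fun m => INR (S m) * / ((1 + INR (S m) * INR (S m) * z) * (1 + INR (S m) * INR (S m) * z))) M
     <= / (2 * z) * (1 - / (1 + INR (S M) * (INR (S M) + 1) * z))).
  { induction M as [|M IH].
    - cbn [sum_f_R0]. eapply Rle_trans; [apply St|]. right. simpl (INR 0). rewrite Rmult_0_l, Rmult_0_l, Rplus_0_r, Rinv_1. reflexivity.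
    - rewrite tech5. specialize (St (S M)).
      replace (1 + INR (S M) * (INR (S M) + 1) * z) with (1 + INR (S M) * (INR (S M) + 1) * z) in IH by ring. lra. }
  eapply Rle_trans; [apply H|]. assert (0 < / (2 * z)) by (apply Rinv_0_lt_compat; lra).
  assert (0 < / (1 + INR (S M) * (INR (S M) + 1) * z)).
  { apply Rinv_0_lt_compat. pose proof (pos_INR (S M)). assert (0 <= INR (S M) * (INR (S M) + 1) * z) by (apply Rmult_le_pos; nra). lra. }
  nra.
Qed.

(** * Sums over one level and over all levels *)

Definition level_sum (n N : nat) : R := sum_f_R0 (fun m => (-1) ^ m * INR (S m) * level_weight n (N * S m)) n.

Lemma level_sum_ext n N M : (1 <= N)%nat -> (n <= M)%nat -> sum_f_R0 (fun m => (-1) ^ m * INR (S m) * level_weight n (N * S m)) M = level_sum n N.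
Proof.
  intros HN HM. unfold level_sum. induction HM as [|M HM IH]; [reflexivity|].
  rewrite tech5, IH, level_weight_large by nia. ring.
Qed.

(** With z = N^2/nu the telescoped sum is at most nu/(2 N^2), so pointwise errors nu^(-2) add up to
    O(1/nu). The terms of order 1/nu are not estimated individually but summed with their signs into
    [fluct_corr]. The level sum is finite and constant in M >= n, which permits the limit in M on
    the other side. *)
Lemma level_sum_approx_aux : exists C, 0 <= C /\ forall n N w, (1 <= n)%nat -> (1 <= N)%nat -> exp w = INR N * INR N / nu n ->
  Rabs (level_sum n N - (fluct w + / nu n * fluct_corr w)) <= C * / nu n.
Proof.
  destruct level_weight_approx as [C [HC H]]. exists C. split; [assumption|]. intros n N w Hn1 HN1 Hw.
  pose proof (nu_pos n) as Hn. pose proof HN1 as HN. apply (le_INR 1) in HN. simpl (INR 1) in HN.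
  assert (Hz : 0 < exp w) by apply exp_pos.
  assert (Conv : forall F, decays F -> is_lim_seq (fun M => sum_f_R0 (fun m => (-1) ^ m * samp F (exp_half w) m) M) (altsum (samp F (exp_half w)))).
  { intros F HF. apply is_lim_seq_eps. intros eps He. destruct (samp_partial_unif F (Rabs w) HF eps He) as [K HK].
    exists K. intros M HM. apply HK; [assumption|lra]. }
  assert (L : is_lim_seq (fun M => sum_f_R0 (fun m => (-1) ^ m * samp gauss_main (exp_half w) m) M + / nu n * sum_f_R0 (fun m => (-1) ^ m * samp gauss_corr (exp_half w) m) M)
     (fluct w + / nu n * fluct_corr w)).
  { apply is_lim_seq_plus'; [apply (Conv gauss_main gauss_main_decays)|].
    apply (is_lim_seq_scal_l (fun M => sum_f_R0 (fun m => (-1) ^ m * samp gauss_corr (exp_half w) m) M) (/ nu n) (fluct_corr w)), (Conv gauss_corr gauss_corr_decays). }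
  apply (lim_abs_le _ _ _ _ L). exists n. intros M HM. rewrite <- (level_sum_ext n N M HN1 HM).
  rewrite scal_sum, <- plus_sum, <- minus_sum.
  eapply Rle_trans; [apply Rsum_abs|].
  apply Rle_trans with (C * / nu n ^ 2 * sum_f_R0 (fun m => INR (S m) * / ((1 + INR (S m) * INR (S m) * exp w) * (1 + INR (S m) * INR (S m) * exp w))) M).
  - rewrite scal_sum. apply sum_Rle. intros m _. set (c := INR (S m)).
    assert (Hc : 0 < c) by (apply lt_0_INR; lia).
    assert (EX : gauss_arg n (N * S m) = c * c * exp w).
    { unfold gauss_arg. rewrite mult_INR. fold c. rewrite Hw. field. lra. }
    pose proof (H n (N * S m)%nat Hn1 ltac:(nia)) as B. rewrite EX in B.
    assert (ES : (-1) ^ m * samp gauss_main (exp_half w) m + (-1) ^ m * samp gauss_corr (exp_half w) m * / nu n = (-1) ^ m * (c * gmain (c * c * exp w) (/ nu n))).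
    { unfold samp, gauss_main, gauss_corr, gmain, gaussmon. fold c. pose proof (exp_half_pos w). rewrite <- (exp_half_sq w).
      replace (c * exp_half w * (c * exp_half w)) with (c * c * (exp_half w * exp_half w)) by ring. field. lra. }
    rewrite ES.
    replace ((-1) ^ m * c * level_weight n (N * S m) - (-1) ^ m * (c * gmain (c * c * exp w) (/ nu n)))
      with ((-1) ^ m * (c * (level_weight n (N * S m) - gmain (c * c * exp w) (/ nu n)))) by ring.
    rewrite !Rabs_mult, pow_m1_abs, Rmult_1_l, (Rabs_pos_eq c) by lra.
    eapply Rle_trans; [apply Rmult_le_compat_l; [lra|apply B]|]. right; ring.
  - pose proof (sum_telescope (exp w) M Hz) as T.
    assert (HI : 0 < / nu n ^ 2) by (apply Rinv_0_lt_compat, pow_lt; assumption).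
    apply Rle_trans with (C * / nu n ^ 2 * / (2 * exp w)); [apply Rmult_le_compat_l; [apply Rmult_le_pos; lra|assumption]|].
    rewrite Hw. replace (C * / nu n ^ 2 * / (2 * (INR N * INR N / nu n))) with (C * / nu n * / (2 * (INR N * INR N))) by (field; lra).
    rewrite <- (Rmult_1_r (C * / nu n)) at 2. apply Rmult_le_compat_l; [apply Rmult_le_pos; [assumption|left; now apply Rinv_0_lt_compat]|].
    rewrite <- Rinv_1. apply Rinv_le_contravar; nra.
Qed.

(** Replacing nu by n moves w by ln(1 + 1/(2n)) <= 1/n, and the derivative of [fluct] is bounded. *)
Lemma level_sum_approx : exists C, 0 <= C /\ forall n N, (1 <= n)%nat -> (1 <= N)%nat ->
  Rabs (level_sum n N - fluct (2 * ln (INR N) - ln (INR n))) <= C * / INR n.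
Proof.
  destruct level_sum_approx_aux as [C [HC H]]. destruct fluct_corr_bound as [K [HK HP]]. destruct dfluct_bound as [K' [HK' [HD _]]].
  exists (C + K + K'). split; [lra|]. intros n N Hn1 HN1.
  pose proof (nu_pos n) as Hn. pose proof (le_INR 1 n Hn1) as Hn'. pose proof (le_INR 1 N HN1) as HN'. simpl (INR 1) in *.
  set (w := 2 * ln (INR N) - ln (nu n)). set (w' := 2 * ln (INR N) - ln (INR n)).
  assert (Hw : exp w = INR N * INR N / nu n).
  { unfold w, Rminus. replace (2 * ln (INR N)) with (ln (INR N) + ln (INR N)) by ring.
    rewrite !exp_plus, exp_Ropp, !exp_ln by lra. reflexivity. }
  specialize (H n N w Hn1 HN1 Hw). specialize (HP w).
  assert (Hvn : / nu n <= / INR n) by (apply Rinv_le_contravar; unfold nu; lra).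
  assert (Hv0 : 0 < / nu n) by now apply Rinv_0_lt_compat.
  assert (Hd : Rabs (fluct w' - fluct w) <= K' * / INR n).
  { destruct (mvt fluct dfluct w w' fluct_derive) as [c [_ E]]. rewrite E, Rabs_mult.
    assert (H1 : Rabs (dfluct c) <= K').
    { eapply Rle_trans; [apply HD|]. rewrite <- (Rmult_1_r K') at 2. apply Rmult_le_compat_l; [assumption|].
      rewrite <- exp_0. apply exp_le_mono. pose proof (Rabs_pos c); lra. }
    assert (H2 : 0 <= w' - w <= / INR n).
    { replace (w' - w) with (ln (nu n) - ln (INR n)) by (unfold w, w'; ring).
      replace (ln (nu n) - ln (INR n)) with (ln (nu n / INR n)) by (unfold Rdiv; rewrite ln_mult, ln_Rinv; try lra; apply Rinv_0_lt_compat; lra).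
      assert (Q : nu n / INR n = 1 + / 2 * / INR n) by (unfold nu; field; lra).
      assert (Hi : 0 < / INR n) by (apply Rinv_0_lt_compat; lra). rewrite Q. split.
      - rewrite <- ln_1. apply ln_le; [lra|]. lra.
      - rewrite <- (ln_exp (/ INR n)) at 2. apply ln_le; [lra|]. pose proof (exp_ineq1_le (/ INR n)). lra. }
    rewrite (Rabs_pos_eq (w' - w)) by lra. apply Rmult_le_compat; try apply Rabs_pos; lra. }
  replace (level_sum n N - fluct w') with ((level_sum n N - (fluct w + / nu n * fluct_corr w)) + / nu n * fluct_corr w - (fluct w' - fluct w)) by ring.
  assert (Hp : Rabs (/ nu n * fluct_corr w) <= K * / INR n).
  { rewrite Rabs_mult, (Rabs_pos_eq (/ nu n)), Rmult_comm by lra. apply Rmult_le_compat; try lra. apply Rabs_pos. }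
  assert (HC' : C * / nu n <= C * / INR n) by (now apply Rmult_le_compat_l).
  unfold Rminus at 1. eapply Rle_trans; [apply Rabs_triang|]. rewrite Rabs_Ropp.
  eapply Rle_trans; [apply Rplus_le_compat_r, Rabs_triang|]. lra.
Qed.

Lemma exp_lam_x n x : 0 < INR n -> x = log4 (INR n) -> exp (x * lam) = INR n.
Proof.
  intros Hn ->. unfold log4, lam. assert (0 < ln 4) by apply lam_pos.
  replace (ln (INR n) / ln 4 * ln 4) with (ln (INR n)) by (field; lra). now apply exp_ln.
Qed.

(** The levels r < 0 and r > L are missing from the finite sum: the former contribute at most K/n,
    the latter 4K/n. [PsiN] compensates the n+1 levels from -n to 0, of which level 0 belongs to the
    finite sum, and this leaves the 1/2. *)
Lemma Psi_partial_sum : exists C, 0 <= C /\ forall n L, (1 <= n)%nat -> (n + 1 < 2 ^ S L)%nat ->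
  Rabs (sum_f_R0 (fun l => fluct ((INR l - log4 (INR n)) * lam)) L - (Psi (log4 (INR n)) - / 2)) <= C * / INR n.
Proof.
  destruct fluct_bound as [K [HK [Hm Hp]]]. exists (5 * K). split; [lra|]. intros n L Hn1 HL.
  pose proof lam_pos as Hlam. pose proof (le_INR 1 n Hn1) as Hn. simpl (INR 1) in Hn.
  set (x := log4 (INR n)). assert (Ex : exp (x * lam) = INR n) by (apply exp_lam_x; [lra|reflexivity]).
  assert (Hx : 0 <= x * lam) by (rewrite <- (ln_exp (x * lam)), Ex, <- ln_1; apply ln_le; lra).
  assert (Ex' : exp (- (x * lam)) = / INR n) by (rewrite exp_Ropp, Ex; reflexivity).
  assert (Pn : 0 < / INR n) by (apply Rinv_0_lt_compat; lra).
  assert (P4 : forall j, 0 < / 4 ^ j) by (intros; apply Rinv_0_lt_compat, pow_lt; lra).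
  assert (I4 : forall j, / 4 ^ j = 4 * / 4 ^ S j) by (intros; simpl; field; apply pow_nonzero; lra).
  set (A := fun N => sum_f_R0 (fun l => fluct ((INR l - x) * lam)) N).
  assert (H1 : forall N, Rabs (PsiN N x - / 2 - A N) <= K * / INR n * (1 - / 4 ^ N)).
  { intros N. induction N as [|N IH].
    - unfold PsiN, A. cbn [symsum sum_f_R0]. simpl (INR 0).
      replace (fluct ((0 - x) * lam) + (0 + 1) / 2 - / 2 - fluct ((0 - x) * lam)) with 0 by field. rewrite Rabs_R0. simpl. lra.
    - assert (E : PsiN (S N) x - / 2 - A (S N) = (PsiN N x - / 2 - A N) + (fluct ((- INR (S N) - x) * lam) + / 2)).
      { unfold PsiN, A. rewrite tech5. cbn [symsum]. rewrite (S_INR N) at 3. field. }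
      rewrite E. eapply Rle_trans; [apply Rabs_triang|].
      assert (B : Rabs (fluct ((- INR (S N) - x) * lam) + / 2) <= K * (/ INR n * / 4 ^ S N)).
      { pose proof (pos_INR (S N)). eapply Rle_trans; [apply Hm; nra|]. apply Rmult_le_compat_l; [assumption|].
        right. replace ((- INR (S N) - x) * lam) with (- (x * lam) + - (INR (S N) * lam)) by ring.
        rewrite exp_plus, Ex', exp_lam. reflexivity. }
      rewrite I4 in IH. specialize (P4 (S N)).
      assert (0 <= K * / INR n * / 4 ^ S N) by (apply Rmult_le_pos; [apply Rmult_le_pos; lra|lra]). nra. }
  (* n < 2^(L+1) gives n^2 <= 4^(L+1): the upper tail, of size n 4^(-L), is then O(1/n), and all
     levels above L have a positive argument. *)
  assert (H4L : INR n * INR n <= 4 ^ S L).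
  { apply lt_INR in HL. rewrite plus_INR, pow_INR in HL. simpl (INR 1) in HL. simpl (INR 2) in HL.
    replace 4 with (2 * 2) by ring. rewrite Rpow_mult_distr.
    replace (1 + 1) with 2 in HL by ring. apply Rmult_le_compat; lra. }
  assert (H2 : forall j, Rabs (A (L + j)%nat - A L) <= K * INR n * (/ 4 ^ L - / 4 ^ (L + j))).
  { intros j. induction j as [|j IH].
    - rewrite Nat.add_0_r, !Rminus_diag, Rabs_R0. lra.
    - replace (L + S j)%nat with (S (L + j)) by lia. unfold A at 1. rewrite tech5. fold (A (L + j)%nat).
      set (m := (L + j)%nat) in *.
      assert (Q : x * lam <= INR (S m) * lam).
      { rewrite <- (ln_exp (x * lam)), <- (ln_exp (INR (S m) * lam)). rewrite Ex.
        apply ln_le; [lra|]. rewrite <- (Rinv_inv (exp _)), <- exp_Ropp, exp_lam, Rinv_inv.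
        apply Rle_trans with (4 ^ S L); [nra|]. apply Rle_pow; [lra|lia]. }
      assert (B : Rabs (fluct ((INR (S m) - x) * lam)) <= K * (INR n * / 4 ^ S m)).
      { eapply Rle_trans; [apply Hp; lra|]. apply Rmult_le_compat_l; [assumption|].
        right. replace (- ((INR (S m) - x) * lam)) with (x * lam + - (INR (S m) * lam)) by ring.
        rewrite exp_plus, Ex, exp_lam. reflexivity. }
      replace (A m + fluct ((INR (S m) - x) * lam) - A L) with ((A m - A L) + fluct ((INR (S m) - x) * lam)) by ring.
      eapply Rle_trans; [apply Rabs_triang|]. rewrite (I4 m) in IH.
      assert (0 <= K * INR n * / 4 ^ S m) by (specialize (P4 (S m)); apply Rmult_le_pos; [apply Rmult_le_pos; lra|lra]). nra. }
  assert (H3 : K * INR n * / 4 ^ L <= 4 * K * / INR n).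
  { rewrite I4. apply Rle_trans with (K * INR n * (4 * / (INR n * INR n))).
    - apply Rmult_le_compat_l; [apply Rmult_le_pos; lra|]. apply Rmult_le_compat_l; [lra|].
      apply Rinv_le_contravar; [nra|assumption].
    - right. field. lra. }
  assert (Lim : is_lim_seq (fun N => PsiN N x - / 2) (Psi x - / 2)).
  { apply is_lim_seq_minus'; [apply Psi_lim|apply is_lim_seq_const]. }
  fold (A L). apply (lim_abs_le _ _ _ _ Lim). exists L. intros N HN.
  replace N with (L + (N - L))%nat by lia. set (j := (N - L)%nat).
  specialize (H1 (L + j)%nat). specialize (H2 j).
  replace (A L - (PsiN (L + j) x - / 2)) with (- (A (L + j)%nat - A L) - (PsiN (L + j) x - / 2 - A (L + j)%nat)) by ring.
  unfold Rminus at 1. eapply Rle_trans; [apply Rabs_triang|]. rewrite !Rabs_Ropp.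
  specialize (P4 (L + j)%nat).
  assert (0 <= K * INR n * / 4 ^ (L + j)) by (apply Rmult_le_pos; [apply Rmult_le_pos; lra|lra]).
  assert (0 <= K * / INR n * / 4 ^ (L + j)) by (apply Rmult_le_pos; [apply Rmult_le_pos; lra|lra]). lra.
Qed.

Theorem theorem2 :
  (forall x : R, delta (x + 1) = delta x) /\
  RInt (fun x => Re (delta x)) 0 1 = 0 /\
  RInt (fun x => Im (delta x)) 0 1 = 0 /\
  exists (K : R) (N : nat), forall n : nat, (N <= n)%nat ->
    Cmod (RtoC (E_n n - main_term n) - delta (log4 (INR n)))
      <= K * (ln (INR n) / INR n).
Proof.
  split; [exact delta_period|]. split; [exact delta_mean_re|]. split; [exact delta_mean_im|].
  destruct level_sum_approx as [C1 [HC1 H1]]. destruct Psi_partial_sum as [C2 [HC2 H2]].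
  pose proof ln2_pos as L2.
  (* For n >= 2 one has 2^L <= n+1 <= n^2 and ln 2 <= ln n, so L + 1 <= 3 ln n / ln 2; the second
     constant absorbs a plain 1/n into (ln n)/n. *)
  exists (C1 * (3 / ln 2) + C2 / ln 2), 2%nat. intros n Hn.
  assert (Hn1 : (1 <= n)%nat) by lia.
  pose proof (le_INR 2 n Hn) as Hn2. simpl (INR 2) in Hn2. replace (1 + 1) with 2 in Hn2 by ring.
  set (L := Nat.log2 (n + 1)).
  destruct (Nat.log2_spec (n + 1) ltac:(lia)) as [LS1 LS2]. fold L in LS1, LS2.
  rewrite RtoC_minus, (main_term_Psi n Hn1), (E_n_formula n L LS2).
  set (x := log4 (INR n)).
  set (SR := sum_f_R0 _ L).
  assert (ESR : SR = sum_f_R0 (fun l => level_sum n (2 ^ l)) L) by reflexivity.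
  replace (RtoC (4 / 3 * (INR n + 1) - / 3 * SR) - (RtoC (4 / 3 * (INR n + 1) - / 3 * (Psi x - / 2)) - delta x) - delta x)%C
    with (RtoC (4 / 3 * (INR n + 1) - / 3 * SR) - RtoC (4 / 3 * (INR n + 1) - / 3 * (Psi x - / 2)))%C by ring.
  rewrite <- RtoC_minus, Cmod_R.
  replace (4 / 3 * (INR n + 1) - / 3 * SR - (4 / 3 * (INR n + 1) - / 3 * (Psi x - / 2)))
    with (- / 3 * (SR - (Psi x - / 2))) by ring.
  rewrite Rabs_mult, Rabs_Ropp, (Rabs_pos_eq (/ 3)) by lra.
  specialize (H2 n L Hn1 LS2). fold x in H2. set (SA := sum_f_R0 _ L) in H2.
  assert (Hi : 0 < / INR n) by (apply Rinv_0_lt_compat; lra).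
  (* Each of the L+1 levels contributes an error O(1/n); this is where the logarithm in the error
     term arises. *)
  assert (HS : Rabs (SR - SA) <= (INR L + 1) * (C1 * / INR n)).
  { rewrite ESR. unfold SA. rewrite <- minus_sum. eapply Rle_trans; [apply Rsum_abs|].
    apply Rle_trans with (sum_f_R0 (fun _ => C1 * / INR n) L); [|rewrite sum_cte, S_INR; right; ring].
    apply sum_Rle. intros l _.
    assert (Hl : (1 <= 2 ^ l)%nat) by (pose proof (Nat.pow_nonzero 2 l); lia).
    replace ((INR l - x) * lam) with (2 * ln (INR (2 ^ l)) - ln (INR n)); [now apply H1|].
    rewrite pow_INR. simpl (INR 2). replace (1 + 1) with 2 by ring. rewrite ln_pow by lra.
    unfold x, log4. fold lam. pose proof lam_pos. rewrite lam_eq in *. field. lra. }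
  assert (HL : INR L + 1 <= 3 / ln 2 * ln (INR n)).
  { assert (Hln : ln 2 <= ln (INR n)) by (apply ln_le; lra).
    apply le_INR in LS1. rewrite pow_INR, plus_INR in LS1. simpl (INR 2) in LS1. simpl (INR 1) in LS1.
    replace (1 + 1) with 2 in LS1 by ring.
    assert (Q : INR L * ln 2 <= 2 * ln (INR n)).
    { rewrite <- ln_pow by lra. replace (2 * ln (INR n)) with (ln (INR n * INR n)) by (rewrite ln_mult by lra; ring).
      apply ln_le; [apply pow_lt; lra|]. nra. }
    apply (Rmult_le_reg_r (ln 2)); [assumption|]. replace (3 / ln 2 * ln (INR n) * ln 2) with (3 * ln (INR n)) by (field; lra). lra. }
  assert (HT : Rabs (SR - (Psi x - / 2)) <= (C1 * (3 / ln 2) + C2 / ln 2) * (ln (INR n) / INR n)).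
  { replace (SR - (Psi x - / 2)) with ((SR - SA) + (SA - (Psi x - / 2))) by ring.
    eapply Rle_trans; [apply Rabs_triang|].
    replace ((C1 * (3 / ln 2) + C2 / ln 2) * (ln (INR n) / INR n)) with
      ((3 / ln 2 * ln (INR n)) * (C1 * / INR n) + (ln (INR n) / ln 2) * (C2 * / INR n)) by (field; lra).
    apply Rplus_le_compat.
    - eapply Rle_trans; [apply HS|]. apply Rmult_le_compat_r; [apply Rmult_le_pos; lra|assumption].
    - eapply Rle_trans; [apply H2|]. rewrite <- (Rmult_1_l (C2 * / INR n)) at 1. apply Rmult_le_compat_r; [apply Rmult_le_pos; lra|].
      apply (Rmult_le_reg_r (ln 2)); [assumption|]. replace (ln (INR n) / ln 2 * ln 2) with (ln (INR n)) by (field; lra).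
      rewrite Rmult_1_l. apply ln_le; lra. }
  pose proof (Rabs_pos (SR - (Psi x - / 2))). lra.
Qed.
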